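(* Let $n\in\mathbb{N}$ and let $\omega(z)=cz^n+p_{n-1}z^{n-1}+\cdots+p_0$ be a polynomial with $c\ne0$. If $f$ is a meromorphic function in $\mathbb{C}$ such that $$\limsup_{r\to\infty}\frac{\log\log T(r,f)}{\log r}<\frac{1}{n^2},$$ then $$T(r,f\circ\omega)=(1+o(1))\,T(|c|r^n,f)$$ as $r\to\infty$ outside of a possible exceptional set of finite logarithmic measure.
   Context: $T(r,f)$ is the Nevanlinna characteristic. A set $E\subset[1,\infty)$ has finite logarithmic measure if $\int_E\frac{dt}{t}<\infty$. *)

(* Defs.v *)
From Stdlib Require Import Reals Lra List Classical ClassicalEpsilon.
Open Scope R_scope.

Definition Cx := (R * R)%type.
Definition C0 : Cx := (0, 0).
Definition C1 : Cx := (1, 0).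
Definition Cadd (z w : Cx) : Cx := (fst z + fst w, snd z + snd w).
Definition Copp (z : Cx) : Cx := (- fst z, - snd z).
Definition Csub (z w : Cx) : Cx := Cadd z (Copp w).
Definition Cmul (z w : Cx) : Cx :=
  (fst z * fst w - snd z * snd w, fst z * snd w + snd z * fst w).
Definition Cinv (z : Cx) : Cx :=
  (fst z / (fst z ^ 2 + snd z ^ 2), - snd z / (fst z ^ 2 + snd z ^ 2)).
Definition Cdiv (z w : Cx) : Cx := Cmul z (Cinv w).
Definition Cabs (z : Cx) : R := sqrt (fst z ^ 2 + snd z ^ 2).
Fixpoint Cpow (z : Cx) (k : nat) : Cx :=
  match k with O => C1 | S k => Cmul z (Cpow z k) end.

Definition Cdiff (g : Cx -> Cx) (z : Cx) : Prop :=
  exists L : Cx, forall eps, 0 < eps -> exists delta, 0 < delta /\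
    forall h, 0 < Cabs h < delta ->
      Cabs (Csub (Cdiv (Csub (g (Cadd z h)) (g z)) h) L) < eps.

Definition holo_on_disc (g : Cx -> Cx) (a : Cx) (r : R) : Prop :=
  forall z, Cabs (Csub z a) < r -> Cdiff g z.

(** f is meromorphic in Cx: around every point a, on a punctured disc,
    f = g / (z - a)^k with g holomorphic on the disc (values of f at the
    isolated singular points themselves are irrelevant). *)
Definition meromorphic (f : Cx -> Cx) : Prop :=
  forall a : Cx, exists r, 0 < r /\ exists (k : nat) (g : Cx -> Cx),
    holo_on_disc g a r /\
    forall z, 0 < Cabs (Csub z a) < r -> f z = Cdiv (g z) (Cpow (Csub z a) k).

Definition is_pole (f : Cx -> Cx) (a : Cx) (k : nat) : Prop :=
  (1 <= k)%nat /\ exists r, 0 < r /\ exists g : Cx -> Cx,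
    holo_on_disc g a r /\ g a <> C0 /\
    forall z, 0 < Cabs (Csub z a) < r -> f z = Cdiv (g z) (Cpow (Csub z a) k).

Definition pole_count (f : Cx -> Cx) (t : R) (N : nat) : Prop :=
  exists (l : list Cx) (ks : list nat),
    NoDup l /\
    (forall a, In a l <-> (Cabs a <= t /\ exists k, is_pole f a k)) /\
    Forall2 (is_pole f) l ks /\
    N = fold_right plus O ks.

Definition npoles (f : Cx -> Cx) (t : R) : nat :=
  epsilon (inhabits O) (pole_count f t).

(** Riemann integral of g on [a,b] (0 if g is not Riemann integrable) *)
Definition Rint (g : R -> R) (a b : R) : R :=
  match excluded_middle_informative (inhabited (Riemann_integrable g a b)) with
  | left H => RiemannInt (epsilon H (fun _ => True))
  | right _ => 0
  end.

(** least upper bound of a set of reals (junk if none) *)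
Definition Rsup (S : R -> Prop) : R := epsilon (inhabits 0) (fun v => is_lub S v).

Definition logplus (x : R) : R := Rmax 0 (ln x).

(** proximity function m(r,f) = (1/2pi) int_0^{2pi} log^+ |f(r e^{i theta})| d theta,
    computed as the supremum over M of the Riemann integrals of the truncations
    min(log^+|f|, M) (monotone convergence). *)
Definition prox (f : Cx -> Cx) (r : R) : R :=
  Rsup (fun x => exists M : nat,
    x = / (2 * PI) *
        Rint (fun th => Rmin (logplus (Cabs (f (r * cos th, r * sin th)))) (INR M))
             0 (2 * PI)).

Definition Ncount (f : Cx -> Cx) (r : R) : R :=
  Rint (fun t => (INR (npoles f t) - INR (npoles f 0)) / t) 0 r
  + INR (npoles f 0) * ln r.

Definition T (f : Cx -> Cx) (r : R) : R := prox f r + Ncount f r.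

Fixpoint lower_sum (p : nat -> Cx) (z : Cx) (k : nat) : Cx :=
  match k with
  | O => C0
  | S k => Cadd (lower_sum p z k) (Cmul (p k) (Cpow z k))
  end.

Definition omega (n : nat) (c : Cx) (p : nat -> Cx) (z : Cx) : Cx :=
  Cadd (Cmul c (Cpow z n)) (lower_sum p z n).

Definition finite_log_measure (E : R -> Prop) : Prop :=
  (forall x, E x -> 1 <= x) /\
  exists a b : nat -> R,
    (forall k, 1 <= a k <= b k) /\
    (forall x, E x -> exists k, a k <= x <= b k) /\
    exists l, infinite_sum (fun k => ln (b k / a k)) l.

(* Main.v *)
(** Call a radius good when its circle carries no singular value of [f]; the bad
    radii are countable and are put into the exceptional set. On good circles
    Jensen's formula for polynomials turns [T(r, f o omega)] into the mean of
    [log+ |f o omega|] plus, for each pole [b] of [f], the mean of [log |omega - b|]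
    minus a constant.

    Upper bound: if [|omega| < R] on [|z| = r], integrate over [|z| = r] the
    Poisson-Jensen majorant of [log+ |f|] in [|w| < R], evaluated at [omega z]. Up to
    a factor [1 + o(1)] this bounds [T(r, f o omega)] by [T(R, f)] plus the sum over
    the poles of the differences of the Green functions with centres [omega 0]
    and [0], which by Harnack's inequality is at most [eps N(R, f) + O(1)].

    Lower bound: majorise on [|z| = r] the composition, with its poles removed by
    a Blaschke product in the variable [w], by a Poisson integral, and average it
    over the [n] roots of [omega z = w]. The result is harmonic in [w], and its
    mean over [|w| = rho] gives [T(rho, f) <= (1 + o(1)) T(r, f o omega) + eps T(R, f) + O(1)].

    Both work with [rho = |c| (r - l)^n] and [R = |c| (r + l)^n] for a constant [l].
    Since [log T] grows at most like [r ^ tau] with [tau < 1] along [|c| r^n], the two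
    values of [T f] are asymptotic to each other outside a union of intervals of
    length [l] of finite logarithmic measure. If [T f] is bounded, then [f] is
    constant by Liouville's theorem. *)

From Stdlib Require Import ZArith Reals Lra Lia List Classical ClassicalEpsilon FunctionalExtensionality Permutation.
From Stdlib Require Cantor.
From Coquelicot Require Import Coquelicot.
Require Import Defs.
Open Scope R_scope.

(** * Complex differentiability *)

(** The two comparisons meet different obstacles. In the upper bound the mean over |z| = r of a
    harmonic function of omega z is its value at omega 0, while T(R, f) is normalised at 0. Moving
    the base point costs the Harnack factor (R + |omega 0|) / (R - |omega 0|); for the poles it
    costs a difference of Green functions, in which only the finitely many poles near the origin
    fail to be small against N(R, f). In the lower bound a single root of omega z = w is not a
    holomorphic function of w, because of branching; the sum of a Schwarz integral over all n roots
    is, since it involves the roots only through the logarithmic derivative of omega - w. A constant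
    shift l suffices because |omega z| = |c| |z|^n (1 + O(1 / |z|)). The hypothesis yields sigma
    with n sigma < 1 and log T(|c| r^n, f) = O(r^(n sigma)), which gives the exponent tau. Additive
    constants can be absorbed only when T is unbounded, so bounded T is a separate case. Majorants
    are applied to moduli of holomorphic functions times exp(- schwarz), never to log |f|, so that
    zeros of f need no treatment. *)

Lemma Cmod_minus_sym (z w : C) : Cmod (z - w) = Cmod (w - z).
Proof. rewrite <- (Cmod_opp (z - w)). f_equal. ring. Qed.

Lemma Cmod_triangle3 (a b c : C) : Cmod (a - c) <= Cmod (a - b) + Cmod (b - c).
Proof. replace (a - c)%C with ((a - b) + (b - c))%C by ring. apply Cmod_triangle. Qed.

Lemma Cmod_sub_le (a b : C) : Cmod (a - b) <= Cmod a + Cmod b.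
Proof.
  replace (a - b)%C with (a + - b)%C by ring.
  rewrite <- (Cmod_opp b). apply Cmod_triangle.
Qed.

Lemma Cmod_sub_ge (a b : C) : Cmod a - Cmod b <= Cmod (a - b).
Proof.
  pose proof (Cmod_triangle (a - b) b) as H.
  replace (a - b + b)%C with a in H by ring. lra.
Qed.

Lemma Cmod_pos (z : C) : z <> 0%C -> 0 < Cmod z.
Proof. apply Cmod_gt_0. Qed.

Lemma Cminus_neq_0 (a b : C) : a <> b -> (a - b)%C <> 0%C.
Proof.
  intros H E. apply H. replace a with (a - b + b)%C by ring. rewrite E. ring.
Qed.

Lemma Cminus_eq_0 (a b : C) : (a - b)%C = 0%C -> a = b.
Proof. intros E. replace a with (a - b + b)%C by ring. rewrite E. ring. Qed.

Lemma Cmod_pos_neq (z : C) : 0 < Cmod z -> z <> 0%C.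
Proof. apply Cmod_gt_0. Qed.

Lemma Cx_eq_dec (a b : C) : {a = b} + {a <> b}.
Proof. apply excluded_middle_informative. Qed.

Definition ccont (g : C -> C) (z : C) : Prop :=
  forall eps, 0 < eps -> exists delta, 0 < delta /\
    forall w, Cmod (w - z) < delta -> Cmod (g w - g z) < eps.

(** Caratheodory's form of the derivative: [phi] is the difference quotient, completed by [L] at
    [z]. Product and chain rule become identities between such functions. *)
Definition cderiv (g : C -> C) (z L : C) : Prop :=
  exists phi : C -> C, phi z = L /\ ccont phi z /\
    forall w, g w = (g z + phi w * (w - z))%C.

Lemma ccont_const (c z : C) : ccont (fun _ => c) z.
Proof.
  intros eps He. exists 1. split; [lra|]. intros w _.
  replace (c - c)%C with (RtoC 0) by ring. rewrite Cmod_0. lra.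
Qed.

Lemma ccont_id (z : C) : ccont (fun w => w) z.
Proof. intros eps He. exists eps. auto. Qed.

Lemma ccont_ext_loc (f g : C -> C) (z : C) (d : R) : 0 < d ->
  (forall w, Cmod (w - z) < d -> f w = g w) -> ccont f z -> ccont g z.
Proof.
  intros Hd E H eps He. destruct (H eps He) as [d' [Hd' H']].
  exists (Rmin d d'). split; [apply Rmin_pos; lra|]. intros w Hw.
  pose proof (Rmin_l d d'). pose proof (Rmin_r d d').
  rewrite <- !E; [apply H'; lra| |lra].
  replace (z - z)%C with (RtoC 0) by ring. rewrite Cmod_0. lra.
Qed.

Lemma ccont_plus (f g : C -> C) (z : C) :
  ccont f z -> ccont g z -> ccont (fun w => f w + g w)%C z.
Proof.
  intros Hf Hg eps He.
  destruct (Hf (eps/2)) as [d1 [H1 F1]]; [lra|].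
  destruct (Hg (eps/2)) as [d2 [H2 F2]]; [lra|].
  exists (Rmin d1 d2). split; [apply Rmin_pos; lra|]. intros w Hw.
  pose proof (Rmin_l d1 d2). pose proof (Rmin_r d1 d2).
  specialize (F1 w ltac:(lra)). specialize (F2 w ltac:(lra)).
  replace (f w + g w - (f z + g z))%C with ((f w - f z) + (g w - g z))%C by ring.
  eapply Rle_lt_trans; [apply Cmod_triangle|lra].
Qed.

Lemma ccont_mult (f g : C -> C) (z : C) :
  ccont f z -> ccont g z -> ccont (fun w => f w * g w)%C z.
Proof.
  intros Hf Hg eps He.
  set (M := Cmod (f z) + Cmod (g z) + 1).
  pose proof (Cmod_ge_0 (f z)). pose proof (Cmod_ge_0 (g z)).
  assert (HM : 1 <= M) by (unfold M; lra).
  assert (He' : 0 < eps / (2 * M)) by (apply Rdiv_lt_0_compat; lra).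
  destruct (Hf _ He') as [d1 [H1 F1]].
  destruct (Hg (Rmin 1 (eps / (2 * M)))) as [d2 [H2 F2]]; [apply Rmin_pos; lra|].
  exists (Rmin d1 d2). split; [apply Rmin_pos; lra|]. intros w Hw.
  pose proof (Rmin_l d1 d2). pose proof (Rmin_r d1 d2).
  specialize (F1 w ltac:(lra)). specialize (F2 w ltac:(lra)).
  pose proof (Rmin_l 1 (eps / (2 * M))). pose proof (Rmin_r 1 (eps / (2 * M))).
  replace (f w * g w - f z * g z)%C
    with ((f w - f z) * g w + f z * (g w - g z))%C by ring.
  eapply Rle_lt_trans; [apply Cmod_triangle|]. rewrite !Cmod_mult.
  assert (Hgw : Cmod (g w) <= M).
  { pose proof (Cmod_triangle (g w - g z) (g z)) as Ht.
    replace (g w - g z + g z)%C with (g w) in Ht by ring. unfold M. lra. }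
  assert (Hfz : Cmod (f z) <= M) by (unfold M; lra).
  pose proof (Cmod_ge_0 (g w)). pose proof (Cmod_ge_0 (f w - f z)).
  pose proof (Cmod_ge_0 (g w - g z)).
  assert (Cmod (f w - f z) * Cmod (g w) <= Cmod (f w - f z) * M) by nra.
  assert (Cmod (f z) * Cmod (g w - g z) <= M * Cmod (g w - g z)) by nra.
  assert (Ee : eps = M * (eps / (2 * M)) + M * (eps / (2 * M))) by (field; lra).
  nra.
Qed.

Lemma ccont_opp (f : C -> C) (z : C) : ccont f z -> ccont (fun w => - f w)%C z.
Proof.
  intros H. apply (ccont_ext_loc (fun w => - RtoC 1 * f w)%C _ z 1); [lra| |].
  - intros w _. ring.
  - apply ccont_mult; [apply ccont_const|auto].
Qed.

Lemma ccont_minus (f g : C -> C) (z : C) :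
  ccont f z -> ccont g z -> ccont (fun w => f w - g w)%C z.
Proof. intros. apply ccont_plus; [|apply ccont_opp]; auto. Qed.

Lemma ccont_neq_loc (f : C -> C) (z c : C) : ccont f z -> f z <> c ->
  exists d, 0 < d /\ forall w, Cmod (w - z) < d -> f w <> c.
Proof.
  intros H Hc. destruct (H (Cmod (f z - c))) as [d [Hd F]].
  { apply Cmod_pos, Cminus_neq_0; auto. }
  exists d. split; auto. intros w Hw E. specialize (F w Hw).
  rewrite E, Cmod_minus_sym in F. lra.
Qed.

Lemma ccont_inv (f : C -> C) (z : C) :
  ccont f z -> f z <> 0%C -> ccont (fun w => / f w)%C z.
Proof.
  intros Hf Hz eps He.
  pose proof (Cmod_pos _ Hz) as Hm. set (m := Cmod (f z)) in *.
  destruct (Hf (Rmin (m/2) (eps * (m * m / 2)))) as [d [Hd F]].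
  { apply Rmin_pos; [lra|]. repeat apply Rmult_lt_0_compat; lra. }
  exists d. split; auto. intros w Hw. specialize (F w Hw).
  pose proof (Rmin_l (m/2) (eps * (m * m / 2))).
  pose proof (Rmin_r (m/2) (eps * (m * m / 2))).
  assert (Hfw : m / 2 < Cmod (f w)).
  { pose proof (Cmod_sub_ge (f z) (f z - f w)) as Ht.
    replace (f z - (f z - f w))%C with (f w) in Ht by ring.
    rewrite (Cmod_minus_sym (f z)) in Ht. fold m in Ht. lra. }
  assert (f w <> 0%C) by (apply Cmod_pos_neq; lra).
  replace (/ f w - / f z)%C with ((f z - f w) / (f w * f z))%C by (field; auto).
  rewrite Cmod_div by (apply Cmult_neq_0; auto).
  rewrite Cmod_mult, Cmod_minus_sym. fold m.
  assert (Hp : m * m / 2 < Cmod (f w) * m) by nra.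
  assert (0 < m * m) by nra.
  apply Rmult_lt_reg_r with (Cmod (f w) * m); [lra|].
  unfold Rdiv. rewrite Rmult_assoc, Rinv_l by lra. nra.
Qed.

Lemma ccont_div (f g : C -> C) (z : C) :
  ccont f z -> ccont g z -> g z <> 0%C -> ccont (fun w => f w / g w)%C z.
Proof. intros. apply ccont_mult; [|apply ccont_inv]; auto. Qed.

Lemma ccont_comp (f g : C -> C) (z : C) :
  ccont g z -> ccont f (g z) -> ccont (fun w => f (g w)) z.
Proof.
  intros Hg Hf eps He. destruct (Hf eps He) as [d [Hd F]].
  destruct (Hg d Hd) as [d' [Hd' G]]. exists d'. auto.
Qed.

Lemma ccont_limit_unique (f g : C -> C) (z : C) (d : R) : 0 < d ->
  ccont f z -> ccont g z ->
  (forall w, 0 < Cmod (w - z) < d -> f w = g w) -> f z = g z.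
Proof.
  intros Hd Hf Hg E. apply NNPP. intros Hne.
  destruct (ccont_neq_loc (fun w => f w - g w)%C z 0) as [d' [Hd' F]].
  { apply ccont_minus; auto. }
  { apply Cminus_neq_0; auto. }
  set (t := Rmin d d' / 2).
  pose proof (Rmin_l d d'). pose proof (Rmin_r d d').
  assert (0 < Rmin d d') by (apply Rmin_pos; lra).
  assert (Ht : Cmod (z + RtoC t - z) = t).
  { replace (z + RtoC t - z)%C with (RtoC t) by ring.
    rewrite Cmod_R. apply Rabs_pos_eq. unfold t; lra. }
  apply (F (z + RtoC t)%C).
  - rewrite Ht. unfold t; lra.
  - rewrite E; [ring|]. rewrite Ht. unfold t; lra.
Qed.

Lemma cderiv_alt (g : C -> C) (z L : C) :
  (forall eps, 0 < eps -> exists delta, 0 < delta /\ forall w,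
     Cmod (w - z) < delta ->
     Cmod (g w - g z - L * (w - z)) <= eps * Cmod (w - z)) ->
  cderiv g z L.
Proof.
  intros H.
  exists (fun w => match Cx_eq_dec w z with
            | left _ => L | right _ => ((g w - g z) / (w - z))%C end).
  split; [|split].
  - destruct (Cx_eq_dec z z); congruence.
  - intros eps He. destruct (H (eps/2)) as [d [Hd F]]; [lra|].
    exists d. split; auto. intros w Hw.
    destruct (Cx_eq_dec z z) as [_|]; [|congruence].
    destruct (Cx_eq_dec w z) as [->|Hne].
    + replace (L - L)%C with (RtoC 0) by ring. rewrite Cmod_0. lra.
    + pose proof (Cminus_neq_0 _ _ Hne) as Hn. specialize (F w Hw).
      replace ((g w - g z) / (w - z) - L)%C
        with ((g w - g z - L * (w - z)) / (w - z))%C by (field; auto).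
      rewrite Cmod_div by auto. pose proof (Cmod_pos _ Hn).
      apply Rle_lt_trans with (eps / 2); [|lra].
      apply Rmult_le_reg_r with (Cmod (w - z)); auto.
      unfold Rdiv at 1. rewrite Rmult_assoc, Rinv_l by lra. lra.
  - intros w. destruct (Cx_eq_dec w z) as [->|Hne]; [ring|].
    field. apply Cminus_neq_0; auto.
Qed.

Lemma cderiv_approx (g : C -> C) (z L : C) : cderiv g z L ->
  forall eps, 0 < eps -> exists delta, 0 < delta /\ forall w,
     Cmod (w - z) < delta ->
     Cmod (g w - g z - L * (w - z)) <= eps * Cmod (w - z).
Proof.
  intros [phi [E [Hc F]]] eps He. destruct (Hc eps He) as [d [Hd G]].
  exists d. split; auto. intros w Hw. specialize (G w Hw).
  rewrite (F w), <- E.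
  replace (g z + phi w * (w - z) - g z - phi z * (w - z))%C
    with ((phi w - phi z) * (w - z))%C by ring.
  rewrite Cmod_mult. apply Rmult_le_compat_r; [apply Cmod_ge_0|lra].
Qed.

Lemma Cdiff_cderiv (g : C -> C) (z : C) :
  Cdiff g z <-> exists L, cderiv g z L.
Proof.
  split.
  (* [Cx] and [C] are the same type of pairs, and the field operations of the statement are
     convertible to those of [C]; this is what the [change] steps use. *)
  - intros [L H]. change Cx with C in L. exists L. apply cderiv_alt. intros eps He.
    destruct (H eps He) as [d [Hd F]]. exists d. split; auto. intros w Hw.
    destruct (Cx_eq_dec w z) as [->|Hne].
    + replace (g z - g z - L * (z - z))%C with (RtoC 0) by ring.
      replace (z - z)%C with (RtoC 0) by ring. rewrite Cmod_0. lra.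
    + pose proof (Cminus_neq_0 _ _ Hne) as Hn. pose proof (Cmod_pos _ Hn).
      specialize (F (w - z)%C (conj H0 Hw)).
      change (Cmod ((g (z + (w - z)) - g z) / (w - z) - L)%C < eps) in F.
      replace (z + (w - z))%C with w in F by ring.
      replace (g w - g z - L * (w - z))%C
        with (((g w - g z) / (w - z) - L) * (w - z))%C by (field; auto).
      rewrite Cmod_mult. apply Rmult_le_compat_r; lra.
  - intros [L H]. exists L. intros eps He.
    destruct (cderiv_approx _ _ _ H (eps/2)) as [d [Hd F]]; [lra|].
    exists d. split; auto. intros h Hh. change Cx with C in h.
    change (0 < Cmod h < d) in Hh.
    specialize (F (z + h)%C).
    change (Cmod ((g (z + h) - g z) / h - L)%C < eps).
    replace (z + h - z)%C with h in F by ring. specialize (F ltac:(lra)).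
    assert (h <> 0%C) by (apply Cmod_pos_neq; lra).
    replace ((g (z + h) - g z) / h - L)%C
      with ((g (z + h) - g z - L * h) / h)%C by (field; auto).
    rewrite Cmod_div by auto.
    apply Rle_lt_trans with (eps / 2); [|lra].
    apply Rmult_le_reg_r with (Cmod h); [lra|].
    unfold Rdiv at 1. rewrite Rmult_assoc, Rinv_l by lra. lra.
Qed.

Lemma cderiv_ccont (g : C -> C) (z L : C) : cderiv g z L -> ccont g z.
Proof.
  intros [phi [E [Hc F]]].
  apply (ccont_ext_loc (fun w => g z + phi w * (w - z))%C _ z 1); [lra| |].
  - intros; symmetry; auto.
  - apply ccont_plus; [apply ccont_const|]. apply ccont_mult; auto.
    apply ccont_minus; [apply ccont_id|apply ccont_const].
Qed.

Lemma cderiv_unique (g : C -> C) (z L L' : C) :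
  cderiv g z L -> cderiv g z L' -> L = L'.
Proof.
  intros [phi [<- [Hc F]]] [phi' [<- [Hc' F']]].
  apply (ccont_limit_unique phi phi' z 1); auto; [lra|].
  intros w [Hw _]. apply Cmod_pos_neq in Hw.
  specialize (F w). rewrite F' in F.
  replace (phi w) with ((g z + phi w * (w - z) - g z) / (w - z))%C by (field; auto).
  rewrite <- F. field; auto.
Qed.

Lemma cderiv_ext_loc (f g : C -> C) (z L : C) (d : R) : 0 < d ->
  (forall w, Cmod (w - z) < d -> f w = g w) -> cderiv f z L -> cderiv g z L.
Proof.
  intros Hd E H. apply cderiv_alt. intros eps He.
  destruct (cderiv_approx _ _ _ H eps He) as [d' [Hd' F]].
  exists (Rmin d d'). split; [apply Rmin_pos; lra|]. intros w Hw.
  pose proof (Rmin_l d d'). pose proof (Rmin_r d d').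
  rewrite <- !E; [apply F; lra| |lra].
  replace (z - z)%C with (RtoC 0) by ring. rewrite Cmod_0. lra.
Qed.

Lemma cderiv_const (c z : C) : cderiv (fun _ => c) z 0.
Proof.
  exists (fun _ => 0%C). repeat split; [apply ccont_const|]. intros; ring.
Qed.

Lemma cderiv_id (z : C) : cderiv (fun w => w) z 1.
Proof.
  exists (fun _ => 1%C). repeat split; [apply ccont_const|]. intros; ring.
Qed.

Lemma cderiv_plus (f g : C -> C) (z A B : C) :
  cderiv f z A -> cderiv g z B -> cderiv (fun w => f w + g w)%C z (A + B)%C.
Proof.
  intros [p [E1 [C1 F1]]] [q [E2 [C2 F2]]].
  exists (fun w => p w + q w)%C. split; [congruence|]. split.
  - apply ccont_plus; auto.
  - intros w. rewrite (F1 w), (F2 w). ring.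
Qed.

Lemma cderiv_mult (f g : C -> C) (z A B : C) :
  cderiv f z A -> cderiv g z B ->
  cderiv (fun w => f w * g w)%C z (A * g z + f z * B)%C.
Proof.
  intros Hf Hg. pose proof (cderiv_ccont _ _ _ Hg) as Hgc.
  destruct Hf as [p [E1 [C1 F1]]]. destruct Hg as [q [E2 [C2 F2]]].
  exists (fun w => p w * g w + f z * q w)%C. split; [congruence|]. split.
  - apply ccont_plus; apply ccont_mult; auto. apply ccont_const.
  - intros w. rewrite (F1 w). rewrite (F2 w) at 1 2. ring.
Qed.

Lemma cderiv_comp (f g : C -> C) (z A B : C) :
  cderiv g z B -> cderiv f (g z) A -> cderiv (fun w => f (g w)) z (A * B)%C.
Proof.
  intros Hg Hf. pose proof (cderiv_ccont _ _ _ Hg) as Hgc.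
  destruct Hf as [p [E1 [C1 F1]]]. destruct Hg as [q [E2 [C2 F2]]].
  exists (fun w => p (g w) * q w)%C. split; [congruence|]. split.
  - apply ccont_mult; auto. apply (ccont_comp p g); auto.
  - intros w. rewrite (F1 (g w)) at 1. rewrite (F2 w) at 2. ring.
Qed.

Lemma cderiv_inv (z : C) : z <> 0%C -> cderiv (fun w => / w)%C z (- / (z * z))%C.
Proof.
  intros Hz.
  (* Caratheodory's identity must hold at every [w], also at 0; there the function is first replaced
     by its tangent at [z], which changes nothing near [z]. *)
  apply (cderiv_ext_loc (fun w => match Cx_eq_dec w 0 with left _ => (/ z - (w - z) / (z * z))%C
     | right _ => / w end)%C _ z _ (Cmod z)).
  { apply Cmod_pos; auto. }
  { intros w Hw. destruct (Cx_eq_dec w 0) as [->|]; auto.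
    exfalso. replace (0 - z)%C with (- z)%C in Hw by ring.
    rewrite Cmod_opp in Hw. lra. }
  exists (fun w => match Cx_eq_dec w 0 with left _ => (- / (z * z))%C
     | right _ => (- / (w * z))%C end). split; [|split].
  - destruct (Cx_eq_dec z 0); [contradiction|auto].
  - apply (ccont_ext_loc (fun w => - / (w * z))%C _ z (Cmod z)).
    + apply Cmod_pos; auto.
    + intros w Hw. destruct (Cx_eq_dec w 0) as [->|]; auto.
      exfalso. replace (0 - z)%C with (- z)%C in Hw by ring.
      rewrite Cmod_opp in Hw. lra.
    + apply ccont_opp, ccont_inv; [|apply Cmult_neq_0; auto].
      apply ccont_mult; [apply ccont_id|apply ccont_const].
  - intros w. destruct (Cx_eq_dec z 0); [contradiction|].
    destruct (Cx_eq_dec w 0) as [->|]; field; auto.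
Qed.

Lemma Cdiff_const (c z : C) : Cdiff (fun _ => c) z.
Proof. apply Cdiff_cderiv. eexists. apply cderiv_const. Qed.

Lemma Cdiff_id (z : C) : Cdiff (fun w => w) z.
Proof. apply Cdiff_cderiv. eexists. apply cderiv_id. Qed.

Lemma Cdiff_plus (f g : C -> C) (z : C) :
  Cdiff f z -> Cdiff g z -> Cdiff (fun w => f w + g w)%C z.
Proof.
  rewrite !Cdiff_cderiv. intros [A HA] [B HB]. eexists. apply cderiv_plus; eauto.
Qed.

Lemma Cdiff_mult (f g : C -> C) (z : C) :
  Cdiff f z -> Cdiff g z -> Cdiff (fun w => f w * g w)%C z.
Proof.
  rewrite !Cdiff_cderiv. intros [A HA] [B HB]. eexists. apply cderiv_mult; eauto.
Qed.

Lemma Cdiff_comp (f g : C -> C) (z : C) :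
  Cdiff g z -> Cdiff f (g z) -> Cdiff (fun w => f (g w)) z.
Proof.
  rewrite !Cdiff_cderiv. intros [A HA] [B HB]. eexists. eapply cderiv_comp; eauto.
Qed.

Lemma Cdiff_ext_loc (f g : C -> C) (z : C) (d : R) : 0 < d ->
  (forall w, Cmod (w - z) < d -> f w = g w) -> Cdiff f z -> Cdiff g z.
Proof.
  rewrite !Cdiff_cderiv. intros Hd E [A HA]. exists A. eapply cderiv_ext_loc; eauto.
Qed.

Lemma Cdiff_opp (f : C -> C) (z : C) : Cdiff f z -> Cdiff (fun w => - f w)%C z.
Proof.
  intros H. apply (Cdiff_ext_loc (fun w => - RtoC 1 * f w)%C _ z 1); [lra| |].
  - intros w _. ring.
  - apply Cdiff_mult; [apply Cdiff_const|auto].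
Qed.

Lemma Cdiff_minus (f g : C -> C) (z : C) :
  Cdiff f z -> Cdiff g z -> Cdiff (fun w => f w - g w)%C z.
Proof. intros. apply Cdiff_plus; [|apply Cdiff_opp]; auto. Qed.

Lemma Cdiff_inv (f : C -> C) (z : C) :
  Cdiff f z -> f z <> 0%C -> Cdiff (fun w => / f w)%C z.
Proof.
  intros H Hz. apply (Cdiff_comp (fun w => / w)%C f); auto.
  apply Cdiff_cderiv. eexists. apply cderiv_inv; auto.
Qed.

Lemma Cdiff_div (f g : C -> C) (z : C) :
  Cdiff f z -> Cdiff g z -> g z <> 0%C -> Cdiff (fun w => f w / g w)%C z.
Proof. intros. apply Cdiff_mult; [|apply Cdiff_inv]; auto. Qed.

Lemma Cdiff_ccont (g : C -> C) (z : C) : Cdiff g z -> ccont g z.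
Proof. rewrite Cdiff_cderiv. intros [L H]. eapply cderiv_ccont; eauto. Qed.

(** * Continuity and integrals of complex-valued functions of a real variable *)

Definition rcont (g : R -> C) (t : R) : Prop :=
  continuous (fun s => fst (g s)) t /\ continuous (fun s => snd (g s)) t.

Lemma continuous_eps (f : R -> R) (t : R) : continuous f t <->
  forall eps, 0 < eps -> exists delta, 0 < delta /\
    forall s, Rabs (s - t) < delta -> Rabs (f s - f t) < eps.
Proof.
  split.
  - intros H eps He.
    apply continuity_pt_filterlim in H. destruct (H eps He) as [d [Hd F]].
    exists d. split; auto. intros s Hs. destruct (Req_dec s t) as [->|Hne].
    + unfold Rminus. rewrite Rplus_opp_r, Rabs_R0. auto.
    + apply (F s). split; [split; [exact I|auto]|auto].
  - intros H. apply continuity_pt_filterlim. intros eps He.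
    destruct (H eps He) as [d [Hd F]]. exists d. split; auto.
    intros s [_ Hs]. apply F, Hs.
Qed.

Lemma continuous_Rmult (f g : R -> R) (t : R) :
  continuous f t -> continuous g t -> continuous (fun s => f s * g s) t.
Proof. exact (continuous_mult (K := R_AbsRing) f g t). Qed.

Lemma rcont_eps (g : R -> C) (t : R) : rcont g t <->
  forall eps, 0 < eps -> exists delta, 0 < delta /\
    forall s, Rabs (s - t) < delta -> Cmod (g s - g t) < eps.
Proof.
  split.
  - intros [H1 H2] eps He. rewrite continuous_eps in H1, H2.
    destruct (H1 (eps/2)) as [d1 [Hd1 F1]]; [lra|].
    destruct (H2 (eps/2)) as [d2 [Hd2 F2]]; [lra|].
    exists (Rmin d1 d2). split; [apply Rmin_pos; lra|]. intros s Hs.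
    pose proof (Rmin_l d1 d2). pose proof (Rmin_r d1 d2).
    specialize (F1 s ltac:(lra)). specialize (F2 s ltac:(lra)).
    eapply Rle_lt_trans; [apply Cmod_2Rmax|].
    assert (Hs2 : sqrt 2 < 2).
    { replace 2 with (sqrt (2 * 2)) at 2 by (apply sqrt_square; lra).
      apply sqrt_lt_1; lra. }
    assert (0 <= sqrt 2) by apply sqrt_pos.
    assert (Rmax (Rabs (fst (g s - g t)%C)) (Rabs (snd (g s - g t)%C)) < eps / 2)
      by (apply Rmax_lub_lt; auto).
    pose proof (Rabs_pos (fst (g s - g t)%C)).
    pose proof (Rmax_l (Rabs (fst (g s - g t)%C)) (Rabs (snd (g s - g t)%C))). nra.
  - intros H. split; apply continuous_eps; intros eps He;
      destruct (H eps He) as [d [Hd F]]; exists d; (split; [auto|]); intros s Hs;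
      specialize (F s Hs); pose proof (Rmax_Cmod (g s - g t)%C) as Hm.
    + eapply Rle_lt_trans; [|exact F]. eapply Rle_trans; [|exact Hm]. apply Rmax_l.
    + eapply Rle_lt_trans; [|exact F]. eapply Rle_trans; [|exact Hm]. apply Rmax_r.
Qed.

Lemma rcont_comp (g : C -> C) (p : R -> C) (t : R) :
  rcont p t -> ccont g (p t) -> rcont (fun s => g (p s)) t.
Proof.
  rewrite !rcont_eps. intros Hp Hg eps He.
  destruct (Hg eps He) as [d [Hd F]]. destruct (Hp d Hd) as [d' [Hd' G]].
  exists d'. auto.
Qed.

Lemma rcont_const (c : C) (t : R) : rcont (fun _ => c) t.
Proof. split; apply continuous_const. Qed.

Lemma rcont_pair (u v : R -> R) (t : R) :
  continuous u t -> continuous v t -> rcont (fun s => (u s, v s) : C) t.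
Proof. split; auto. Qed.

Lemma rcont_plus (f g : R -> C) (t : R) :
  rcont f t -> rcont g t -> rcont (fun s => f s + g s)%C t.
Proof.
  intros [] []. split; simpl.
  - apply (continuous_plus (fun s => fst (f s)) (fun s => fst (g s))); auto.
  - apply (continuous_plus (fun s => snd (f s)) (fun s => snd (g s))); auto.
Qed.

Lemma rcont_parts (f : R -> C) (t : R) : rcont f t ->
  continuous (fun s => fst (f s)) t /\ continuous (fun s => snd (f s)) t.
Proof. auto. Qed.

Lemma rcont_opp (f : R -> C) (t : R) : rcont f t -> rcont (fun s => - f s)%C t.
Proof.
  intros []. split; simpl.
  - apply (continuous_opp (fun s => fst (f s))); auto.
  - apply (continuous_opp (fun s => snd (f s))); auto.
Qed.

Lemma rcont_minus (f g : R -> C) (t : R) :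
  rcont f t -> rcont g t -> rcont (fun s => f s - g s)%C t.
Proof. intros. apply rcont_plus; [|apply rcont_opp]; auto. Qed.

Lemma rcont_mult (f g : R -> C) (t : R) :
  rcont f t -> rcont g t -> rcont (fun s => f s * g s)%C t.
Proof.
  intros [] []. split; simpl.
  - apply (continuous_minus (fun s => fst (f s) * fst (g s)) (fun s => snd (f s) * snd (g s)));
      apply continuous_Rmult; auto.
  - apply (continuous_plus (fun s => fst (f s) * snd (g s)) (fun s => snd (f s) * fst (g s)));
      apply continuous_Rmult; auto.
Qed.

Lemma rcont_inv (f : R -> C) (t : R) :
  rcont f t -> f t <> 0%C -> rcont (fun s => / f s)%C t.
Proof.
  intros H Hz. apply (rcont_comp (fun w => / w)%C f); auto.
  apply ccont_inv; auto. apply ccont_id.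
Qed.

Lemma rcont_div (f g : R -> C) (t : R) :
  rcont f t -> rcont g t -> g t <> 0%C -> rcont (fun s => f s / g s)%C t.
Proof. intros. apply rcont_mult; [|apply rcont_inv]; auto. Qed.

Lemma rcont_Cmod (f : R -> C) (t : R) : rcont f t -> continuous (fun s => Cmod (f s)) t.
Proof.
  rewrite rcont_eps, continuous_eps. intros H eps He.
  destruct (H eps He) as [d [Hd F]]. exists d. split; auto. intros s Hs.
  specialize (F s Hs). pose proof (Cmod_sub_ge (f s) (f t)).
  pose proof (Cmod_sub_ge (f t) (f s)) as H1. rewrite Cmod_minus_sym in H1.
  apply Rabs_def1; lra.
Qed.

Global Opaque rcont.

Definition CInt (g : R -> C) (a b : R) : C :=
  (RInt (fun t => fst (g t)) a b, RInt (fun t => snd (g t)) a b).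

Definition rcont_on (g : R -> C) (a b : R) : Prop := forall t, a <= t <= b -> rcont g t.

Lemma ex_RInt_cont (f : R -> R) (a b : R) : a <= b ->
  (forall t, a <= t <= b -> continuous f t) -> ex_RInt f a b.
Proof.
  intros Hab H. apply (ex_RInt_continuous (V := R_CompleteNormedModule)).
  rewrite Rmin_left, Rmax_right by lra. auto.
Qed.

Lemma rcont_on_ex (g : R -> C) (a b : R) : a <= b -> rcont_on g a b ->
  ex_RInt (fun t => fst (g t)) a b /\ ex_RInt (fun t => snd (g t)) a b.
Proof. intros Hab H. split; apply ex_RInt_cont; auto; intros t Ht; apply rcont_parts, H; auto. Qed.

Ltac as_R := match goal with |- @eq _ ?a ?b => change (@eq R a b) end.

Lemma RInt_eq (f g : R -> R) (a b : R) : a <= b ->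
  (forall t, a < t < b -> f t = g t) -> RInt f a b = RInt g a b.
Proof.
  intros Hab E. apply RInt_ext. rewrite Rmin_left, Rmax_right by lra. auto.
Qed.

Lemma CInt_ext (f g : R -> C) (a b : R) : a <= b ->
  (forall t, a < t < b -> f t = g t) -> CInt f a b = CInt g a b.
Proof.
  intros Hab E. unfold CInt. f_equal; apply RInt_eq; auto; intros; rewrite E; auto.
Qed.

Lemma CInt_plus (f g : R -> C) (a b : R) : a <= b -> rcont_on f a b -> rcont_on g a b ->
  CInt (fun t => f t + g t)%C a b = (CInt f a b + CInt g a b)%C.
Proof.
  intros Hab Hf Hg. destruct (rcont_on_ex f a b), (rcont_on_ex g a b); auto.
  unfold CInt, Cplus. simpl. f_equal.
  - apply (RInt_plus (V := R_CompleteNormedModule) (fun t => fst (f t)) (fun t => fst (g t))); auto.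
  - apply (RInt_plus (V := R_CompleteNormedModule) (fun t => snd (f t)) (fun t => snd (g t))); auto.
Qed.

Lemma RInt_lin (f g : R -> R) (a b u v : R) : ex_RInt f a b -> ex_RInt g a b ->
  RInt (fun t => u * f t + v * g t) a b = u * RInt f a b + v * RInt g a b.
Proof.
  intros Hf Hg. apply is_RInt_unique.
  apply (is_RInt_plus (V := R_NormedModule) (fun t => u * f t) (fun t => v * g t)).
  - apply (is_RInt_scal (V := R_NormedModule) f). apply (RInt_correct f); auto.
  - apply (is_RInt_scal (V := R_NormedModule) g). apply (RInt_correct g); auto.
Qed.

Lemma CInt_scal (c : C) (f : R -> C) (a b : R) : a <= b -> rcont_on f a b ->
  CInt (fun t => c * f t)%C a b = (c * CInt f a b)%C.
Proof.
  intros Hab Hf. destruct (rcont_on_ex f a b); auto.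
  unfold CInt, Cmult. simpl. f_equal.
  - rewrite <- (RInt_eq (fun t => fst c * fst (f t) + (- snd c) * snd (f t))); auto.
    + rewrite RInt_lin; auto. as_R. ring.
    + intros; ring.
  - apply (RInt_lin (fun t => snd (f t)) (fun t => fst (f t))); auto.
Qed.

Lemma CInt_opp (f : R -> C) (a b : R) : a <= b -> rcont_on f a b ->
  CInt (fun t => - f t)%C a b = (- CInt f a b)%C.
Proof.
  intros Hab Hf.
  rewrite <- (CInt_ext (fun t => - RtoC 1 * f t)%C); [|auto|intros; ring].
  rewrite CInt_scal; auto. ring.
Qed.

Lemma CInt_minus (f g : R -> C) (a b : R) : a <= b -> rcont_on f a b -> rcont_on g a b ->
  CInt (fun t => f t - g t)%C a b = (CInt f a b - CInt g a b)%C.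
Proof.
  intros Hab Hf Hg. unfold Cminus.
  rewrite (CInt_plus f (fun t => - g t)%C), CInt_opp; auto.
  intros t Ht. apply rcont_opp; auto.
Qed.

Lemma CInt_Chasles (f : R -> C) (a b c : R) : a <= b -> b <= c -> rcont_on f a c ->
  (CInt f a b + CInt f b c)%C = CInt f a c.
Proof.
  intros Hab Hbc Hf. unfold CInt, Cplus. simpl. f_equal.
  - apply (RInt_Chasles (V := R_CompleteNormedModule) (fun t => fst (f t)));
      apply ex_RInt_cont; auto; intros t Ht; apply rcont_parts, Hf; lra.
  - apply (RInt_Chasles (V := R_CompleteNormedModule) (fun t => snd (f t)));
      apply ex_RInt_cont; auto; intros t Ht; apply rcont_parts, Hf; lra.
Qed.

Lemma CInt_const (c : C) (a b : R) : CInt (fun _ => c) a b = (RtoC (b - a) * c)%C.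
Proof.
  unfold CInt. rewrite !RInt_const. unfold scal; simpl. unfold mult; simpl.
  unfold Cmult; simpl. f_equal; ring.
Qed.

(* Rotating the integral to the positive real axis reduces the bound to the
   real case. *)
Lemma Cmod_CInt_le (f : R -> C) (a b M : R) : a <= b -> rcont_on f a b ->
  (forall t, a <= t <= b -> Cmod (f t) <= M) -> Cmod (CInt f a b) <= M * (b - a).
Proof.
  intros Hab Hf HM. set (I := CInt f a b).
  destruct (rcont_on_ex f a b) as [E1 E2]; auto.
  assert (Hm : Cmod I ^ 2 = RInt (fun t => fst I * fst (f t) + snd I * snd (f t)) a b).
  { rewrite RInt_lin; auto. rewrite Cmod2_alt. unfold Re, Im, I, CInt. simpl. ring. }
  assert (Hle : RInt (fun t => fst I * fst (f t) + snd I * snd (f t)) a b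
                <= RInt (fun _ => Cmod I * M) a b).
  { apply RInt_le; auto.
    - apply (ex_RInt_plus (V := R_NormedModule) (fun t => fst I * fst (f t)) (fun t => snd I * snd (f t))).
      + apply (ex_RInt_scal (V := R_NormedModule) (fun t => fst (f t))); auto.
      + apply (ex_RInt_scal (V := R_NormedModule) (fun t => snd (f t))); auto.
    - apply ex_RInt_const.
    - intros t Ht. apply Rle_trans with (Cmod (Cconj I * f t)%C).
      + replace (fst I * fst (f t) + snd I * snd (f t)) with (Re (Cconj I * f t)%C)
          by (unfold Re, Cconj, Cmult; simpl; ring).
        eapply Rle_trans; [apply Rle_abs|apply re_le_Cmod].
      + rewrite Cmod_mult, Cmod_conj. apply Rmult_le_compat_l; [apply Cmod_ge_0|].
        apply HM; lra. }
  rewrite <- Hm, RInt_const in Hle.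
  change (Cmod I ^ 2 <= (b - a) * (Cmod I * M)) in Hle.
  destruct (Req_dec (Cmod I) 0) as [E|E].
  - rewrite E. apply Rmult_le_pos; [|lra].
    apply Rle_trans with (Cmod (f a)); [apply Cmod_ge_0|apply HM; lra].
  - pose proof (Cmod_ge_0 I). apply Rmult_le_reg_l with (Cmod I); [lra|]. simpl in Hle. lra.
Qed.

(** * Bisection and Goursat's lemma *)

Section Bisection.
Variables (x0 y0 w h : R) (P : nat -> R -> R -> Prop).
Hypothesis Hw : 0 <= w.
Hypothesis Hh : 0 <= h.

(** At level [k] the point (x, y) stands for the rectangle with this lower left corner and with
    sides [w / 2 ^ k] and [h / 2 ^ k]. *)
Let inR k x y := x0 <= x /\ x + w / 2 ^ k <= x0 + w /\ y0 <= y /\ y + h / 2 ^ k <= y0 + h.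

Hypothesis Hsplit : forall k x y, inR k x y ->
  P (S k) x y -> P (S k) (x + w / 2 ^ S k) y -> P (S k) x (y + h / 2 ^ S k) ->
  P (S k) (x + w / 2 ^ S k) (y + h / 2 ^ S k) -> P k x y.
Hypothesis Hloc : forall px py, x0 <= px <= x0 + w -> y0 <= py <= y0 + h ->
  exists delta, 0 < delta /\ forall k x y, inR k x y ->
    x <= px <= x + w / 2 ^ k -> y <= py <= y + h / 2 ^ k ->
    w / 2 ^ k < delta -> h / 2 ^ k < delta -> P k x y.

Let half k (v : R) : v / 2 ^ k = v / 2 ^ S k + v / 2 ^ S k.
Proof. simpl. field. apply pow_nonzero; lra. Qed.

Let bad k (q : R * R) := inR k (fst q) (snd q) /\ ~ P k (fst q) (snd q).
Let child k (q q' : R * R) :=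
  fst q <= fst q' /\ fst q' + w / 2 ^ S k <= fst q + w / 2 ^ k /\
  snd q <= snd q' /\ snd q' + h / 2 ^ S k <= snd q + h / 2 ^ k.

Let bad_child k q : bad k q -> exists q', bad (S k) q' /\ child k q q'.
Proof.
  destruct q as [x y]. intros [[Hx1 [Hx2 [Hy1 Hy2]]] HP]. unfold bad, child, inR in *. cbn [fst snd] in *.
  apply NNPP. intros Hno. apply HP.
  assert (0 < 2 ^ S k) by (apply pow_lt; lra).
  assert (0 <= w / 2 ^ S k) by (apply Rdiv_le_0_compat; [lra|apply pow_lt; lra]).
  assert (0 <= h / 2 ^ S k) by (apply Rdiv_le_0_compat; [lra|apply pow_lt; lra]).
  pose proof (half k w). pose proof (half k h).
  apply Hsplit; [unfold inR; repeat split; lra| | | |]; apply NNPP; intros HnP; apply Hno.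
  - exists (x, y). cbn [fst snd]. repeat split; auto; lra.
  - exists (x + w / 2 ^ S k, y). cbn [fst snd]. repeat split; auto; lra.
  - exists (x, y + h / 2 ^ S k). cbn [fst snd]. repeat split; auto; lra.
  - exists (x + w / 2 ^ S k, y + h / 2 ^ S k). cbn [fst snd]. repeat split; auto; lra.
Qed.

Let nested (u : nat -> R) (v : R) : 0 <= v ->
  (forall k, u k <= u (S k) /\ u (S k) + v / 2 ^ S k <= u k + v / 2 ^ k) ->
  exists p, forall k, u k <= p <= u k + v / 2 ^ k.
Proof.
  intros Hv Hu.
  assert (H1 : forall k j, u k <= u (j + k)%nat /\ u (j + k)%nat + v / 2 ^ (j + k) <= u k + v / 2 ^ k).
  { intros k j. induction j as [|j IH]; [simpl; split; lra|].
    destruct (Hu (j + k)%nat). change (S j + k)%nat with (S (j + k)). split; lra. }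
  assert (Hp : forall k, 0 <= v / 2 ^ k).
  { intros k. apply Rdiv_le_0_compat; [lra|apply pow_lt; lra]. }
  assert (H2 : forall k j, u j <= u k + v / 2 ^ k).
  { intros k j. destruct (Nat.le_ge_cases k j) as [E|E].
    - destruct (H1 k (j - k)%nat) as [_ A]. replace (j - k + k)%nat with j in A by lia.
      pose proof (Hp j). lra.
    - destruct (H1 j (k - j)%nat) as [A _]. replace (k - j + j)%nat with k in A by lia.
      pose proof (Hp k). lra. }
  destruct (completeness (fun x => exists k, x = u k)) as [p [Hub Hlub]].
  - exists (u 0%nat + v / 2 ^ 0). intros x [k ->]. apply H2.
  - exists (u 0%nat). exists 0%nat; auto.
  - exists p. intros k. split.
    + apply Hub. exists k; auto.
    + apply Hlub. intros x [j ->]. apply H2.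
Qed.

(** Compactness of a rectangle: if [P] failed, some quarter of each bad rectangle would be bad, and
    the nested bad rectangles would shrink to a point near which [P] holds. It serves Goursat's
    lemma and the finiteness of the singular points in a disc. *)
Lemma bisection : P 0 x0 y0.
Proof.
  apply NNPP. intros HP.
  set (nxt := fun k q => epsilon (inhabits (0, 0)) (fun q' => bad (S k) q' /\ child k q q')).
  set (s := fix s k := match k with O => (x0, y0) | S k => nxt k (s k) end).
  assert (Hb : forall k, bad k (s k)).
  { induction k as [|k IH].
    - split; [|exact HP]. unfold inR. simpl. lra.
    - apply (epsilon_spec (inhabits (0, 0)) (fun q' => bad (S k) q' /\ child k (s k) q')).
      apply bad_child; auto. }
  assert (Hc : forall k, child k (s k) (s (S k))).
  { intros k.
    apply (epsilon_spec (inhabits (0, 0)) (fun q' => bad (S k) q' /\ child k (s k) q')).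
    apply bad_child; auto. }
  destruct (nested (fun k => fst (s k)) w Hw) as [px Hpx].
  { intros k. destruct (Hc k) as [? [? [? ?]]]. auto. }
  destruct (nested (fun k => snd (s k)) h Hh) as [py Hpy].
  { intros k. destruct (Hc k) as [? [? [? ?]]]. auto. }
  destruct (Hloc px py) as [d [Hd F]].
  - specialize (Hpx 0%nat). simpl in Hpx. split; lra.
  - specialize (Hpy 0%nat). simpl in Hpy. split; lra.
  - assert (Hsm : exists k, w / 2 ^ k < d /\ h / 2 ^ k < d).
    { destruct (pow_lt_1_zero (1/2)) with (y := d / (w + h + 1)) as [N HN].
      - rewrite Rabs_pos_eq; lra.
      - apply Rdiv_lt_0_compat; lra.
      - exists N. specialize (HN N (le_n _)).
        rewrite Rabs_pos_eq in HN by (apply pow_le; lra).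
        assert (E : (1/2) ^ N = / 2 ^ N) by (unfold Rdiv; rewrite Rmult_1_l, pow_inv; auto).
        rewrite E in HN.
        assert (0 < / 2 ^ N) by (apply Rinv_0_lt_compat, pow_lt; lra).
        assert (d = (w + h + 1) * (d / (w + h + 1))) by (field; lra).
        unfold Rdiv at 1 2. nra. }
    destruct Hsm as [k [Hk1 Hk2]]. destruct (Hb k) as [Hin HnP]. apply HnP.
    apply F; auto.
Qed.
End Bisection.

(** The contour integral of [Q] along the boundary, counterclockwise. *)
Definition rect_int (Q : C -> C) (x1 x2 y1 y2 : R) : C :=
  (CInt (fun x => Q (x, y1)) x1 x2 + Ci * CInt (fun y => Q (x2, y)) y1 y2
   - CInt (fun x => Q (x, y2)) x1 x2 - Ci * CInt (fun y => Q (x1, y)) y1 y2)%C.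

Definition ccont_rect (Q : C -> C) (x1 x2 y1 y2 : R) : Prop :=
  forall x y, x1 <= x <= x2 -> y1 <= y <= y2 -> ccont Q (x, y).

Lemma rcont_hline (Q : C -> C) (y x1 x2 : R) :
  (forall x, x1 <= x <= x2 -> ccont Q (x, y)) -> rcont_on (fun x => Q (x, y)) x1 x2.
Proof.
  intros H t Ht. apply (rcont_comp Q (fun x => (x, y))); [|apply H; auto].
  apply rcont_pair; [apply continuous_id|apply continuous_const].
Qed.

Lemma rcont_vline (Q : C -> C) (x y1 y2 : R) :
  (forall y, y1 <= y <= y2 -> ccont Q (x, y)) -> rcont_on (fun y => Q (x, y)) y1 y2.
Proof.
  intros H t Ht. apply (rcont_comp Q (fun y => (x, y))); [|apply H; auto].
  apply rcont_pair; [apply continuous_const|apply continuous_id].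
Qed.

Lemma rect_int_split_x (Q : C -> C) (x1 x x2 y1 y2 : R) :
  x1 <= x -> x <= x2 -> y1 <= y2 -> ccont_rect Q x1 x2 y1 y2 ->
  rect_int Q x1 x2 y1 y2 = (rect_int Q x1 x y1 y2 + rect_int Q x x2 y1 y2)%C.
Proof.
  intros H1 H2 H3 HQ. unfold rect_int.
  rewrite <- (CInt_Chasles (fun s => Q (s, y1)) x1 x x2); auto.
  2: { apply rcont_hline. intros; apply HQ; lra. }
  rewrite <- (CInt_Chasles (fun s => Q (s, y2)) x1 x x2); auto.
  2: { apply rcont_hline. intros; apply HQ; lra. }
  ring.
Qed.

Lemma rect_int_split_y (Q : C -> C) (x1 x2 y1 y y2 : R) :
  x1 <= x2 -> y1 <= y -> y <= y2 -> ccont_rect Q x1 x2 y1 y2 ->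
  rect_int Q x1 x2 y1 y2 = (rect_int Q x1 x2 y1 y + rect_int Q x1 x2 y y2)%C.
Proof.
  intros H1 H2 H3 HQ. unfold rect_int.
  rewrite <- (CInt_Chasles (fun s => Q (x1, s)) y1 y y2); auto.
  2: { apply rcont_vline. intros; apply HQ; lra. }
  rewrite <- (CInt_Chasles (fun s => Q (x2, s)) y1 y y2); auto.
  2: { apply rcont_vline. intros; apply HQ; lra. }
  ring.
Qed.

Lemma rect_int_le (Q : C -> C) (x1 x2 y1 y2 M : R) :
  x1 <= x2 -> y1 <= y2 -> ccont_rect Q x1 x2 y1 y2 ->
  (forall x y, x1 <= x <= x2 -> y1 <= y <= y2 -> Cmod (Q (x, y)) <= M) ->
  Cmod (rect_int Q x1 x2 y1 y2) <= 2 * M * ((x2 - x1) + (y2 - y1)).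
Proof.
  intros H1 H2 HQ HM. unfold rect_int.
  assert (A : forall y, y1 <= y <= y2 -> Cmod (CInt (fun x => Q (x, y)) x1 x2) <= M * (x2 - x1)).
  { intros y Hy. apply Cmod_CInt_le; auto. apply rcont_hline. auto. }
  assert (B : forall x, x1 <= x <= x2 -> Cmod (Ci * CInt (fun y => Q (x, y)) y1 y2) <= M * (y2 - y1)).
  { intros x Hx. rewrite Cmod_mult, Cmod_Ci, Rmult_1_l. apply Cmod_CInt_le; auto. apply rcont_vline. auto. }
  eapply Rle_trans; [apply Cmod_sub_le|].
  eapply Rle_trans; [apply Rplus_le_compat_r, Cmod_sub_le|].
  eapply Rle_trans; [apply Rplus_le_compat_r, Rplus_le_compat_r, Cmod_triangle|].
  pose proof (A y1 ltac:(lra)). pose proof (A y2 ltac:(lra)).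
  pose proof (B x1 ltac:(lra)). pose proof (B x2 ltac:(lra)). lra.
Qed.

Lemma RInt_affine (u v a b : R) :
  RInt (fun t => u + v * t) a b = u * (b - a) + v * ((b * b - a * a) / 2).
Proof.
  replace (u * (b - a) + v * ((b * b - a * a) / 2))
    with ((u * b + v * (b * b / 2)) - (u * a + v * (a * a / 2))) by field.
  apply is_RInt_unique.
  apply (is_RInt_derive (fun t => u * t + v * (t * t / 2)) (fun t => u + v * t)).
  - intros t _. auto_derive; [auto|field].
  - intros t _. apply (continuous_plus (fun _ => u) (fun t => v * t)).
    + apply continuous_const.
    + apply continuous_Rmult; [apply continuous_const|apply continuous_id].
Qed.

Lemma rect_int_affine (A B : C) (x1 x2 y1 y2 : R) : x1 <= x2 -> y1 <= y2 ->
  rect_int (fun z => A + B * z)%C x1 x2 y1 y2 = 0%C.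
Proof.
  intros Hx Hy. unfold rect_int, CInt.
  assert (E1 : forall y, RInt (fun x => fst (A + B * (x, y))%C) x1 x2
     = (fst A - snd B * y) * (x2 - x1) + fst B * ((x2 * x2 - x1 * x1) / 2)).
  { intros y. rewrite <- RInt_affine. apply RInt_eq; auto. intros; simpl; ring. }
  assert (E2 : forall y, RInt (fun x => snd (A + B * (x, y))%C) x1 x2
     = (snd A + fst B * y) * (x2 - x1) + snd B * ((x2 * x2 - x1 * x1) / 2)).
  { intros y. rewrite <- RInt_affine. apply RInt_eq; auto. intros; simpl; ring. }
  assert (E3 : forall x, RInt (fun y => fst (A + B * (x, y))%C) y1 y2
     = (fst A + fst B * x) * (y2 - y1) + (- snd B) * ((y2 * y2 - y1 * y1) / 2)).
  { intros y. rewrite <- RInt_affine. apply RInt_eq; auto. intros; simpl; ring. }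
  assert (E4 : forall x, RInt (fun y => snd (A + B * (x, y))%C) y1 y2
     = (snd A + snd B * x) * (y2 - y1) + fst B * ((y2 * y2 - y1 * y1) / 2)).
  { intros y. rewrite <- RInt_affine. apply RInt_eq; auto. intros; simpl; ring. }
  rewrite !E1, !E2, !E3, !E4.
  unfold Cminus, Cplus, Cmult, Copp, Ci, RtoC. simpl. f_equal; field.
Qed.

Lemma rect_int_minus (Q A : C -> C) (x1 x2 y1 y2 : R) :
  x1 <= x2 -> y1 <= y2 -> ccont_rect Q x1 x2 y1 y2 -> ccont_rect A x1 x2 y1 y2 ->
  rect_int (fun z => Q z - A z)%C x1 x2 y1 y2
  = (rect_int Q x1 x2 y1 y2 - rect_int A x1 x2 y1 y2)%C.
Proof.
  intros Hx Hy HQ HA. unfold rect_int.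
  rewrite !(CInt_minus (fun x => Q (x, _)) (fun x => A (x, _)));
    try (apply rcont_hline; intros; auto; (apply HQ || apply HA); lra); auto.
  rewrite !(CInt_minus (fun y => Q (_, y)) (fun y => A (_, y)));
    try (apply rcont_vline; intros; auto; (apply HQ || apply HA); lra); auto.
  ring.
Qed.

Lemma ccont_rect_sub (Q : C -> C) (x1 x2 y1 y2 a1 a2 b1 b2 : R) :
  ccont_rect Q x1 x2 y1 y2 -> x1 <= a1 -> a2 <= x2 -> y1 <= b1 -> b2 <= y2 ->
  ccont_rect Q a1 a2 b1 b2.
Proof. intros H ? ? ? ? x y Hx Hy. apply H; lra. Qed.

Lemma Cmod_pair_le (x y : R) : Cmod (x, y) <= Rabs x + Rabs y.
Proof.
  replace ((x, y) : C) with (RtoC x + Ci * RtoC y)%C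
    by (unfold RtoC, Ci, Cmult, Cplus; simpl; f_equal; ring).
  eapply Rle_trans; [apply Cmod_triangle|].
  rewrite Cmod_mult, Cmod_Ci, !Cmod_R. lra.
Qed.

(** On a small rectangle [Q] differs from its tangent by eps times the size, and the tangent
    integrates to 0; so the integral is at most eps times the square of the size. A quadratic bound
    is stable under quartering, since the four bounds add up to that of the whole. *)
Lemma goursat (Q : C -> C) (x1 x2 y1 y2 : R) : x1 <= x2 -> y1 <= y2 ->
  (forall x y, x1 <= x <= x2 -> y1 <= y <= y2 -> Cdiff Q (x, y)) ->
  rect_int Q x1 x2 y1 y2 = 0%C.
Proof.
  intros Hx Hy HQ.
  assert (HC : ccont_rect Q x1 x2 y1 y2) by (intros x y ? ?; apply Cdiff_ccont; auto).
  set (w := x2 - x1). set (h := y2 - y1).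
  assert (Hb : forall eps, 0 < eps -> Cmod (rect_int Q x1 x2 y1 y2) <= eps * (2 * (w + h) * (w + h))).
  { intros eps He.
    pose proof (bisection x1 y1 w h (fun k x y =>
      Cmod (rect_int Q x (x + w / 2 ^ k) y (y + h / 2 ^ k))
      <= eps * (2 * (w / 2 ^ k + h / 2 ^ k) * (w / 2 ^ k + h / 2 ^ k)))) as HB.
    simpl in HB.
    replace (x1 + w / 1) with x2 in HB by (unfold w; field).
    replace (y1 + h / 1) with y2 in HB by (unfold h; field).
    replace (w / 1 + h / 1) with (w + h) in HB by field.
    apply HB; try (unfold w, h; lra); clear HB.
    - intros k x y [Hx1 [Hx2 [Hy1 Hy2]]] I1 I2 I3 I4.
      assert (Hk : 0 < 2 ^ k) by (apply pow_lt; lra).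
      set (a := w / (2 * 2 ^ k)) in *. set (b := h / (2 * 2 ^ k)) in *.
      assert (Ea : w / 2 ^ k = a + a) by (unfold a; field; lra).
      assert (Eb : h / 2 ^ k = b + b) by (unfold b; field; lra).
      assert (0 <= a) by (apply Rdiv_le_0_compat; unfold w; lra).
      assert (0 <= b) by (apply Rdiv_le_0_compat; unfold h; lra).
      rewrite Ea, Eb in *.
      assert (HC' : ccont_rect Q x (x + (a + a)) y (y + (b + b))).
      { apply (ccont_rect_sub _ _ _ _ _ _ _ _ _ HC); unfold w, h in *; lra. }
      rewrite (rect_int_split_x Q x (x + a)); auto; try lra.
      rewrite (rect_int_split_y Q x (x + a) y (y + b)); try lra.
      2: { apply (ccont_rect_sub _ _ _ _ _ _ _ _ _ HC'); lra. }
      rewrite (rect_int_split_y Q (x + a) (x + (a + a)) y (y + b)); try lra.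
      2: { apply (ccont_rect_sub _ _ _ _ _ _ _ _ _ HC'); lra. }
      replace (x + a + a) with (x + (a + a)) in * by ring.
      replace (y + b + b) with (y + (b + b)) in * by ring.
      eapply Rle_trans; [apply Cmod_triangle|].
      eapply Rle_trans; [apply Rplus_le_compat; apply Cmod_triangle|]. nra.
    - intros px py Hpx Hpy.
      assert (HD : Cdiff Q (px, py)) by (apply HQ; unfold w, h in *; lra).
      apply Cdiff_cderiv in HD. destruct HD as [L HL].
      destruct (cderiv_approx _ _ _ HL eps He) as [d [Hd F]].
      exists (d / 2). split; [lra|].
      intros k x y [Hx1 [Hx2 [Hy1 Hy2]]] Kx Ky Kw Kh.
      set (a := w / 2 ^ k) in *. set (b := h / 2 ^ k) in *.
      assert (HC' : ccont_rect Q x (x + a) y (y + b)).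
      { apply (ccont_rect_sub _ _ _ _ _ _ _ _ _ HC); unfold w, h in *; lra. }
      set (p := ((px, py) : C)) in *.
      set (A := fun z : C => ((Q p - L * p) + L * z)%C).
      assert (HA : ccont_rect A x (x + a) y (y + b)).
      { intros u v _ _. apply ccont_plus; [apply ccont_const|].
        apply ccont_mult; [apply ccont_const|apply ccont_id]. }
      replace (rect_int Q x (x + a) y (y + b)) with
        (rect_int (fun z => Q z - A z)%C x (x + a) y (y + b)).
      2: { rewrite rect_int_minus; auto; try lra. unfold A.
           rewrite rect_int_affine by lra. ring. }
      eapply Rle_trans.
      { apply rect_int_le with (M := eps * (a + b)); try lra.
        - intros u v Hu Hv. apply ccont_minus; [apply HC'|apply HA]; auto.
        - intros u v Hu Hv.
          assert (Hd' : Cmod ((u, v) - p)%C <= a + b).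
          { unfold p. unfold Cminus, Cplus, Copp. simpl.
            eapply Rle_trans; [apply Cmod_pair_le|].
            apply Rplus_le_compat; apply Rabs_le; lra. }
          specialize (F (u, v) ltac:(lra)).
          unfold A. replace (Q (u, v) - (Q p - L * p + L * (u, v)))%C
            with (Q (u, v) - Q p - L * ((u, v) - p))%C by ring.
          eapply Rle_trans; [exact F|]. apply Rmult_le_compat_l; lra. }
      right. ring. }
  apply Cmod_eq_0. apply Rle_antisym; [|apply Cmod_ge_0].
  apply Rnot_lt_le. intros Hp. set (m := Cmod (rect_int Q x1 x2 y1 y2)) in *.
  set (K := 2 * (w + h) * (w + h)) in *.
  assert (0 <= K) by (unfold K, w, h; nra).
  specialize (Hb (m / (2 * (K + 1)))).
  assert (m / (2 * (K + 1)) * K < m); [|assert (0 < m / (2 * (K + 1))) by (apply Rdiv_lt_0_compat; lra); lra].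
  apply Rmult_lt_reg_r with (2 * (K + 1)); [lra|].
  replace (m / (2 * (K + 1)) * K * (2 * (K + 1))) with (m * K) by (field; lra). nra.
Qed.

Lemma ccont_bounded_near (Q : C -> C) (p : C) : ccont Q p ->
  exists d, 0 < d /\ forall z, Cmod (z - p) < d -> Cmod (Q z) <= Cmod (Q p) + 1.
Proof.
  intros H. destruct (H 1) as [d [Hd F]]; [lra|]. exists d. split; auto. intros z Hz.
  specialize (F z Hz). pose proof (Cmod_triangle (Q z - Q p) (Q p)) as Ht.
  replace (Q z - Q p + Q p)%C with (Q z) in Ht by ring. lra.
Qed.

(** Cut out a square of half side t around the exceptional point: the four remaining rectangles
    contribute 0, and the square O(t) because [Q] is bounded near the point. This admits difference
    quotients, which are only known to be continuous at one point. *)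
Lemma goursat_except (Q : C -> C) (x1 x2 y1 y2 px py : R) :
  x1 < px < x2 -> y1 < py < y2 -> ccont Q (px, py) ->
  (forall x y, x1 <= x <= x2 -> y1 <= y <= y2 -> (x, y) <> (px, py) -> Cdiff Q (x, y)) ->
  rect_int Q x1 x2 y1 y2 = 0%C.
Proof.
  intros Hx Hy HP HQ.
  assert (HC : ccont_rect Q x1 x2 y1 y2).
  { intros x y ? ?. destruct (Cx_eq_dec (x, y) (px, py)) as [E|E]; [rewrite E; auto|].
    apply Cdiff_ccont; auto. }
  destruct (ccont_bounded_near Q _ HP) as [d [Hd HM]].
  set (M := Cmod (Q (px, py)) + 1) in *.
  assert (HM0 : 1 <= M) by (unfold M; pose proof (Cmod_ge_0 (Q (px, py))); lra).
  set (d0 := Rmin (d / 3) (Rmin (Rmin (px - x1) (x2 - px)) (Rmin (py - y1) (y2 - py)))).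
  assert (Hd0 : 0 < d0) by (repeat apply Rmin_pos; lra).
  assert (L1 : d0 <= d / 3) by apply Rmin_l.
  assert (L2 : d0 <= px - x1 /\ d0 <= x2 - px /\ d0 <= py - y1 /\ d0 <= y2 - py).
  { unfold d0.
    pose proof (Rmin_r (d / 3) (Rmin (Rmin (px - x1) (x2 - px)) (Rmin (py - y1) (y2 - py)))).
    pose proof (Rmin_l (Rmin (px - x1) (x2 - px)) (Rmin (py - y1) (y2 - py))).
    pose proof (Rmin_r (Rmin (px - x1) (x2 - px)) (Rmin (py - y1) (y2 - py))).
    pose proof (Rmin_l (px - x1) (x2 - px)). pose proof (Rmin_r (px - x1) (x2 - px)).
    pose proof (Rmin_l (py - y1) (y2 - py)). pose proof (Rmin_r (py - y1) (y2 - py)). lra. }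
  assert (Hb : forall t, 0 < t < d0 -> Cmod (rect_int Q x1 x2 y1 y2) <= 8 * M * t).
  { intros t Ht.
    rewrite (rect_int_split_x Q x1 (px - t)); auto; try lra.
    rewrite (rect_int_split_x Q (px - t) (px + t)); try lra.
    2: { apply (ccont_rect_sub _ _ _ _ _ _ _ _ _ HC); lra. }
    rewrite (rect_int_split_y Q (px - t) (px + t) y1 (py - t)); try lra.
    2: { apply (ccont_rect_sub _ _ _ _ _ _ _ _ _ HC); lra. }
    rewrite (rect_int_split_y Q (px - t) (px + t) (py - t) (py + t)); try lra.
    2: { apply (ccont_rect_sub _ _ _ _ _ _ _ _ _ HC); lra. }
    rewrite (goursat Q x1), (goursat Q (px + t)), (goursat Q (px - t) (px + t) y1),
      (goursat Q (px - t) (px + t) (py + t)); try lra;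
      try (intros x y ? ?; apply HQ; try lra; intros E; injection E; intros; lra).
    replace (0 + (0 + (rect_int Q (px - t) (px + t) (py - t) (py + t) + 0) + 0))%C
      with (rect_int Q (px - t) (px + t) (py - t) (py + t)) by ring.
    eapply Rle_trans; [apply rect_int_le with (M := M); try lra|].
    - apply (ccont_rect_sub _ _ _ _ _ _ _ _ _ HC); lra.
    - intros x y Hx' Hy'. apply HM. unfold Cminus, Cplus, Copp. simpl.
      eapply Rle_lt_trans; [apply Cmod_pair_le|].
      assert (Rabs (x + - px) <= t) by (apply Rabs_le; lra).
      assert (Rabs (y + - py) <= t) by (apply Rabs_le; lra). lra.
    - right. ring. }
  apply Cmod_eq_0. apply Rle_antisym; [|apply Cmod_ge_0].
  apply Rnot_lt_le. intros Hp. set (m := Cmod (rect_int Q x1 x2 y1 y2)) in *.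
  set (t := Rmin (d0 / 2) (m / (16 * M))).
  assert (0 < m / (16 * M)) by (apply Rdiv_lt_0_compat; lra).
  assert (0 < t) by (apply Rmin_pos; lra).
  assert (t <= d0 / 2) by apply Rmin_l. assert (t <= m / (16 * M)) by apply Rmin_r.
  specialize (Hb t ltac:(lra)).
  assert (8 * M * t <= 8 * M * (m / (16 * M))) by (apply Rmult_le_compat_l; lra).
  replace (8 * M * (m / (16 * M))) with (m / 2) in * by (field; lra). lra.
Qed.

(** * Mean value property *)

Definition circ (t th : R) : C := (t * cos th, t * sin th).

Definition cexp (z : C) : C := circ (exp (fst z)) (snd z).

Lemma Cmod_circ (t th : R) : 0 <= t -> Cmod (circ t th) = t.
Proof.
  intros Ht. unfold Cmod, circ. simpl fst. simpl snd.
  replace ((t * cos th) ^ 2 + (t * sin th) ^ 2) with (t * t).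
  - apply sqrt_square; auto.
  - pose proof (sin2_cos2 th) as H. unfold Rsqr in H.
    transitivity (t * t * (sin th * sin th + cos th * cos th)); [rewrite H|]; ring.
Qed.

Lemma circ_neq_0 (t th : R) : 0 < t -> circ t th <> 0%C.
Proof. intros Ht. apply Cmod_pos_neq. rewrite Cmod_circ; lra. Qed.

Lemma Cmod_cexp (z : C) : Cmod (cexp z) = exp (fst z).
Proof. apply Cmod_circ. left; apply exp_pos. Qed.

Lemma cexp_plus (z w : C) : cexp (z + w)%C = (cexp z * cexp w)%C.
Proof.
  unfold cexp, circ, Cmult, Cplus. simpl. rewrite exp_plus, cos_plus, sin_plus.
  f_equal; ring.
Qed.

Lemma derivable_pt_lim_approx (f : R -> R) (l : R) : derivable_pt_lim f 0 l ->
  forall eps, 0 < eps -> exists delta, 0 < delta /\ forall h, Rabs h < delta ->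
    Rabs (f h - f 0 - l * h) <= eps * Rabs h.
Proof.
  intros H eps He. destruct (H eps He) as [d F]. exists d. split; [apply cond_pos|].
  intros h Hh. destruct (Req_dec h 0) as [->|Hne].
  - replace (f 0 - f 0 - l * 0) with 0 by ring. rewrite Rabs_R0. lra.
  - specialize (F h Hne Hh). rewrite Rplus_0_l in F.
    replace (f h - f 0 - l * h) with (((f h - f 0) / h - l) * h) by (field; auto).
    rewrite Rabs_mult. apply Rmult_le_compat_r; [apply Rabs_pos|lra].
Qed.

Lemma Rabs_mult_le (a b A B : R) : Rabs a <= A -> Rabs b <= B -> Rabs (a * b) <= A * B.
Proof. intros. rewrite Rabs_mult. apply Rmult_le_compat; auto using Rabs_pos. Qed.

Lemma cexp_approx_0 (eps : R) : 0 < eps -> exists delta, 0 < delta /\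
  forall h : C, Cmod h < delta -> Cmod (cexp h - 1 - h) <= eps * Cmod h.
Proof.
  (* The error terms collected at the end add up to at most 9 [e] times |h|, so a twelfth of [eps]
     is enough. *)
  intros He. set (e := Rmin 1 (eps / 12)).
  assert (He0 : 0 < e) by (apply Rmin_pos; lra).
  assert (He1 : e <= 1) by apply Rmin_l. assert (He2 : e <= eps / 12) by apply Rmin_r.
  clearbody e.
  destruct (derivable_pt_lim_approx exp 1) with (eps := e) as [d1 [Hd1 F1]]; auto.
  { apply derivable_pt_lim_exp_0. }
  destruct (derivable_pt_lim_approx cos 0) with (eps := e) as [d2 [Hd2 F2]]; auto.
  { apply derivable_pt_lim_cos_0. }
  destruct (derivable_pt_lim_approx sin 1) with (eps := e) as [d3 [Hd3 F3]]; auto.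
  { apply derivable_pt_lim_sin_0. }
  exists (Rmin e (Rmin d1 (Rmin d2 d3))).
  split; [repeat apply Rmin_pos; auto|]. intros [a b] Hh.
  pose proof (Rmin_l e (Rmin d1 (Rmin d2 d3))). pose proof (Rmin_r e (Rmin d1 (Rmin d2 d3))).
  pose proof (Rmin_l d1 (Rmin d2 d3)). pose proof (Rmin_r d1 (Rmin d2 d3)).
  pose proof (Rmin_l d2 d3). pose proof (Rmin_r d2 d3).
  pose proof (Rmax_Cmod (a, b)) as HM. simpl in HM.
  pose proof (Rmax_l (Rabs a) (Rabs b)). pose proof (Rmax_r (Rabs a) (Rabs b)).
  specialize (F1 a ltac:(lra)). specialize (F2 b ltac:(lra)). specialize (F3 b ltac:(lra)).
  rewrite exp_0 in F1. rewrite cos_0 in F2. rewrite sin_0 in F3.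
  set (m := Cmod (a, b)) in *.
  set (r1 := exp a - 1 - 1 * a) in *. set (r2 := cos b - 1 - 0 * b) in *.
  set (r3 := sin b - 0 - 1 * b) in *.
  assert (Ea : exp a = 1 + a + r1) by (unfold r1; ring).
  assert (Eb : cos b = 1 + r2) by (unfold r2; ring).
  assert (Ec : sin b = b + r3) by (unfold r3; ring).
  assert (G1 : Rabs r1 <= e * m) by (eapply Rle_trans; [exact F1|]; apply Rmult_le_compat_l; lra).
  assert (G2 : Rabs r2 <= e * m) by (eapply Rle_trans; [exact F2|]; apply Rmult_le_compat_l; lra).
  assert (G3 : Rabs r3 <= e * m) by (eapply Rle_trans; [exact F3|]; apply Rmult_le_compat_l; lra).
  assert (Hm0 : 0 <= m) by apply Cmod_ge_0.
  assert (G4 : Rabs (a + r1) <= 2 * e).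
  { eapply Rle_trans; [apply Rabs_triang|]. nra. }
  assert (G5 : Rabs (1 + a + r1) <= 3).
  { rewrite Rplus_assoc. eapply Rle_trans; [apply Rabs_triang|]. rewrite Rabs_R1. lra. }
  replace (cexp (a, b) - 1 - (a, b))%C
    with ((r1 + (1 + a + r1) * r2, (a + r1) * b + (1 + a + r1) * r3) : C).
  2: { unfold cexp, circ. simpl fst; simpl snd. rewrite Ea, Eb, Ec.
       unfold Cminus, Cplus, Copp, RtoC. simpl. f_equal; ring. }
  eapply Rle_trans; [apply Cmod_pair_le|].
  pose proof (Rabs_mult_le _ _ _ _ G5 G2). pose proof (Rabs_mult_le _ _ _ _ G5 G3).
  assert (Rabs ((a + r1) * b) <= 2 * e * m) by (apply Rabs_mult_le; lra).
  pose proof (Rabs_triang r1 ((1 + a + r1) * r2)).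
  pose proof (Rabs_triang ((a + r1) * b) ((1 + a + r1) * r3)). nra.
Qed.

Lemma cderiv_cexp (z : C) : cderiv cexp z (cexp z).
Proof.
  apply cderiv_alt. intros eps He.
  destruct (cexp_approx_0 (eps / exp (fst z))) as [d [Hd F]].
  { apply Rdiv_lt_0_compat; auto. apply exp_pos. }
  exists d. split; auto. intros w Hw. specialize (F _ Hw).
  replace (cexp w) with (cexp z * cexp (w - z))%C by (rewrite <- cexp_plus; f_equal; ring).
  replace (cexp z * cexp (w - z) - cexp z - cexp z * (w - z))%C
    with (cexp z * (cexp (w - z) - 1 - (w - z)))%C by ring.
  rewrite Cmod_mult, Cmod_cexp. pose proof (exp_pos (fst z)).
  replace (eps * Cmod (w - z)) with (exp (fst z) * (eps / exp (fst z) * Cmod (w - z)))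
    by (field; lra).
  apply Rmult_le_compat_l; lra.
Qed.

Lemma Cdiff_cexp (z : C) : Cdiff cexp z.
Proof. apply Cdiff_cderiv. eexists. apply cderiv_cexp. Qed.

Lemma continuous_cos' (t : R) : continuous cos t.
Proof. apply continuity_pt_filterlim, continuity_cos. Qed.

Lemma continuous_sin' (t : R) : continuous sin t.
Proof. apply continuity_pt_filterlim, continuity_sin. Qed.

Lemma rcont_circ (t th : R) : rcont (circ t) th.
Proof.
  apply (rcont_pair (fun s => t * cos s) (fun s => t * sin s)).
  - apply (continuous_Rmult (fun _ => t)); [apply continuous_const|apply continuous_cos'].
  - apply (continuous_Rmult (fun _ => t)); [apply continuous_const|apply continuous_sin'].
Qed.

Lemma circ_period (t th : R) : circ t (th + 2 * PI) = circ t th.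
Proof. unfold circ. rewrite cos_plus, sin_plus, cos_2PI, sin_2PI. f_equal; ring. Qed.

Lemma RInt_period (f : R -> R) (a p : R) : 0 <= p -> (forall t, continuous f t) ->
  (forall t, f (t + p) = f t) -> RInt f a (a + p) = RInt f 0 p.
Proof.
  intros Hp Hf Hper.
  assert (Hex : forall u v, ex_RInt f u v).
  { intros u v. apply (ex_RInt_continuous (V := R_CompleteNormedModule)). auto. }
  rewrite <- (RInt_Chasles f a 0 (a + p)); auto.
  rewrite <- (RInt_Chasles f 0 p (a + p)); auto.
  assert (E : RInt f p (a + p) = RInt f 0 a).
  { pose proof (RInt_comp_lin (V := R_CompleteNormedModule) f 1 p 0 a (Hex _ _)) as E.
    replace (1 * 0 + p) with p in E by ring. replace (1 * a + p) with (a + p) in E by ring.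
    rewrite <- E. apply RInt_ext. intros x _. rewrite (scal_one (K := R_Ring)), Rmult_1_l.
    apply Hper. }
  rewrite E, <- (opp_RInt_swap f 0 a); auto.
  unfold plus, opp; simpl. ring.
Qed.

Lemma CInt_period (f : R -> C) (a p : R) : 0 <= p -> (forall t, rcont f t) ->
  (forall t, f (t + p) = f t) -> CInt f a (a + p) = CInt f 0 p.
Proof.
  intros Hp Hf Hper. unfold CInt. f_equal.
  - apply (RInt_period (fun t => fst (f t))); auto; intros; [apply rcont_parts, Hf|rewrite Hper; auto].
  - apply (RInt_period (fun t => snd (f t))); auto; intros; [apply rcont_parts, Hf|rewrite Hper; auto].
Qed.

Lemma polar_form (p : C) : exists a, p = circ (Cmod p) a.
Proof.
  destruct (Cx_eq_dec p 0) as [->|Hp].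
  - exists 0. rewrite Cmod_0. unfold circ, RtoC. f_equal; ring.
  - pose proof (Cmod_pos _ Hp) as Hm. set (m := Cmod p) in *.
    assert (E : fst p * fst p + snd p * snd p = m * m).
    { pose proof (Cmod2_alt p) as H. unfold Re, Im in H. fold m in H. simpl in H. lra. }
    assert (Hx : -1 <= fst p / m <= 1).
    { assert (Rabs (fst p) <= m) by apply re_le_Cmod. apply Rabs_le_between in H.
      split; apply Rmult_le_reg_r with m; auto; unfold Rdiv;
        rewrite Rmult_assoc, Rinv_l by lra; lra. }
    assert (Hs : sin (acos (fst p / m)) = Rabs (snd p) / m).
    { rewrite sin_acos by auto.
      replace (1 - (fst p / m)²) with ((Rabs (snd p) / m)²).
      - apply sqrt_Rsqr. apply Rdiv_le_0_compat; auto. apply Rabs_pos.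
      - unfold Rdiv. rewrite !Rsqr_mult, <- Rsqr_abs. unfold Rsqr.
        apply Rmult_eq_reg_r with (m * m); [|nra]. field_simplify; lra. }
    destruct (Rle_dec 0 (snd p)) as [Hy|Hy].
    + exists (acos (fst p / m)). unfold circ. rewrite cos_acos, Hs by auto.
      rewrite Rabs_pos_eq by auto. destruct p; simpl. f_equal; field; lra.
    + exists (- acos (fst p / m)). unfold circ. rewrite cos_neg, sin_neg, cos_acos, Hs by auto.
      rewrite Rabs_left by lra. destruct p; simpl. f_equal; field; lra.
Qed.

Lemma cos_eq_1_small (u : R) : - PI <= u <= PI -> cos u = 1 -> u = 0.
Proof.
  intros Hu Hc. pose proof PI_RGT_0.
  assert (Hs : sin (u / 2) = 0).
  { replace u with (2 * (u / 2)) in Hc by field. rewrite cos_2a_sin in Hc. nra. }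
  destruct (Rtotal_order u 0) as [Hl|[->|Hg]]; auto; exfalso.
  - assert (0 < sin (- (u / 2))) by (apply sin_gt_0; lra). rewrite sin_neg in H0. lra.
  - assert (0 < sin (u / 2)) by (apply sin_gt_0; lra). lra.
Qed.

Lemma rcont_on_circle (g : C -> C) (t : R) : 0 <= t ->
  (forall z, Cmod z = t -> ccont g z) -> forall th, rcont (fun s => g (circ t s)) th.
Proof.
  intros Ht H th. apply rcont_comp; [apply rcont_circ|].
  apply H, Cmod_circ, Ht.
Qed.

(* In logarithmic coordinates an annulus becomes a rectangle whose two
   horizontal sides cancel by periodicity. *)
Lemma circle_int_eq (g : C -> C) (s t : R) (p : C) : 0 < s < t ->
  (forall z, s <= Cmod z <= t -> ccont g z) ->
  (forall z, s <= Cmod z <= t -> z <> p -> Cdiff g z) ->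
  Cmod p <> s -> Cmod p <> t ->
  CInt (fun th => g (circ s th)) 0 (2 * PI) = CInt (fun th => g (circ t th)) 0 (2 * PI).
Proof.
  intros Hst HC HD Hs Ht. pose proof PI_RGT_0 as HPI.
  destruct (polar_form p) as [a Ha].
  assert (Hln : ln s < ln t) by (apply ln_increasing; lra).
  set (Q := fun z => g (cexp z)).
  assert (Hrange : forall x, ln s <= x <= ln t -> s <= exp x <= t).
  { intros x [H1 H2]. rewrite <- (exp_ln s), <- (exp_ln t) by lra.
    split; [destruct H1|destruct H2]; subst; try lra; left; apply exp_increasing; auto. }
  (* The strip of height 2 PI is centred at the argument of [p], so that [p] has exactly one
     preimage in the rectangle and this preimage is interior. *)
  assert (HQ : rect_int Q (ln s) (ln t) (a - PI) (a + PI) = 0%C).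
  { assert (Hd : forall x y, ln s <= x <= ln t -> cexp (x, y) <> p -> Cdiff Q (x, y)).
    { intros x y Hx Hne. apply (Cdiff_comp g cexp); [apply Cdiff_cexp|].
      apply HD; auto. rewrite Cmod_cexp. simpl. auto. }
    destruct (classic (s < Cmod p < t)) as [Hp|Hp].
    - apply (goursat_except Q _ _ _ _ (ln (Cmod p)) a); try lra.
      + split; apply ln_increasing; lra.
      + apply (ccont_comp g cexp); [apply Cdiff_ccont, Cdiff_cexp|].
        apply HC. rewrite Cmod_cexp. simpl. rewrite exp_ln; lra.
      + intros x y Hx Hy Hne. apply Hd; auto. intros E. apply Hne.
        assert (Em : exp x = Cmod p) by (rewrite <- E, Cmod_cexp; auto).
        assert (Ex : x = ln (Cmod p)) by (rewrite <- Em, ln_exp; auto).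
        assert (E' : cexp (x, y) = circ (Cmod p) a) by congruence.
        unfold cexp, circ in E'. simpl in E'. rewrite Em in E'. injection E' as E1 E2.
        apply Rmult_eq_reg_l in E1; [|lra]. apply Rmult_eq_reg_l in E2; [|lra].
        assert (y - a = 0).
        { apply cos_eq_1_small; [lra|]. rewrite cos_minus, E1, E2.
          pose proof (sin2_cos2 a). unfold Rsqr in *. lra. }
        f_equal; auto; lra.
    - apply goursat; try lra. intros x y Hx Hy. apply Hd; auto.
      intros E. pose proof (Hrange x Hx) as Hr.
      assert (Em : exp x = Cmod p) by (rewrite <- E, Cmod_cexp; auto). lra. }
  assert (Hcirc : forall u, s <= u <= t ->
    CInt (fun y => Q (ln u, y)) (a - PI) (a + PI) = CInt (fun th => g (circ u th)) 0 (2 * PI)).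
  { intros u Hu. rewrite <- (CInt_period _ (a - PI) (2 * PI)); try lra.
    - replace (a - PI + 2 * PI) with (a + PI) by ring.
      apply CInt_ext; [lra|]. intros y _. unfold Q, cexp. simpl. rewrite exp_ln by lra. auto.
    - intros th. apply rcont_on_circle; [lra|]. intros z Hz. apply HC. lra.
    - intros th. rewrite circ_period. auto. }
  rewrite <- (Hcirc s), <- (Hcirc t) by lra.
  unfold rect_int in HQ.
  assert (E : CInt (fun x => Q (x, a - PI)) (ln s) (ln t) = CInt (fun x => Q (x, a + PI)) (ln s) (ln t)).
  { apply CInt_ext; [lra|]. intros x _. unfold Q, cexp. simpl.
    replace (a + PI) with (a - PI + 2 * PI) by ring. rewrite circ_period. auto. }
  rewrite E in HQ.
  set (V1 := CInt (fun y => Q (ln s, y)) (a - PI) (a + PI)) in *.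
  set (V2 := CInt (fun y => Q (ln t, y)) (a - PI) (a + PI)) in *.
  set (H0 := CInt (fun x => Q (x, a + PI)) (ln s) (ln t)) in *.
  assert (Hz : (Ci * (V2 - V1))%C = 0%C) by (rewrite <- HQ; ring).
  symmetry. apply Cminus_eq_0.
  destruct (Cx_eq_dec (V2 - V1)%C 0) as [|Hne]; auto. exfalso.
  assert (Hci : Ci <> 0%C) by (intros Hx; injection Hx; lra).
  apply (Cmult_neq_0 _ _ Hci Hne Hz).
Qed.

(** The integral does not depend on the radius, and by continuity at 0 it tends to the right-hand
    side as the radius shrinks. *)
Lemma circle_int_center (g : C -> C) (t : R) (p : C) : 0 < t ->
  (forall z, Cmod z <= t -> ccont g z) ->
  (forall z, Cmod z <= t -> z <> p -> Cdiff g z) -> Cmod p <> t ->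
  CInt (fun th => g (circ t th)) 0 (2 * PI) = (RtoC (2 * PI) * g 0)%C.
Proof.
  intros Ht HC HD Hp. pose proof PI_RGT_0 as HPI.
  apply Cminus_eq_0. apply NNPP. intros Hne. apply Cmod_pos in Hne.
  remember (Cmod _) as m eqn:Em in Hne.
  assert (Hg0 : ccont g 0) by (apply HC; rewrite Cmod_0; lra).
  destruct (Hg0 (m / (4 * PI))) as [d [Hd F]].
  { apply Rdiv_lt_0_compat; lra. }
  (* The inner circle must avoid [p]: its radius is kept below |p|, or is merely positive when [p]
     is the centre. *)
  set (q := if Req_EM_T (Cmod p) 0 then t else Cmod p).
  assert (Hq : 0 < q).
  { unfold q. destruct (Req_EM_T (Cmod p) 0); auto. pose proof (Cmod_ge_0 p). lra. }
  set (s := Rmin (Rmin d t) q / 2).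
  assert (H0 : 0 < Rmin (Rmin d t) q) by (repeat apply Rmin_pos; auto).
  pose proof (Rmin_l (Rmin d t) q). pose proof (Rmin_r (Rmin d t) q).
  pose proof (Rmin_l d t). pose proof (Rmin_r d t).
  assert (Hs : 0 < s /\ s < d /\ s < t /\ s < q) by (unfold s; lra).
  assert (E : m <= m / (4 * PI) * (2 * PI - 0)).
  { rewrite Em at 1. rewrite <- (circle_int_eq g s t p); try lra.
    - replace (RtoC (2 * PI) * g 0)%C with (CInt (fun _ => g 0%C) 0 (2 * PI)).
      2: { rewrite CInt_const, Rminus_0_r. auto. }
      assert (HCs : forall z, Cmod z = s -> ccont g z) by (intros; apply HC; lra).
      rewrite <- CInt_minus; try lra.
      + apply Cmod_CInt_le; [lra| |].
        * intros th _. apply rcont_minus; [|apply rcont_const]. apply rcont_on_circle; auto; lra.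
        * intros th _. left. apply F. replace (circ s th - 0)%C with (circ s th) by ring.
          rewrite Cmod_circ; lra.
      + intros th _. apply rcont_on_circle; auto; lra.
      + intros th _. apply rcont_const.
    - intros z Hz. apply HC; lra.
    - intros z Hz. apply HD; lra.
    - unfold q in Hs. destruct (Req_EM_T (Cmod p) 0); lra. }
  replace (m / (4 * PI) * (2 * PI - 0)) with (m / 2) in E by (field; lra). lra.
Qed.

(** * Circle means and Cauchy's formula *)

Definition Cmean (f : R -> C) : C := (/ RtoC (2 * PI) * CInt f 0 (2 * PI))%C.
Definition Rmean (f : R -> R) : R := / (2 * PI) * RInt f 0 (2 * PI).

Lemma two_PI_pos : 0 < 2 * PI.
Proof. pose proof PI_RGT_0. lra. Qed.

Lemma two_PI_C_neq_0 : RtoC (2 * PI) <> 0%C.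
Proof. intros E. injection E. pose proof two_PI_pos. lra. Qed.

Lemma Cmean_ext (f g : R -> C) : (forall t, f t = g t) -> Cmean f = Cmean g.
Proof. intros E. f_equal. apply functional_extensionality; auto. Qed.

Lemma Rmean_ext (f g : R -> R) : (forall t, f t = g t) -> Rmean f = Rmean g.
Proof. intros E. f_equal. apply functional_extensionality; auto. Qed.

Lemma Cmean_plus (f g : R -> C) : (forall t, rcont f t) -> (forall t, rcont g t) ->
  Cmean (fun t => f t + g t)%C = (Cmean f + Cmean g)%C.
Proof.
  intros Hf Hg. unfold Cmean. pose proof two_PI_pos.
  rewrite CInt_plus; [ring|lra| |]; intros t _; auto.
Qed.

Lemma Cmean_minus (f g : R -> C) : (forall t, rcont f t) -> (forall t, rcont g t) ->
  Cmean (fun t => f t - g t)%C = (Cmean f - Cmean g)%C.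
Proof.
  intros Hf Hg. unfold Cmean. pose proof two_PI_pos.
  rewrite CInt_minus; [ring|lra| |]; intros t _; auto.
Qed.

Lemma Cmean_scal (c : C) (f : R -> C) : (forall t, rcont f t) ->
  Cmean (fun t => c * f t)%C = (c * Cmean f)%C.
Proof.
  intros Hf. unfold Cmean. pose proof two_PI_pos.
  rewrite CInt_scal; [ring|lra|]; intros t _; auto.
Qed.

Lemma Cmean_const (c : C) : Cmean (fun _ => c) = c.
Proof.
  unfold Cmean. rewrite CInt_const, Rminus_0_r. field. apply two_PI_C_neq_0.
Qed.

Lemma Cmod_Cmean_le_on (f : R -> C) (M : R) : (forall t, rcont f t) ->
  (forall t, 0 <= t <= 2 * PI -> Cmod (f t) <= M) -> Cmod (Cmean f) <= M.
Proof.
  intros Hf HM. unfold Cmean. pose proof two_PI_pos as HP.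
  rewrite Cmod_mult, Cmod_inv, Cmod_R, Rabs_pos_eq by (apply two_PI_C_neq_0 || lra).
  apply Rmult_le_reg_l with (2 * PI); auto. rewrite <- Rmult_assoc, Rinv_r, Rmult_1_l by lra.
  assert (Cmod (CInt f 0 (2 * PI)) <= M * (2 * PI - 0)); [|lra].
  apply Cmod_CInt_le; auto; [lra|]. intros t _; auto.
Qed.

Lemma Cmod_Cmean_le (f : R -> C) (M : R) : (forall t, rcont f t) ->
  (forall t, Cmod (f t) <= M) -> Cmod (Cmean f) <= M.
Proof. intros. apply Cmod_Cmean_le_on; auto. Qed.

Lemma Re_Cmean (f : R -> C) : Re (Cmean f) = Rmean (fun t => Re (f t)).
Proof.
  unfold Cmean, Rmean, Re. pose proof two_PI_pos.
  rewrite <- RtoC_inv by lra. unfold CInt, Cmult, RtoC. simpl. ring.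
Qed.

Lemma mean_value_except (g : C -> C) (t : R) (p : C) : 0 < t ->
  (forall z, Cmod z <= t -> ccont g z) ->
  (forall z, Cmod z <= t -> z <> p -> Cdiff g z) -> Cmod p <> t ->
  Cmean (fun th => g (circ t th)) = g 0%C.
Proof.
  intros Ht HC HD Hp. unfold Cmean. rewrite (circle_int_center g t p); auto.
  field. apply two_PI_C_neq_0.
Qed.

Lemma mean_value (g : C -> C) (t : R) : 0 < t ->
  (forall z, Cmod z <= t -> Cdiff g z) -> Cmean (fun th => g (circ t th)) = g 0%C.
Proof.
  intros Ht HD. apply (mean_value_except g t 0); auto.
  - intros; apply Cdiff_ccont; auto.
  - rewrite Cmod_0. lra.
Qed.

Lemma circ_minus_ge (t th : R) (w : C) : 0 <= t -> t - Cmod w <= Cmod (circ t th - w).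
Proof. intros Ht. pose proof (Cmod_sub_ge (circ t th) w) as H. rewrite Cmod_circ in H; auto. Qed.

Lemma circ_minus_neq_0 (t th : R) (w : C) : 0 <= t -> Cmod w <> t -> (circ t th - w)%C <> 0%C.
Proof.
  intros Ht Hw E. apply Hw. rewrite <- (Cminus_eq_0 _ _ E). apply Cmod_circ; auto.
Qed.

Lemma rcont_circ_div (f : R -> C) (t th : R) (w : C) : 0 <= t -> Cmod w <> t ->
  rcont f th -> rcont (fun s => f s / (circ t s - w))%C th.
Proof.
  intros. apply rcont_div; auto.
  - apply rcont_minus; [apply rcont_circ|apply rcont_const].
  - apply circ_minus_neq_0; auto.
Qed.

Lemma le_all_eps_0 (m : R) : (forall eps, 0 < eps -> m <= eps) -> m <= 0.
Proof. intros H. apply Rnot_lt_le. intros Hm. specialize (H (m/2)). lra. Qed.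

(** The kernel is 1 + w / (z - w). Its mean is the same on every circle around [w] centred at 0, and
    the second summand vanishes as the radius [s] tends to infinity. *)
Lemma Cmean_cauchy_kernel (t : R) (w : C) : Cmod w < t ->
  Cmean (fun th => circ t th / (circ t th - w))%C = 1%C.
Proof.
  intros Hw. pose proof (Cmod_ge_0 w) as Hw0. pose proof two_PI_pos as HP.
  assert (E : forall s, Cmod w < s ->
    Cmean (fun th => circ s th / (circ s th - w))%C
    = (1 + Cmean (fun th => w / (circ s th - w)))%C).
  { intros s Hs. rewrite <- (Cmean_const 1), <- Cmean_plus.
    - apply Cmean_ext. intros th. field. apply circ_minus_neq_0; lra.
    - intros; apply rcont_const.
    - intros; apply rcont_circ_div; try lra. apply rcont_const. }
  apply Cminus_eq_0, Cmod_eq_0, Rle_antisym; [|apply Cmod_ge_0].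
  apply le_all_eps_0. intros eps He.
  set (s := t + 1 + Cmod w / eps).
  assert (Hd : 0 <= Cmod w / eps) by (apply Rdiv_le_0_compat; lra).
  assert (HD : forall z, t <= Cmod z <= s -> Cdiff (fun z => z / (z - w))%C z).
  { intros z Hz. apply Cdiff_div; [apply Cdiff_id| |].
    - apply Cdiff_minus; [apply Cdiff_id|apply Cdiff_const].
    - intros Ez. apply Cminus_eq_0 in Ez. subst z. lra. }
  assert (Eq : Cmean (fun th => circ t th / (circ t th - w))%C
             = Cmean (fun th => circ s th / (circ s th - w))%C).
  { unfold Cmean. f_equal.
    apply (circle_int_eq (fun z => z / (z - w))%C t s 0); auto.
    - unfold s; lra.
    - intros; apply Cdiff_ccont; auto.
    - rewrite Cmod_0; lra.
    - rewrite Cmod_0; unfold s; lra. }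
  rewrite Eq, E by (unfold s; lra).
  replace (1 + Cmean (fun th => w / (circ s th - w)) - 1)%C
    with (Cmean (fun th => w / (circ s th - w)))%C by ring.
  apply Cmod_Cmean_le.
  - intros; apply rcont_circ_div; try (unfold s; lra). apply rcont_const.
  - intros th. assert (Hs : Cmod w / eps <= Cmod (circ s th - w)).
    { eapply Rle_trans; [|apply circ_minus_ge; unfold s; lra]. unfold s. lra. }
    assert (Hs' : 1 <= Cmod (circ s th - w)).
    { eapply Rle_trans; [|apply circ_minus_ge; unfold s; lra]. unfold s. lra. }
    rewrite Cmod_div by (apply Cmod_pos_neq; lra).
    apply Rmult_le_reg_r with (Cmod (circ s th - w)); [lra|].
    unfold Rdiv at 1. rewrite Rmult_assoc, Rinv_l by lra.
    assert (Cmod w = eps * (Cmod w / eps)) by (field; lra). nra.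
Qed.

(** Subtracting [g w] times the kernel leaves z [phi z], where [phi] is the difference quotient of
    [g] at [w]: holomorphic off [w], continuous at [w], so that the mean is the value at 0, which is
    0. *)
Lemma cauchy_formula (g : C -> C) (t : R) (w : C) : Cmod w < t ->
  (forall z, Cmod z <= t -> Cdiff g z) ->
  Cmean (fun th => circ t th * g (circ t th) / (circ t th - w))%C = g w.
Proof.
  intros Hw HD. pose proof (Cmod_ge_0 w) as Hw0.
  pose proof (HD w ltac:(lra)) as Hd. apply Cdiff_cderiv in Hd.
  destruct Hd as [L [phi [E [Hc F]]]].
  assert (Hphi : forall z, z <> w -> phi z = ((g z - g w) / (z - w))%C).
  { intros z Hz. rewrite (F z). field. apply Cminus_neq_0; auto. }
  assert (HDphi : forall z, Cmod z <= t -> z <> w -> Cdiff phi z).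
  { intros z Hz Hne.
    apply (Cdiff_ext_loc (fun z => (g z - g w) / (z - w))%C _ z (Cmod (z - w))).
    - apply Cmod_pos, Cminus_neq_0; auto.
    - intros v Hv. symmetry. apply Hphi. intros ->. rewrite Cmod_minus_sym in Hv. lra.
    - apply Cdiff_div.
      + apply Cdiff_minus; [auto|apply Cdiff_const].
      + apply Cdiff_minus; [apply Cdiff_id|apply Cdiff_const].
      + apply Cminus_neq_0; auto. }
  assert (M : Cmean (fun th => circ t th * phi (circ t th))%C = 0%C).
  { rewrite (mean_value_except (fun z => z * phi z)%C t w).
    - ring.
    - lra.
    - intros z Hz. apply ccont_mult; [apply ccont_id|].
      destruct (Cx_eq_dec z w) as [->|Hne]; auto. apply Cdiff_ccont; auto.
    - intros z Hz Hne. apply Cdiff_mult; [apply Cdiff_id|auto].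
    - lra. }
  assert (Hg : forall th, rcont (fun s => g (circ t s)) th).
  { apply rcont_on_circle; [lra|]. intros; apply Cdiff_ccont, HD; lra. }
  rewrite (Cmean_ext _ (fun th => g w * (circ t th / (circ t th - w))
     + circ t th * phi (circ t th))%C).
  - rewrite Cmean_plus, M, Cmean_scal, Cmean_cauchy_kernel; auto; try ring.
    + intros th. apply rcont_circ_div; try lra. apply rcont_circ.
    + intros th. apply rcont_mult; [apply rcont_const|].
      apply rcont_circ_div; try lra. apply rcont_circ.
    + intros th. apply rcont_mult; [apply rcont_circ|].
      apply rcont_on_circle; [lra|]. intros z Hz.
      apply Cdiff_ccont, HDphi; [lra|]. intros ->. lra.
  - intros th. assert (Hne : circ t th <> w).
    { intros <-. rewrite Cmod_circ in Hw; lra. }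
    rewrite Hphi by auto. field. apply Cminus_neq_0; auto.
Qed.

Lemma continuous_bounded_circle (f : R -> R) : (forall t, continuous f t) ->
  exists M, 0 <= M /\ forall t, 0 <= t <= 2 * PI -> f t <= M.
Proof.
  intros H. destruct (continuity_ab_maj f 0 (2 * PI)) as [m [Hm _]].
  - pose proof two_PI_pos; lra.
  - intros c _. apply continuity_pt_filterlim, H.
  - exists (Rmax 0 (f m)). split; [apply Rmax_l|]. intros t Ht.
    eapply Rle_trans; [apply Hm; auto|apply Rmax_r].
Qed.

(** Differentiation under the integral sign. The curve [psi] is arbitrary because later it is the
    image of a circle under the polynomial. *)
Lemma cauchy_type_Cdiff (phi psi : R -> C) (w0 : C) (d : R) :
  (forall t, rcont phi t) -> (forall t, rcont psi t) -> 0 < d ->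
  (forall t, d <= Cmod (psi t - w0)) ->
  Cdiff (fun w => Cmean (fun t => phi t / (psi t - w))%C) w0.
Proof.
  intros Hphi Hpsi Hd Hdist.
  destruct (continuous_bounded_circle (fun t => Cmod (phi t))) as [M [HM0 HM]].
  { intros t. apply rcont_Cmod; auto. }
  assert (Hn0 : forall t, (psi t - w0)%C <> 0%C).
  { intros t. apply Cmod_pos_neq. specialize (Hdist t). lra. }
  apply Cdiff_cderiv. exists (Cmean (fun t => phi t / ((psi t - w0) * (psi t - w0)))%C).
  apply cderiv_alt. intros eps He.
  assert (HK : 0 < 2 * (M + 1) / (d * d * d)).
  { apply Rdiv_lt_0_compat; [lra|]. repeat apply Rmult_lt_0_compat; auto. }
  set (K := 2 * (M + 1) / (d * d * d)) in *.
  exists (Rmin (d / 2) (eps / K)). split.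
  { apply Rmin_pos; [lra|]. apply Rdiv_lt_0_compat; auto. }
  intros w Hw. pose proof (Rmin_l (d / 2) (eps / K)). pose proof (Rmin_r (d / 2) (eps / K)).
  set (h := Cmod (w - w0)) in *.
  assert (Hdw : forall t, d / 2 <= Cmod (psi t - w)).
  { intros t. specialize (Hdist t). pose proof (Cmod_triangle3 (psi t) w w0). fold h in H1. lra. }
  assert (Hnw : forall t, (psi t - w)%C <> 0%C).
  { intros t. apply Cmod_pos_neq. specialize (Hdw t). lra. }
  assert (Hc0 : forall t, rcont (fun t => psi t - w0)%C t).
  { intros; apply rcont_minus; [auto|apply rcont_const]. }
  assert (Hcw : forall t, rcont (fun t => psi t - w)%C t).
  { intros; apply rcont_minus; [auto|apply rcont_const]. }
  assert (A1 : forall t, rcont (fun t => phi t / (psi t - w))%C t).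
  { intros; apply rcont_div; auto. }
  assert (A2 : forall t, rcont (fun t => phi t / (psi t - w0))%C t).
  { intros; apply rcont_div; auto. }
  assert (A3 : forall t, rcont (fun t => phi t / ((psi t - w0) * (psi t - w0)))%C t).
  { intros; apply rcont_div; auto; [apply rcont_mult; auto|apply Cmult_neq_0; auto]. }
  assert (A4 : forall t, rcont (fun t => (w - w0) * (phi t / ((psi t - w0) * (psi t - w0))))%C t).
  { intros; apply rcont_mult; auto. apply rcont_const. }
  assert (A5 : forall t, rcont (fun t => phi t / (psi t - w) - phi t / (psi t - w0))%C t).
  { intros; apply rcont_minus; auto. }
  rewrite (Cmult_comm _ (w - w0)%C).
  rewrite <- Cmean_scal, <- !Cmean_minus by auto.
  apply Cmod_Cmean_le_on; [intros; apply rcont_minus; auto|].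
  intros t Ht.
  replace (phi t / (psi t - w) - phi t / (psi t - w0)
     - (w - w0) * (phi t / ((psi t - w0) * (psi t - w0))))%C
    with (phi t * ((w - w0) * (w - w0)) / ((psi t - w) * ((psi t - w0) * (psi t - w0))))%C
    by (field; auto).
  rewrite Cmod_div by (repeat apply Cmult_neq_0; auto).
  rewrite !Cmod_mult. fold h.
  specialize (Hdist t). specialize (Hdw t). specialize (HM t Ht). simpl in HM.
  set (A := Cmod (psi t - w)) in *. set (B := Cmod (psi t - w0)) in *.
  assert (Hh : 0 <= h) by apply Cmod_ge_0.
  assert (HKh : K * h <= eps).
  { replace eps with (K * (eps / K)) by (field; lra). apply Rmult_le_compat_l; lra. }
  assert (Hden : d * d * d / 2 <= A * (B * B)).
  { replace (d * d * d / 2) with (d / 2 * (d * d)) by field.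
    apply Rmult_le_compat; try lra; [nra|]. apply Rmult_le_compat; lra. }
  assert (0 < d * d * d / 2) by (assert (0 < d * d * d) by (repeat apply Rmult_lt_0_compat; lra); lra).
  apply Rle_trans with (K * h * h); [|apply Rmult_le_compat_r; lra].
  apply Rmult_le_reg_r with (A * (B * B)); [lra|].
  unfold Rdiv at 1. rewrite Rmult_assoc, Rinv_l by lra.
  apply Rle_trans with (K * h * h * (d * d * d / 2)).
  - unfold K. replace (2 * (M + 1) / (d * d * d) * h * h * (d * d * d / 2))
      with ((M + 1) * (h * h)) by (field; lra).
    rewrite Rmult_1_r. apply Rmult_le_compat_r; [nra|lra].
  - apply Rmult_le_compat_l; [|lra]. apply Rmult_le_pos; [apply Rmult_le_pos|]; lra.
Qed.

(** Subtracting the mean value formula at 0 from Cauchy's formula at [w] brings out the factor [w];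
    the quotient is again a Cauchy-type integral. This takes the place of Taylor series. *)
Lemma divide_out_0 (g : C -> C) (t : R) : 0 < t ->
  (forall z, Cmod z <= t -> Cdiff g z) ->
  exists g1, (forall z, Cmod z < t -> Cdiff g1 z) /\
    forall z, Cmod z < t -> g z = (g 0 + z * g1 z)%C.
Proof.
  intros Ht HD. exists (fun w => Cmean (fun th => g (circ t th) / (circ t th - w))%C).
  assert (Hg : forall th, rcont (fun s => g (circ t s)) th).
  { apply rcont_on_circle; [lra|]. intros; apply Cdiff_ccont, HD; lra. }
  split.
  - intros w Hw. apply (cauchy_type_Cdiff (fun th => g (circ t th)) (circ t) w (t - Cmod w)); auto.
    + apply rcont_circ.
    + lra.
    + intros th. apply circ_minus_ge. lra.
  - intros w Hw. rewrite <- (cauchy_formula g t w Hw HD), <- (mean_value g t Ht HD).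
    assert (forall th, rcont (fun th0 => (g (circ t th0) / (circ t th0 - w))%C) th).
    { intros. apply rcont_circ_div; auto; lra. }
    rewrite <- Cmean_scal, <- Cmean_plus; auto.
    + apply Cmean_ext. intros th. field. apply circ_minus_neq_0; lra.
    + intros; apply rcont_mult; [apply rcont_const|auto].
Qed.

Lemma Cdiff_pow (g : C -> C) (N : nat) (z : C) : Cdiff g z -> Cdiff (fun w => g w ^ N)%C z.
Proof.
  intros H. induction N as [|N IH]; simpl.
  - apply Cdiff_const.
  - apply Cdiff_mult; auto.
Qed.

Lemma cauchy_estimate (G : C -> C) (t M : R) (w : C) : Cmod w < t ->
  (forall z, Cmod z <= t -> Cdiff G z) -> (forall th, Cmod (G (circ t th)) <= M) ->
  Cmod (G w) <= t * M / (t - Cmod w).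
Proof.
  intros Hw HD HM. pose proof (Cmod_ge_0 w). rewrite <- (cauchy_formula G t w Hw HD).
  apply Cmod_Cmean_le.
  - intros th. apply rcont_circ_div; try lra. apply rcont_mult; [apply rcont_circ|].
    apply rcont_on_circle; [lra|]. intros; apply Cdiff_ccont, HD; lra.
  - intros th. pose proof (circ_minus_ge t th w ltac:(lra)).
    rewrite Cmod_div by (apply circ_minus_neq_0; lra).
    rewrite Cmod_mult, Cmod_circ by lra.
    apply Rmult_le_compat.
    + apply Rmult_le_pos; [lra|apply Cmod_ge_0].
    + left; apply Rinv_0_lt_compat; lra.
    + apply Rmult_le_compat_l; [lra|auto].
    + apply Rinv_le_contravar; lra.
Qed.

(* Cauchy's estimate for the powers [G^N], as [N] tends to infinity. *)
Lemma maximum_modulus (G : C -> C) (t M : R) (w : C) : Cmod w < t ->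
  (forall z, Cmod z <= t -> Cdiff G z) -> (forall th, Cmod (G (circ t th)) <= M) ->
  Cmod (G w) <= M.
Proof.
  intros Hw HD HM. pose proof (Cmod_ge_0 w) as Hw0.
  assert (HM0 : 0 <= M) by (eapply Rle_trans; [|apply (HM 0)]; apply Cmod_ge_0).
  assert (HP : forall N, Cmod (G w) ^ N <= t / (t - Cmod w) * M ^ N).
  { intros N. rewrite <- Cmod_pow.
    replace (t / (t - Cmod w) * M ^ N) with (t * M ^ N / (t - Cmod w)) by (field; lra).
    apply (cauchy_estimate (fun z => G z ^ N)%C); auto.
    - intros z Hz. apply Cdiff_pow; auto.
    - intros th. rewrite Cmod_pow. apply pow_incr. split; [apply Cmod_ge_0|auto]. }
  apply Rnot_lt_le. intros Hgt.
  destruct (Req_dec M 0) as [E|E].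
  - specialize (HP 1%nat). rewrite E in HP. simpl in HP. lra.
  - set (x := Cmod (G w) / M - 1).
    assert (Hx : 0 < x).
    { unfold x. apply Rlt_0_minus. apply Rmult_lt_reg_r with M; [lra|].
      unfold Rdiv. rewrite Rmult_assoc, Rinv_l; lra. }
    assert (Ex : Cmod (G w) = M * (1 + x)) by (unfold x; field; lra).
    destruct (INR_unbounded (t / (t - Cmod w) / x)) as [N HN].
    specialize (HP N). rewrite Ex, Rpow_mult_distr in HP.
    pose proof (poly N x Hx) as HB.
    assert (0 < M ^ N) by (apply pow_lt; lra).
    assert (t / (t - Cmod w) < INR N * x).
    { replace (t / (t - Cmod w)) with (t / (t - Cmod w) / x * x) by (field; lra).
      apply Rmult_lt_compat_r; auto. }
    nra.
Qed.

(** It carries a bound on a circle over to slightly smaller circles, at a cost proportional to the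
    distance. *)
Lemma Cdiff_lipschitz (G : C -> C) (t T : R) : 0 < t < T ->
  (forall z, Cmod z <= T -> Cdiff G z) ->
  exists K, 0 <= K /\ forall z w, Cmod z <= t -> Cmod w <= t ->
    Cmod (G z - G w) <= K * Cmod (z - w).
Proof.
  intros Ht HD.
  assert (Hc : forall th, rcont (fun s => G (circ T s)) th).
  { apply rcont_on_circle; [lra|]. intros; apply Cdiff_ccont, HD; lra. }
  destruct (continuous_bounded_circle (fun th => Cmod (G (circ T th)))) as [M [HM0 HM]].
  { intros th. apply (rcont_Cmod (fun s => G (circ T s))), Hc. }
  exists (T * M / ((T - t) * (T - t))). split.
  { apply Rdiv_le_0_compat; [|nra]. apply Rmult_le_pos; lra. }
  intros z w Hz Hw.
  rewrite <- (cauchy_formula G T z), <- (cauchy_formula G T w) by (auto; lra).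
  assert (forall v th, Cmod v <= t -> rcont (fun s => (circ T s * G (circ T s) / (circ T s - v))%C) th).
  { intros. apply rcont_circ_div; try lra. apply rcont_mult; auto. apply rcont_circ. }
  rewrite <- Cmean_minus by auto.
  apply Cmod_Cmean_le_on; [intros; apply rcont_minus; auto|].
  intros th Hth.
  assert (N1 : (circ T th - z)%C <> 0%C) by (apply circ_minus_neq_0; lra).
  assert (N2 : (circ T th - w)%C <> 0%C) by (apply circ_minus_neq_0; lra).
  replace (circ T th * G (circ T th) / (circ T th - z)
           - circ T th * G (circ T th) / (circ T th - w))%C
    with (circ T th * G (circ T th) * (z - w) / ((circ T th - z) * (circ T th - w)))%C
    by (field; auto).
  rewrite Cmod_div, !Cmod_mult, Cmod_circ by (try apply Cmult_neq_0; auto; lra).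
  pose proof (circ_minus_ge T th z ltac:(lra)). pose proof (circ_minus_ge T th w ltac:(lra)).
  pose proof (Cmod_ge_0 (z - w)). specialize (HM th Hth). simpl in HM.
  pose proof (Cmod_ge_0 (G (circ T th))).
  replace (T * M / ((T - t) * (T - t)) * Cmod (z - w))
    with (T * M * Cmod (z - w) / ((T - t) * (T - t))) by (field; lra).
  assert (0 < (T - t) * (T - t)) by nra.
  apply Rmult_le_compat.
  - repeat apply Rmult_le_pos; lra.
  - left. apply Rinv_0_lt_compat. nra.
  - apply Rmult_le_compat_r; auto. apply Rmult_le_compat_l; lra.
  - apply Rinv_le_contravar; auto. apply Rmult_le_compat; lra.
Qed.

(** * Poisson integrals *)

Lemma continuous_ex_RInt (f : R -> R) (a b : R) : (forall t, continuous f t) -> ex_RInt f a b.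
Proof. intros H. apply (ex_RInt_continuous (V := R_CompleteNormedModule)). auto. Qed.

Lemma Rmean_plus (f g : R -> R) : (forall t, continuous f t) -> (forall t, continuous g t) ->
  Rmean (fun t => f t + g t) = Rmean f + Rmean g.
Proof.
  intros Hf Hg. unfold Rmean.
  rewrite <- (RInt_eq (fun t => 1 * f t + 1 * g t)); [|pose proof two_PI_pos; lra|intros; ring].
  rewrite RInt_lin by (apply continuous_ex_RInt; auto). ring.
Qed.

Lemma Rmean_scal (c : R) (f : R -> R) : (forall t, continuous f t) ->
  Rmean (fun t => c * f t) = c * Rmean f.
Proof.
  intros Hf. unfold Rmean.
  rewrite <- (RInt_eq (fun t => c * f t + 0 * f t)); [|pose proof two_PI_pos; lra|intros; ring].
  rewrite RInt_lin by (apply continuous_ex_RInt; auto). ring.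
Qed.

Lemma Rmean_opp (f : R -> R) : (forall t, continuous f t) ->
  Rmean (fun t => - f t) = - Rmean f.
Proof.
  intros Hf. rewrite (Rmean_ext _ (fun t => (-1) * f t)) by (intros; ring).
  rewrite Rmean_scal by auto. ring.
Qed.

Lemma Rmean_const (c : R) : Rmean (fun _ => c) = c.
Proof.
  unfold Rmean. rewrite RInt_const. unfold scal; simpl. unfold mult; simpl.
  pose proof PI_RGT_0. field. lra.
Qed.

Lemma Rmean_le_on (f g : R -> R) : (forall t, continuous f t) -> (forall t, continuous g t) ->
  (forall t, 0 <= t <= 2 * PI -> f t <= g t) -> Rmean f <= Rmean g.
Proof.
  intros Hf Hg H. unfold Rmean. pose proof two_PI_pos.
  apply Rmult_le_compat_l; [left; apply Rinv_0_lt_compat; auto|].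
  apply RInt_le; try (apply continuous_ex_RInt; auto); try lra.
  intros t Ht. apply H. lra.
Qed.

Lemma Rmean_le (f g : R -> R) : (forall t, continuous f t) -> (forall t, continuous g t) ->
  (forall t, f t <= g t) -> Rmean f <= Rmean g.
Proof. intros. apply Rmean_le_on; auto. Qed.

Lemma rcont_RtoC (u : R -> R) (t : R) : continuous u t -> rcont (fun s => RtoC (u s)) t.
Proof. intros. apply rcont_pair; auto. apply continuous_const. Qed.

Lemma rcont_Re (f : R -> C) (t : R) : rcont f t -> continuous (fun s => Re (f s)) t.
Proof. intros H. apply rcont_parts, H. Qed.

(** The Schwarz integral, a holomorphic function whose real part is the Poisson integral of [U]. It
    makes the maximum principle and the mean value property of holomorphic functions available for
    Poisson integrals. *)
Definition schwarz (r : R) (U : R -> R) (z : C) : C :=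
  Cmean (fun th => RtoC (U th) * ((circ r th + z) / (circ r th - z)))%C.

Definition poisson_kernel (r : R) (z : C) (th : R) : R :=
  Re ((circ r th + z) / (circ r th - z))%C.

Definition poisson (r : R) (U : R -> R) (z : C) : R := Re (schwarz r U z).

Lemma rcont_schwarz_kernel (r th : R) (z : C) : Cmod z < r ->
  rcont (fun s => (circ r s + z) / (circ r s - z))%C th.
Proof.
  intros Hz. pose proof (Cmod_ge_0 z). apply rcont_circ_div; try lra.
  apply rcont_plus; [apply rcont_circ|apply rcont_const].
Qed.

Lemma continuous_poisson_kernel (r th : R) (z : C) : Cmod z < r ->
  continuous (poisson_kernel r z) th.
Proof. intros Hz. apply rcont_Re, rcont_schwarz_kernel, Hz. Qed.

Lemma poisson_Rmean (r : R) (U : R -> R) (z : C) :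
  poisson r U z = Rmean (fun th => U th * poisson_kernel r z th).
Proof.
  unfold poisson, schwarz. rewrite Re_Cmean. apply Rmean_ext. intros th.
  unfold poisson_kernel, Re, Cmult, RtoC. simpl. ring.
Qed.

Lemma poisson_kernel_eq (r th : R) (z : C) : 0 <= r ->  Cmod z <> r ->
  poisson_kernel r z th = (r ^ 2 - Cmod z ^ 2) / Cmod (circ r th - z) ^ 2.
Proof.
  intros Hr Hz. pose proof (circ_minus_neq_0 r th z Hr Hz) as Hn.
  pose proof (Cmod_circ r th Hr) as Hm.
  set (e := circ r th) in *. unfold poisson_kernel. fold e.
  assert (Hp : 0 < Cmod (e - z) ^ 2) by (apply pow_lt, Cmod_pos; auto).
  rewrite <- Hm, !Cmod2_alt in *. destruct e as [a b], z as [x y].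
  unfold Re, Im, Cdiv, Cmult, Complex.Cinv, Cminus, Cplus, Copp in *. simpl in *.
  field. lra.
Qed.

Lemma poisson_kernel_bounds (r th : R) (z : C) : Cmod z < r ->
  (r - Cmod z) / (r + Cmod z) <= poisson_kernel r z th <= (r + Cmod z) / (r - Cmod z).
Proof.
  intros Hz. pose proof (Cmod_ge_0 z) as H0. rewrite poisson_kernel_eq by lra.
  pose proof (circ_minus_ge r th z ltac:(lra)) as H1.
  pose proof (Cmod_sub_le (circ r th) z) as H2. rewrite Cmod_circ in H2 by lra.
  set (m := Cmod z) in *. set (D := Cmod (circ r th - z)) in *.
  assert (HD : 0 < D) by lra. assert (0 < D ^ 2) by (apply pow_lt; auto).
  split.
  - apply Rle_trans with ((r ^ 2 - m ^ 2) / (r + m) ^ 2).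
    + right. field. lra.
    + apply Rmult_le_compat_l; [simpl; nra|]. apply Rinv_le_contravar; auto.
      apply pow_incr; lra.
  - apply Rle_trans with ((r ^ 2 - m ^ 2) / (r - m) ^ 2).
    + apply Rmult_le_compat_l; [simpl; nra|]. apply Rinv_le_contravar; [apply pow_lt; lra|].
      apply pow_incr; lra.
    + right. field. lra.
Qed.

Lemma poisson_kernel_nonneg (r th : R) (z : C) : Cmod z < r -> 0 <= poisson_kernel r z th.
Proof.
  intros Hz. eapply Rle_trans; [|apply poisson_kernel_bounds; auto].
  pose proof (Cmod_ge_0 z). apply Rdiv_le_0_compat; lra.
Qed.

Lemma poisson_le (r : R) (U V : R -> R) (z : C) : Cmod z < r ->
  (forall t, continuous U t) -> (forall t, continuous V t) ->
  (forall t, 0 <= t <= 2 * PI -> U t <= V t) -> poisson r U z <= poisson r V z.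
Proof.
  intros Hz HU HV H. rewrite !poisson_Rmean. apply Rmean_le_on.
  - intros; apply continuous_Rmult; auto. apply continuous_poisson_kernel; auto.
  - intros; apply continuous_Rmult; auto. apply continuous_poisson_kernel; auto.
  - intros t Ht. apply Rmult_le_compat_r; auto. apply poisson_kernel_nonneg; auto.
Qed.

Lemma poisson_plus (r : R) (U V : R -> R) (z : C) : Cmod z < r ->
  (forall t, continuous U t) -> (forall t, continuous V t) ->
  poisson r (fun t => U t + V t) z = poisson r U z + poisson r V z.
Proof.
  intros Hz HU HV. rewrite !poisson_Rmean, <- Rmean_plus.
  - apply Rmean_ext. intros; ring.
  - intros; apply continuous_Rmult; auto. apply continuous_poisson_kernel; auto.
  - intros; apply continuous_Rmult; auto. apply continuous_poisson_kernel; auto.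
Qed.

Lemma poisson_scal (r c : R) (U : R -> R) (z : C) : Cmod z < r ->
  (forall t, continuous U t) -> poisson r (fun t => c * U t) z = c * poisson r U z.
Proof.
  intros Hz HU. rewrite !poisson_Rmean, <- Rmean_scal.
  - apply Rmean_ext. intros; ring.
  - intros; apply continuous_Rmult; auto. apply continuous_poisson_kernel; auto.
Qed.

Lemma poisson_harnack (r : R) (U : R -> R) (z : C) : Cmod z < r ->
  (forall t, continuous U t) -> (forall t, 0 <= U t) ->
  poisson r U z <= (r + Cmod z) / (r - Cmod z) * Rmean U.
Proof.
  intros Hz HU HU0. rewrite poisson_Rmean, <- Rmean_scal by auto. apply Rmean_le.
  - intros; apply continuous_Rmult; auto. apply continuous_poisson_kernel; auto.
  - intros; apply continuous_Rmult; auto. apply continuous_const.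
  - intros t. rewrite Rmult_comm. apply Rmult_le_compat_r; auto.
    apply poisson_kernel_bounds; auto.
Qed.

Lemma poisson_0 (r : R) (U : R -> R) : 0 < r -> poisson r U 0 = Rmean U.
Proof.
  intros Hr. rewrite poisson_Rmean. apply Rmean_ext. intros th.
  unfold poisson_kernel. replace ((circ r th + 0) / (circ r th - 0))%C with (RtoC 1).
  - simpl. ring.
  - field. apply circ_neq_0; auto.
Qed.

Lemma schwarz_Cdiff (r : R) (U : R -> R) (z : C) : Cmod z < r ->
  (forall t, continuous U t) -> Cdiff (schwarz r U) z.
Proof.
  intros Hz HU. pose proof (Cmod_ge_0 z).
  (* By (e + w) / (e - w) = 2 e / (e - w) - 1 this is a Cauchy-type integral up to a constant. *)
  apply (Cdiff_ext_loc (fun w => Cmean (fun th => (2 * RtoC (U th) * circ r th) / (circ r th - w))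
    - Cmean (fun th => RtoC (U th)))%C _ z (r - Cmod z)); [lra| |].
  - intros w Hw. pose proof (Cmod_sub_ge w z).
    rewrite <- Cmean_minus.
    + apply Cmean_ext. intros th. field. apply circ_minus_neq_0; lra.
    + intros. apply rcont_circ_div; try lra. apply rcont_mult; [|apply rcont_circ].
      apply rcont_mult; [apply rcont_const|]. apply rcont_RtoC; auto.
    + intros. apply rcont_RtoC; auto.
  - apply Cdiff_minus; [|apply Cdiff_const].
    apply (cauchy_type_Cdiff (fun th => 2 * RtoC (U th) * circ r th)%C (circ r) z (r - Cmod z)).
    + intros. apply rcont_mult; [|apply rcont_circ].
      apply rcont_mult; [apply rcont_const|]. apply rcont_RtoC; auto.
    + apply rcont_circ.
    + lra.
    + intros. apply circ_minus_ge. lra.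
Qed.

Lemma Cconj_mult_circ (r th : R) : (Cconj (circ r th) * circ r th)%C = RtoC (r ^ 2).
Proof.
  unfold Cconj, circ, Cmult, RtoC. simpl. pose proof (sin2_cos2 th) as H. unfold Rsqr in H.
  f_equal; [|ring]. transitivity (r * r * (sin th * sin th + cos th * cos th)); [ring|].
  rewrite H. ring.
Qed.

Lemma poisson_kernel_split (r th : R) (z : C) : Cmod z < r ->
  RtoC (poisson_kernel r z th)
  = (circ r th / (circ r th - z) + Cconj z * circ r th / (RtoC (r ^ 2) - Cconj z * circ r th))%C.
Proof.
  intros Hz. pose proof (Cmod_ge_0 z). rewrite <- (Cconj_mult_circ r th).
  pose proof (circ_minus_neq_0 r th z ltac:(lra) ltac:(lra)) as Hn.
  pose proof (circ_neq_0 r th ltac:(lra)) as He.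
  rewrite poisson_kernel_eq by lra.
  pose proof (Cmod_circ r th ltac:(lra)) as Hm.
  set (e := circ r th) in *. rewrite <- Hm. clearbody e.
  assert (Hn' : (Cconj e - Cconj z)%C <> 0%C).
  { intros E. rewrite <- Cminus_conj in E. apply Hn.
    rewrite <- (Cconj_conj (e - z)), E. unfold Cconj, RtoC. simpl. f_equal. ring. }
  assert (0 < Cmod (e - z)) by (apply Cmod_pos; auto).
  assert (0 < Cmod (e - z) ^ 2) by (apply pow_lt; auto).
  rewrite RtoC_div by lra. rewrite RtoC_minus, !Cmod2_conj, Cminus_conj.
  field. repeat split; auto.
  replace (Cconj e * e - Cconj z * e)%C with (e * (Cconj e - Cconj z))%C by ring.
  apply Cmult_neq_0; auto.
Qed.

(* On the circle [Cconj e = r^2 / e], so the kernel is the sum of a Cauchy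
   kernel and of a function of [e] that is holomorphic and vanishes at [0]. *)
Lemma poisson_formula (r : R) (g : C -> C) (z : C) : Cmod z < r -> 
  (forall w, Cmod w <= r -> Cdiff g w) ->
  poisson r (fun th => Re (g (circ r th))) z = Re (g z).
Proof.
  intros Hz HD. pose proof (Cmod_ge_0 z) as H0.
  assert (Hg : forall th, rcont (fun s => g (circ r s)) th).
  { apply rcont_on_circle; [lra|]. intros; apply Cdiff_ccont, HD; lra. }
  assert (Hnz : forall w, Cmod w <= r -> (RtoC (r ^ 2) - Cconj z * w)%C <> 0%C).
  { intros w Hw E. apply Cminus_eq_0 in E.
    assert (Em : Cmod (RtoC (r ^ 2)) = Cmod (Cconj z * w)%C) by congruence.
    rewrite Cmod_R, Rabs_pos_eq in Em by (apply pow_le; lra).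
    rewrite Cmod_mult, Cmod_conj in Em. pose proof (Cmod_ge_0 w).
    assert (Cmod z * Cmod w <= Cmod z * r) by (apply Rmult_le_compat_l; lra).
    simpl in Em. nra. }
  assert (E : Cmean (fun th => g (circ r th) * RtoC (poisson_kernel r z th))%C = g z).
  { assert (M2 : Cmean (fun th => g (circ r th) * (Cconj z * circ r th / (RtoC (r ^ 2) - Cconj z * circ r th)))%C = 0%C).
    { rewrite (mean_value (fun w => g w * (Cconj z * w / (RtoC (r ^ 2) - Cconj z * w)))%C r); [|lra|].
      - assert (E0 : RtoC (r ^ 2) <> 0%C).
        { replace (RtoC (r ^ 2)) with (RtoC (r ^ 2) - Cconj z * 0)%C by ring.
          apply Hnz. rewrite Cmod_0. lra. }
        replace (RtoC (r ^ 2) - Cconj z * 0)%C with (RtoC (r ^ 2)) by ring.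
        set (q := RtoC (r ^ 2)) in *. field. auto.
      - intros w Hw. apply Cdiff_mult; auto. apply Cdiff_div; auto.
        + apply Cdiff_mult; [apply Cdiff_const|apply Cdiff_id].
        + apply Cdiff_minus; [apply Cdiff_const|].
          apply Cdiff_mult; [apply Cdiff_const|apply Cdiff_id]. }
    rewrite <- (cauchy_formula g r z Hz HD), <- Cplus_0_r, <- M2, <- Cmean_plus.
    - apply Cmean_ext. intros th. rewrite poisson_kernel_split by auto. field.
      split; [|apply circ_minus_neq_0; lra]. apply Hnz. rewrite Cmod_circ; lra.
    - intros. apply rcont_circ_div; try lra. apply rcont_mult; auto. apply rcont_circ.
    - intros th. apply rcont_mult; auto. apply rcont_div.
      + apply rcont_mult; [apply rcont_const|apply rcont_circ].
      + apply rcont_minus; [apply rcont_const|].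
        apply rcont_mult; [apply rcont_const|apply rcont_circ].
      + apply Hnz. rewrite Cmod_circ; lra. }
  rewrite <- E, Re_Cmean, poisson_Rmean. apply Rmean_ext. intros th.
  unfold Re, Cmult, RtoC. simpl. ring.
Qed.

Lemma cos_gt_small (u eta : R) : - PI <= u <= PI -> 0 <= eta <= PI -> cos eta < cos u ->
  Rabs u < eta.
Proof.
  intros Hu He Hc. apply Rnot_le_lt. intros Hle.
  assert (Hcu : cos (Rabs u) = cos u).
  { unfold Rabs. destruct (Rcase_abs u); auto. apply cos_neg. }
  assert (Rabs u <= PI) by (apply Rabs_le; lra).
  pose proof (cos_decr_1 eta (Rabs u)). rewrite Hcu in H0. lra.
Qed.

(** Closeness modulo 2 PI is measured by 1 - cos, because the Poisson integral of this function is
    known explicitly. *)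
Lemma periodic_modulus (U : R -> R) (eps : R) : (forall t, continuous U t) ->
  (forall t, U (t + 2 * PI) = U t) -> 0 < eps ->
  exists kappa, 0 < kappa /\ forall th phi, 0 <= th <= 2 * PI -> - PI <= phi <= PI ->
    1 - cos (th - phi) < kappa -> Rabs (U th - U phi) <= eps.
Proof.
  intros HU Hper He. pose proof PI_RGT_0 as HPI.
  destruct (Heine_cor2 (f := U) (a := - (2 * PI)) (b := 2 * PI)) with (eps := mkposreal eps He)
    as [[eta Heta] F].
  { intros x _. apply continuity_pt_filterlim, HU. }
  simpl in F. set (e := Rmin eta PI).
  assert (0 < e) by (apply Rmin_pos; lra).
  assert (e <= eta) by apply Rmin_l. assert (e <= PI) by apply Rmin_r.
  exists (1 - cos e). split.
  { assert (cos e < cos 0) by (apply cos_decreasing_1; lra). rewrite cos_0 in *. lra. }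
  intros th phi Hth Hphi Hc.
  destruct (Rle_dec (th - phi) PI) as [Hd|Hd].
  - left. apply F; try lra.
    assert (Rabs (th - phi) < e); [|lra]. apply cos_gt_small; lra.
  (* Here [th - phi] exceeds PI, and a shift by a full turn brings it back to [- PI, PI]. *)
  - left. replace (U th) with (U (th - 2 * PI)).
    2: { rewrite <- Hper. f_equal. ring. }
    apply F; try lra.
    assert (Rabs (th - 2 * PI - phi) < e); [|lra]. apply cos_gt_small; try lra.
    replace (cos (th - 2 * PI - phi)) with (cos (th - phi)); [lra|].
    replace (th - phi) with (th - 2 * PI - phi + 2 * PI) by ring.
    rewrite cos_plus, cos_2PI, sin_2PI. ring.
Qed.

(* [|U th - U phi| <= eps + C (1 - cos (th - phi))], and the Poisson integral
   of the right-hand side is explicit. *)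
Lemma poisson_boundary (r : R) (U : R -> R) (eps : R) : 0 < r ->
  (forall t, continuous U t) -> (forall t, U (t + 2 * PI) = U t) -> 0 < eps ->
  exists delta, 0 < delta /\ forall s phi, 0 <= s < r -> r - delta < s -> - PI <= phi <= PI ->
    Rabs (poisson r U (circ s phi) - U phi) <= eps.
Proof.
  intros Hr HU Hper He. pose proof PI_RGT_0 as HPI.
  destruct (continuous_bounded_circle (fun t => Rabs (U t))) as [M [HM0 HM]].
  { intros t. apply (continuous_comp U Rabs); auto. apply continuous_Rabs. }
  assert (HM' : forall t, - PI <= t <= 2 * PI -> Rabs (U t) <= M).
  { intros t Ht. destruct (Rle_dec 0 t); [apply HM; lra|].
    rewrite <- Hper. apply HM. lra. }
  destruct (periodic_modulus U (eps / 2)) as [k [Hk F]]; auto; [lra|].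
  set (K := 2 * M / k).
  assert (HK : 0 <= K) by (apply Rdiv_le_0_compat; lra).
  assert (HF : forall th phi, 0 <= th <= 2 * PI -> - PI <= phi <= PI ->
    Rabs (U th - U phi) <= eps / 2 + K * (1 - cos (th - phi))).
  { intros th phi Hth Hphi. pose proof (COS_bound (th - phi)) as Hcb.
    destruct (Rlt_dec (1 - cos (th - phi)) k) as [Hc|Hc].
    - specialize (F th phi Hth Hphi Hc).
      assert (0 <= K * (1 - cos (th - phi))) by (apply Rmult_le_pos; lra). lra.
    - assert (Rabs (U th - U phi) <= 2 * M).
      { eapply Rle_trans; [apply Rabs_triang|]. rewrite Rabs_Ropp.
        pose proof (HM' th ltac:(lra)). pose proof (HM' phi ltac:(lra)). lra. }
      assert (K * k <= K * (1 - cos (th - phi))) by (apply Rmult_le_compat_l; lra).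
      assert (K * k = 2 * M) by (unfold K; field; lra). lra. }
  exists (r * (eps / 2) / (K + 1)). split.
  { apply Rdiv_lt_0_compat; [|lra]. apply Rmult_lt_0_compat; lra. }
  intros s phi Hs Hsd Hphi.
  assert (Hz : Cmod (circ s phi) < r) by (rewrite Cmod_circ; lra).
  set (z := circ s phi) in *.
  assert (Hcc : forall t, continuous (fun th => cos (th - phi)) t).
  { intros t. apply (continuous_comp (fun th => th - phi) cos); [|apply continuous_cos'].
    apply (continuous_minus (fun th => th) (fun _ => phi)); [apply continuous_id|apply continuous_const]. }
  assert (Pc : forall c, poisson r (fun _ => c) z = c).
  { intros c. apply (poisson_formula r (fun _ => RtoC c) z Hz).
    intros; apply Cdiff_const. }
  assert (Pcos : poisson r (fun th => cos (th - phi)) z = s / r).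
  { transitivity (poisson r (fun th => Re (circ (/ r) (- phi) * circ r th)%C) z).
    - f_equal. apply functional_extensionality. intros th.
      unfold Re, circ, Cmult. simpl. rewrite cos_minus, cos_neg, sin_neg. field. lra.
    - rewrite (poisson_formula r (fun w => circ (/ r) (- phi) * w)%C z Hz).
      + unfold z, Re, circ, Cmult. simpl. rewrite cos_neg, sin_neg.
        pose proof (sin2_cos2 phi) as H. unfold Rsqr in H.
        transitivity (s / r * (sin phi * sin phi + cos phi * cos phi)); [field; lra|].
        rewrite H. ring.
      + intros. apply Cdiff_mult; [apply Cdiff_const|apply Cdiff_id]. }
  set (V := fun th => eps / 2 + K * (1 - cos (th - phi))).
  assert (HV : forall t, continuous V t).
  { intros t. apply (continuous_plus (fun _ => eps / 2)); [apply continuous_const|].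
    apply (continuous_Rmult (fun _ => K)); [apply continuous_const|].
    apply (continuous_minus (fun _ => 1)); [apply continuous_const|auto]. }
  assert (PV : poisson r V z = eps / 2 + K * (1 - s / r)).
  { transitivity (poisson r (fun th => (eps / 2 + K) + (- K) * cos (th - phi)) z).
    - f_equal. apply functional_extensionality. intros th. unfold V. ring.
    - rewrite (poisson_plus r (fun _ => eps / 2 + K)); auto.
      + rewrite Pc, poisson_scal, Pcos by auto. ring.
      + intros; apply continuous_const.
      + intros. apply (continuous_Rmult (fun _ => - K)); [apply continuous_const|auto]. }
  assert (HVle : poisson r V z <= eps).
  { rewrite PV. assert (K * (1 - s / r) <= eps / 2); [|lra].
    replace (1 - s / r) with ((r - s) / r) by (field; lra).
    apply Rle_trans with ((K + 1) * ((r * (eps / 2) / (K + 1)) / r)).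
    - apply Rmult_le_compat; try lra.
      + apply Rdiv_le_0_compat; lra.
      + apply Rmult_le_compat_r; [left; apply Rinv_0_lt_compat; lra|lra].
    - right. field. lra. }
  assert (H1 : poisson r U z <= U phi + poisson r V z).
  { rewrite <- (Pc (U phi)) at 1. rewrite <- poisson_plus; auto; [|intros; apply continuous_const].
    apply poisson_le; auto.
    - intros t. apply (continuous_plus (fun _ => U phi)); [apply continuous_const|auto].
    - intros t Ht. specialize (HF t phi Ht Hphi). apply Rabs_le_between in HF. unfold V. lra. }
  assert (H2 : U phi <= poisson r U z + poisson r V z).
  { rewrite <- (Pc (U phi)) at 1. rewrite <- poisson_plus; auto.
    apply poisson_le; auto.
    - intros; apply continuous_const.
    - intros t. apply (continuous_plus U V); auto.
    - intros t Ht. specialize (HF t phi Ht Hphi). apply Rabs_le_between in HF. unfold V. lra. }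
  apply Rabs_le. lra.
Qed.

Lemma polar_form_bound (p : C) : exists a, - PI <= a <= PI /\ p = circ (Cmod p) a.
Proof.
  destruct (polar_form p) as [a Ha].
  destruct (archimed (a / (2 * PI) - 1 / 2)) as [A1 A2].
  pose proof PI_RGT_0.
  set (k := up (a / (2 * PI) - 1 / 2)) in *.
  assert (Hp : forall (n : nat) x, circ (Cmod p) (x + 2 * PI * INR n) = circ (Cmod p) x).
  { induction n as [|n IH]; intros x.
    - simpl. f_equal. ring.
    - replace (x + 2 * PI * INR (S n)) with (x + 2 * PI * INR n + 2 * PI) by (rewrite S_INR; ring).
      rewrite circ_period. apply IH. }
  assert (Ea : a = 2 * PI * (a / (2 * PI))) by (field; lra).
  exists (a - 2 * PI * IZR k). split; [nra|].
  rewrite Ha at 1. destruct (Z.le_gt_cases 0 k) as [Hk|Hk].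
  - rewrite <- (Hp (Z.to_nat k) (a - 2 * PI * IZR k)). f_equal.
    rewrite INR_IZR_INZ, Z2Nat.id by auto. ring.
  - rewrite <- (Hp (Z.to_nat (- k)) a). f_equal.
    rewrite INR_IZR_INZ, Z2Nat.id, opp_IZR by lia. ring.
Qed.

(* Maximum principle for [G exp (- schwarz r U)]. *)
Lemma poisson_majorant (r t : R) (G : C -> C) (U : R -> R) (w : C) : r < t -> Cmod w < r ->
  (forall z, Cmod z <= t -> Cdiff G z) ->
  (forall th, continuous U th) -> (forall th, U (th + 2 * PI) = U th) ->
  (forall th, Cmod (G (circ r th)) <= exp (U th)) ->
  Cmod (G w) <= exp (poisson r U w).
Proof.
  intros Hrt Hw HD HU Hper HG. pose proof (Cmod_ge_0 w) as Hw0.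
  set (Phi := fun z => (G z * cexp (- schwarz r U z))%C).
  assert (HPhi : forall z, Cmod (Phi z) = Cmod (G z) * exp (- poisson r U z)).
  { intros z. unfold Phi. rewrite Cmod_mult, Cmod_cexp. auto. }
  assert (HPD : forall z, Cmod z < r -> Cdiff Phi z).
  { intros z Hz. apply Cdiff_mult; [apply HD; lra|].
    apply (Cdiff_comp cexp (fun z => - schwarz r U z)%C); [|apply Cdiff_cexp].
    apply Cdiff_opp, schwarz_Cdiff; auto. }
  destruct (Cdiff_lipschitz G r t) as [K [HK0 HK]]; auto; [lra|].
  destruct (continuous_bounded_circle (fun t => Rabs (U t))) as [M [HM0 HM]].
  { intros th. apply (continuous_comp U Rabs); auto. apply continuous_Rabs. }
  assert (HM' : forall phi, - PI <= phi <= PI -> Rabs (U phi) <= M).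
  { intros phi Hphi. destruct (Rle_dec 0 phi); [apply HM; lra|].
    rewrite <- Hper. apply HM. pose proof PI_RGT_0. lra. }
  assert (H1 : Cmod (Phi w) <= 1).
  { apply Rminus_le. apply le_all_eps_0. intros eps' He'.
    (* The bound below is (1 + eps)^2, and (1 + eps)^2 - 1 <= 3 eps for eps <= 1. *)
    set (eps := Rmin 1 (eps' / 3)).
    assert (He : 0 < eps) by (apply Rmin_pos; lra).
    assert (He1 : eps <= 1) by apply Rmin_l. assert (He2 : eps <= eps' / 3) by apply Rmin_r.
    assert (Hln : 0 < ln (1 + eps)) by (rewrite <- ln_1; apply ln_increasing; lra).
    destruct (poisson_boundary r U (ln (1 + eps))) as [d [Hd F]]; auto; [lra|].
    (* [m] is the distance to the circle: less than [d] for the boundary behaviour of the Poisson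
       integral, less than r - |w| to keep [w] inside, and so small that the Lipschitz change of [G]
       is at most eps times the lower bound exp (- M) of exp U. *)
    set (m := Rmin (Rmin d (r - Cmod w)) (eps * exp (- M) / (K + 1)) / 2).
    assert (HeM : 0 < eps * exp (- M) / (K + 1)).
    { apply Rdiv_lt_0_compat; [|lra]. apply Rmult_lt_0_compat; auto. apply exp_pos. }
    assert (Hm : 0 < m /\ m < d /\ m < r - Cmod w /\ m < eps * exp (- M) / (K + 1)).
    { assert (0 < Rmin (Rmin d (r - Cmod w)) (eps * exp (- M) / (K + 1))).
      { apply Rmin_pos; auto. apply Rmin_pos; lra. }
      pose proof (Rmin_l (Rmin d (r - Cmod w)) (eps * exp (- M) / (K + 1))).
      pose proof (Rmin_r (Rmin d (r - Cmod w)) (eps * exp (- M) / (K + 1))).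
      pose proof (Rmin_l d (r - Cmod w)). pose proof (Rmin_r d (r - Cmod w)).
      unfold m. lra. }
    clearbody m. set (s := r - m).
    assert (Hs : Cmod (Phi w) <= (1 + eps) * (1 + eps)).
    { apply (maximum_modulus Phi s); [unfold s; lra| |].
      - intros z Hz. apply HPD. unfold s in Hz. lra.
      - intros th. destruct (polar_form_bound (circ s th)) as [phi [Hphi E]].
        rewrite Cmod_circ in E by (unfold s; lra). rewrite E, HPhi.
        specialize (F s phi ltac:(unfold s; lra) ltac:(unfold s; lra) Hphi).
        apply Rabs_le_between in F.
        assert (HL : Cmod (G (circ s phi)) <= exp (U phi) + K * m).
        { pose proof (HK (circ s phi) (circ r phi)) as HL.
          rewrite !Cmod_circ in HL by (unfold s; lra). specialize (HL ltac:(unfold s; lra) ltac:(lra)).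
          replace (circ s phi - circ r phi)%C with (- circ m phi)%C in HL.
          2: { apply injective_projections; unfold s, circ; simpl; ring. }
          rewrite Cmod_opp, Cmod_circ in HL by lra.
          pose proof (Cmod_sub_ge (G (circ s phi)) (G (circ r phi))). specialize (HG phi). lra. }
        assert (HKm : K * m <= eps * exp (- M)).
        { replace (eps * exp (- M)) with ((K + 1) * (eps * exp (- M) / (K + 1))) by (field; lra).
          apply Rmult_le_compat; lra. }
        assert (HMU : exp (- M) <= exp (U phi)).
        { specialize (HM' phi Hphi). apply Rabs_le_between in HM'.
          destruct (Req_dec (- M) (U phi)) as [->|]; [lra|]. left; apply exp_increasing; lra. }
        assert (HGU : Cmod (G (circ s phi)) <= (1 + eps) * exp (U phi)).
        { assert (eps * exp (- M) <= eps * exp (U phi)) by (apply Rmult_le_compat_l; lra). lra. }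
        assert (Hexp : exp (- poisson r U (circ s phi)) <= (1 + eps) * exp (- U phi)).
        { rewrite <- (exp_ln (1 + eps)) by lra. rewrite <- exp_plus.
          set (a := - poisson r U (circ s phi)). set (b := ln (1 + eps) + - U phi).
          assert (Hab : a <= b) by (unfold a, b; lra).
          destruct Hab as [Hab|<-]; [left; apply exp_increasing; auto|lra]. }
        replace ((1 + eps) * (1 + eps)) with ((1 + eps) * exp (U phi) * ((1 + eps) * exp (- U phi))).
        + apply Rmult_le_compat; auto; [apply Cmod_ge_0|left; apply exp_pos].
        + pose proof (exp_pos (U phi)). rewrite exp_Ropp. field. lra. }
    nra. }
  rewrite HPhi, exp_Ropp in H1. pose proof (exp_pos (poisson r U w)).
  apply Rmult_le_reg_r with (/ exp (poisson r U w)); [apply Rinv_0_lt_compat; auto|].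
  rewrite Rinv_r; lra.
Qed.

(** * Circle means of log |G| and Jensen's formula for a linear factor *)

Lemma continuous_ln' (x : R) : 0 < x -> continuous ln x.
Proof.
  intros Hx. apply continuity_pt_filterlim, derivable_continuous_pt.
  exists (/ x). apply derivable_pt_lim_ln; auto.
Qed.

Lemma continuous_ln_Cmod (f : R -> C) (t : R) : rcont f t -> f t <> 0%C ->
  continuous (fun s => ln (Cmod (f s))) t.
Proof.
  intros Hf Hz. apply (continuous_comp (fun s => Cmod (f s)) ln).
  - apply rcont_Cmod; auto.
  - apply continuous_ln', Cmod_pos; auto.
Qed.

(* Majorise both [G] and [1 / G] by the Poisson integrals of [ln |G|] and [- ln |G|]. *)
Lemma mean_log_nonvanishing (r t : R) (G : C -> C) : 0 < r < t ->
  (forall z, Cmod z <= t -> Cdiff G z) -> (forall z, Cmod z <= t -> G z <> 0%C) ->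
  Rmean (fun th => ln (Cmod (G (circ r th)))) = ln (Cmod (G 0%C)).
Proof.
  intros Hrt HD Hnz.
  set (U := fun th => ln (Cmod (G (circ r th)))).
  assert (HGc : forall th, G (circ r th) <> 0%C).
  { intros. apply Hnz. rewrite Cmod_circ; lra. }
  assert (HU : forall th, continuous U th).
  { intros. apply (continuous_ln_Cmod (fun s => G (circ r s))); auto.
    apply rcont_on_circle; [lra|]. intros; apply Cdiff_ccont, HD; lra. }
  assert (Hper : forall th, U (th + 2 * PI) = U th).
  { intros. unfold U. rewrite circ_period. auto. }
  assert (H0 : Cmod (RtoC 0) < r) by (rewrite Cmod_0; lra).
  assert (HG0 : 0 < Cmod (G 0%C)) by (apply Cmod_pos, Hnz; lra).
  assert (H1 : Cmod (G 0%C) <= exp (poisson r U 0)).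
  { apply (poisson_majorant r t G U); auto; [lra|]. intros th. unfold U.
    rewrite exp_ln; [lra|]. apply Cmod_pos; auto. }
  assert (H2 : Cmod (/ G 0)%C <= exp (poisson r (fun th => - U th) 0)).
  { apply (poisson_majorant r t (fun z => / G z)%C); auto; [lra| | | |].
    - intros z Hz. apply Cdiff_inv; auto.
    - intros th. apply (continuous_opp U); auto.
    - intros th. rewrite Hper. auto.
    - intros th. unfold U. rewrite Cmod_inv, exp_Ropp, exp_ln; auto; [lra|]. apply Cmod_pos; auto. }
  rewrite poisson_0 in H1, H2 by lra. rewrite Rmean_opp, exp_Ropp, Cmod_inv in H2 by (auto; apply Hnz; lra).
  fold U. apply Rinv_le_contravar in H2; [|apply Rinv_0_lt_compat; auto].
  rewrite !Rinv_inv in H2.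
  rewrite <- (ln_exp (Rmean U)). f_equal. lra.
Qed.

(** On |z| = r the conjugate of z is r^2 / z. Thus |z - b| is the modulus of a linear function of z
    whose zero is the mirror image of [b], outside the disc when [b] is inside. *)
Lemma Cmod_reflect (r th : R) (b : C) : 0 < r ->
  Cmod (circ r th - b) = Cmod (RtoC r - Cconj b / RtoC r * circ r th).
Proof.
  intros Hr. assert (Hr0 : RtoC r <> 0%C) by (intros E; injection E; lra).
  replace (RtoC r - Cconj b / RtoC r * circ r th)%C
    with ((Cconj (circ r th) - Cconj b) * circ r th / RtoC r)%C.
  - rewrite Cmod_div, Cmod_mult, <- Cminus_conj, Cmod_conj, Cmod_circ, Cmod_R, Rabs_pos_eq by (auto; lra).
    field. lra.
  - replace ((Cconj (circ r th) - Cconj b) * circ r th)%C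
      with (Cconj (circ r th) * circ r th - Cconj b * circ r th)%C by ring.
    rewrite Cconj_mult_circ.
    replace (RtoC (r ^ 2)) with (RtoC r * RtoC r)%C.
    + field. auto.
    + simpl. rewrite Rmult_1_r, RtoC_mult. auto.
Qed.

Lemma mean_log_circle (r : R) (b : C) : 0 < r -> Cmod b <> r ->
  Rmean (fun th => ln (Cmod (circ r th - b))) = ln (Rmax r (Cmod b)).
Proof.
  intros Hr Hb. pose proof (Cmod_ge_0 b) as Hb0. destruct (Rlt_dec r (Cmod b)) as [H|H].
  - rewrite Rmax_right by lra.
    rewrite (mean_log_nonvanishing r ((r + Cmod b) / 2) (fun z => z - b)%C).
    + replace (0 - b)%C with (- b)%C by ring. rewrite Cmod_opp. auto.
    + lra.
    + intros; apply Cdiff_minus; [apply Cdiff_id|apply Cdiff_const].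
    + intros z Hz E. apply Cminus_eq_0 in E. subst. lra.
  - assert (Hr0 : RtoC r <> 0%C) by (intros E; injection E; lra).
    rewrite Rmax_left by lra.
    rewrite (Rmean_ext _ (fun th => ln (Cmod (RtoC r - Cconj b / RtoC r * circ r th))))
      by (intros; rewrite Cmod_reflect; auto).
    (* A radius beyond [r] but before the mirror image of [b]: |b| (2 r - |b|) < r^2 because (r -
       |b|)^2 > 0. *)
    rewrite (mean_log_nonvanishing r (2 * r - Cmod b) (fun z => RtoC r - Cconj b / RtoC r * z)%C).
    + replace (RtoC r - Cconj b / RtoC r * 0)%C with (RtoC r) by ring.
      rewrite Cmod_R, Rabs_pos_eq by lra. auto.
    + lra.
    + intros. apply Cdiff_minus; [apply Cdiff_const|].
      apply Cdiff_mult; [apply Cdiff_const|apply Cdiff_id].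
    + intros z Hz E. apply Cminus_eq_0 in E.
      assert (Em : Cmod (RtoC r) = Cmod (Cconj b / RtoC r * z)%C) by congruence.
      rewrite Cmod_mult, Cmod_div, Cmod_conj, Cmod_R, Rabs_pos_eq in Em by (auto; lra).
      assert (r * r = Cmod b * Cmod z) by (rewrite Em at 1; field; lra).
      assert (Cmod b * Cmod z <= Cmod b * (2 * r - Cmod b)) by (apply Rmult_le_compat_l; lra).
      assert (0 < (r - Cmod b) * (r - Cmod b)) by (apply Rmult_lt_0_compat; lra).
      lra.
Qed.

(** * The characteristic of a meromorphic function with given poles *)

Definition rprod (L : list C) (z : C) : C :=
  fold_right (fun b acc => (z - b) * acc)%C 1%C L.

Definition lsum {A : Type} (f : A -> R) (L : list A) : R :=
  fold_right (fun b acc => f b + acc) 0 L.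

Lemma rprod_app (L M : list C) (z : C) : rprod (L ++ M) z = (rprod L z * rprod M z)%C.
Proof.
  induction L as [|b L IH]; simpl; [ring|]. fold (rprod (L ++ M) z).
  rewrite IH. fold (rprod L z). ring.
Qed.

Lemma rprod_neq_0 (L : list C) (z : C) : ~ In z L -> rprod L z <> 0%C.
Proof.
  induction L as [|b L IH]; simpl; intros H.
  - intros E. injection E. lra.
  - apply Cmult_neq_0; [|apply IH; tauto]. apply Cminus_neq_0. intros ->. tauto.
Qed.

Lemma Cdiff_rprod (L : list C) (z : C) : Cdiff (rprod L) z.
Proof.
  induction L as [|b L IH].
  - apply (Cdiff_const 1%C).
  - apply (Cdiff_mult (fun w => w - b)%C (rprod L)); auto.
    apply Cdiff_minus; [apply Cdiff_id|apply Cdiff_const].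
Qed.

Lemma rprod_split (L : list C) (a z : C) :
  rprod L z = ((z - a) ^ count_occ Cx_eq_dec L a * rprod (remove Cx_eq_dec a L) z)%C.
Proof.
  induction L as [|b L IH]; simpl; [ring|]. fold (rprod L z). rewrite IH.
  destruct (Cx_eq_dec b a) as [E|Hne], (Cx_eq_dec a b) as [E'|Hne']; try congruence; simpl.
  - subst b. ring.
  - fold (rprod (remove Cx_eq_dec a L) z). ring.
Qed.

Lemma lsum_cons {A : Type} (f : A -> R) (b : A) (L : list A) :
  lsum f (b :: L) = f b + lsum f L.
Proof. reflexivity. Qed.

Lemma rprod_cons (b : C) (L : list C) (z : C) : rprod (b :: L) z = ((z - b) * rprod L z)%C.
Proof. reflexivity. Qed.

Lemma lsum_ext {A : Type} (f g : A -> R) (L : list A) :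
  (forall b, In b L -> f b = g b) -> lsum f L = lsum g L.
Proof.
  induction L as [|b L IH]; intros H; auto. rewrite !lsum_cons.
  rewrite (H b), IH; simpl; auto. intros; apply H; simpl; auto.
Qed.

Lemma lsum_plus {A : Type} (f g : A -> R) (L : list A) :
  lsum (fun b => f b + g b) L = lsum f L + lsum g L.
Proof.
  induction L as [|b L IH]; [simpl; ring|]. rewrite !lsum_cons, IH. ring.
Qed.

Lemma lsum_scal {A : Type} (c : R) (f : A -> R) (L : list A) :
  lsum (fun b => c * f b) L = c * lsum f L.
Proof.
  induction L as [|b L IH]; [simpl; ring|]. rewrite !lsum_cons, IH. ring.
Qed.

Lemma lsum_minus {A : Type} (f g : A -> R) (L : list A) :
  lsum (fun b => f b - g b) L = lsum f L - lsum g L.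
Proof.
  induction L as [|b L IH]; [simpl; ring|]. rewrite !lsum_cons, IH. ring.
Qed.

Lemma lsum_le {A : Type} (f g : A -> R) (L : list A) :
  (forall b, In b L -> f b <= g b) -> lsum f L <= lsum g L.
Proof.
  induction L as [|b L IH]; intros H; [simpl; lra|]. rewrite !lsum_cons.
  apply Rplus_le_compat; [apply H|apply IH; intros; apply H]; simpl; auto.
Qed.

Lemma lsum_const {A : Type} (c : R) (L : list A) : lsum (fun _ => c) L = INR (length L) * c.
Proof.
  induction L as [|b L IH]; [simpl; ring|]. rewrite lsum_cons, IH.
  simpl length. rewrite S_INR. ring.
Qed.

Lemma lsum_nonneg {A : Type} (f : A -> R) (L : list A) :
  (forall b, In b L -> 0 <= f b) -> 0 <= lsum f L.
Proof.
  intros H. apply Rle_trans with (lsum (fun _ => 0) L).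
  - rewrite lsum_const. lra.
  - apply lsum_le; auto.
Qed.

Lemma lsum_app {A : Type} (f : A -> R) (L M : list A) : lsum f (L ++ M) = lsum f L + lsum f M.
Proof.
  induction L as [|b L IH]; [simpl; ring|]. simpl app. rewrite !lsum_cons, IH. ring.
Qed.

Lemma lsum_flat_map {A B : Type} (f : B -> R) (h : A -> list B) (L : list A) :
  lsum f (flat_map h L) = lsum (fun a => lsum f (h a)) L.
Proof.
  induction L as [|b L IH]; auto. simpl flat_map. rewrite lsum_app, lsum_cons, IH. auto.
Qed.

Lemma In_cons_neq {A : Type} (x b : A) (L : list A) : ~ In x (b :: L) -> x <> b /\ ~ In x L.
Proof. simpl. intros H. split; [intros ->|]; tauto. Qed.

Lemma ln_Cmod_rprod (L : list C) (z : C) : ~ In z L ->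
  ln (Cmod (rprod L z)) = lsum (fun b => ln (Cmod (z - b))) L.
Proof.
  induction L as [|b L IH]; intros H.
  - simpl. rewrite Cmod_1. apply ln_1.
  - apply In_cons_neq in H. destruct H as [H1 H2].
    rewrite rprod_cons, lsum_cons, Cmod_mult, ln_mult, IH; auto.
    + apply Cmod_pos, Cminus_neq_0, H1.
    + apply Cmod_pos, rprod_neq_0, H2.
Qed.

Lemma continuous_lsum {A : Type} (h : A -> R -> R) (L : list A) (t : R) :
  (forall b, In b L -> continuous (h b) t) -> continuous (fun s => lsum (fun b => h b s) L) t.
Proof.
  induction L as [|b L IH]; intros H.
  - exact (continuous_const (U := R_UniformSpace) (V := R_UniformSpace) 0 t).
  - apply (continuous_plus (h b) (fun s => lsum (fun b => h b s) L)).
    + apply H; simpl; auto.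
    + apply IH. intros; apply H; simpl; auto.
Qed.

Lemma Rmean_lsum {A : Type} (h : A -> R -> R) (L : list A) :
  (forall b t, In b L -> continuous (h b) t) ->
  Rmean (fun s => lsum (fun b => h b s) L) = lsum (fun b => Rmean (h b)) L.
Proof.
  induction L as [|b L IH]; intros H.
  - exact (Rmean_const 0).
  - rewrite lsum_cons, <- IH by (intros; apply H; simpl; auto).
    rewrite <- Rmean_plus; auto.
    + intros t. apply H; simpl; auto.
    + intros t. apply continuous_lsum. intros; apply H; simpl; auto.
Qed.

(* [F = g / rprod L] in the disc of radius [r], up to the values of [F] at its
   singular points; so [L] lists the poles there with multiplicity. Points of [L]
   outside the disc are allowed. *)
Definition rep (F : C -> C) (L : list C) (g : C -> C) (r : R) : Prop :=
  (forall z, Cmod z < r -> Cdiff g z) /\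
  (forall b, In b L -> Cmod b < r -> g b <> 0%C) /\
  (forall a, Cmod a < r -> exists d, 0 < d /\
     forall z, 0 < Cmod (z - a) < d -> (F z * rprod L z)%C = g z).

Lemma Cpow_eq (z : C) (k : nat) : Defs.Cpow z k = (z ^ k)%C.
Proof. induction k as [|k IH]; [reflexivity|]. simpl. rewrite <- IH. reflexivity. Qed.

Lemma not_In_near (L : list C) (a : C) : ~ In a L ->
  exists d, 0 < d /\ forall z, Cmod (z - a) < d -> ~ In z L.
Proof.
  induction L as [|b L IH]; simpl; intros H.
  - exists 1. split; [lra|auto].
  - destruct IH as [d [Hd F]]; [tauto|].
    assert (Hb : 0 < Cmod (b - a)) by (apply Cmod_pos, Cminus_neq_0; intros ->; tauto).
    exists (Rmin d (Cmod (b - a))). split; [apply Rmin_pos; auto|].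
    intros z Hz [E|Hin].
    + subst. pose proof (Rmin_r d (Cmod (z - a))). lra.
    + apply (F z); auto. eapply Rlt_le_trans; [exact Hz|apply Rmin_l].
Qed.

Lemma punctured_near (L : list C) (a : C) :
  exists d, 0 < d /\ forall z, 0 < Cmod (z - a) < d -> ~ In z L.
Proof.
  destruct (not_In_near (remove Cx_eq_dec a L) a) as [d [Hd F]].
  { apply remove_In. }
  exists d. split; auto. intros z Hz Hin. apply (F z); [lra|].
  apply in_in_remove; auto. intros ->.
  replace (a - a)%C with (RtoC 0) in Hz by ring. rewrite Cmod_0 in Hz. lra.
Qed.

Lemma Cmod_lt_near (a z : C) (r d : R) : d <= r - Cmod a -> Cmod (z - a) < d -> Cmod z < r.
Proof. intros H1 H2. pose proof (Cmod_sub_ge z a). lra. Qed.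

Lemma rep_is_pole (F : C -> C) (L : list C) (g : C -> C) (r : R) (a : C) :
  rep F L g r -> Cmod a < r -> In a L -> is_pole F a (count_occ Cx_eq_dec L a).
Proof.
  intros [HD [Hnz Hloc]] Ha Hin. split.
  { apply (count_occ_In Cx_eq_dec) in Hin. lia. }
  destruct (Hloc a Ha) as [d1 [Hd1 F1]].
  destruct (not_In_near (remove Cx_eq_dec a L) a) as [d2 [Hd2 F2]]; [apply remove_In|].
  set (d := Rmin (Rmin d1 d2) (r - Cmod a)).
  assert (Hd : 0 < d) by (repeat apply Rmin_pos; lra).
  assert (Ld : d <= d1 /\ d <= d2 /\ d <= r - Cmod a).
  { unfold d. pose proof (Rmin_l (Rmin d1 d2) (r - Cmod a)). pose proof (Rmin_r (Rmin d1 d2) (r - Cmod a)).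
    pose proof (Rmin_l d1 d2). pose proof (Rmin_r d1 d2). lra. }
  exists d. split; auto.
  exists (fun z => g z / rprod (remove Cx_eq_dec a L) z)%C. split; [|split].
  - intros z Hz. change (Cmod (z - a)%C < d) in Hz.
    apply (Cdiff_div g (rprod (remove Cx_eq_dec a L))).
    + apply HD. apply (Cmod_lt_near a z r d); lra.
    + apply Cdiff_rprod.
    + apply rprod_neq_0, F2. lra.
  - intros E. change ((g a / rprod (remove Cx_eq_dec a L) a)%C = 0%C) in E.
    revert E. apply Cmult_neq_0; auto.
    assert (Hr : rprod (remove Cx_eq_dec a L) a <> 0%C) by (apply rprod_neq_0, remove_In).
    intros E. apply (f_equal Cmod) in E. rewrite Cmod_inv, Cmod_0 in E by auto.
    pose proof (Rinv_0_lt_compat _ (Cmod_pos _ Hr)). lra.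
  - intros z Hz. change (0 < Cmod (z - a)%C < d) in Hz. rewrite Cpow_eq.
    change (F z = (g z / rprod (remove Cx_eq_dec a L) z) / (z - a) ^ count_occ Cx_eq_dec L a)%C.
    rewrite <- F1 by lra. rewrite (rprod_split L a z). field. split.
    + apply rprod_neq_0, F2. lra.
    + apply Cpow_nz, Cmod_pos_neq. lra.
Qed.

Lemma is_pole_local (F : C -> C) (a : C) (k : nat) : is_pole F a k ->
  (1 <= k)%nat /\ exists d g, 0 < d /\ ccont g a /\ g a <> 0%C /\
    forall z, 0 < Cmod (z - a) < d -> (F z * (z - a) ^ k)%C = g z.
Proof.
  intros [Hk [d [Hd [g [Hg [Hga HF]]]]]]. split; auto. exists d, g.
  split; [auto|]. split; [|split; [auto|]].
  - apply Cdiff_ccont, Hg. change (Cmod (a - a)%C < d).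
    replace (a - a)%C with (RtoC 0) by ring. rewrite Cmod_0. auto.
  - intros z Hz. rewrite (HF z Hz), Cpow_eq.
    change ((g z / (z - a) ^ k * (z - a) ^ k)%C = g z).
    field. apply Cpow_nz, Cmod_pos_neq. lra.
Qed.

Lemma ccont_pow (a : C) (k : nat) (z : C) : ccont (fun w => (w - a) ^ k)%C z.
Proof.
  apply Cdiff_ccont, Cdiff_pow, Cdiff_minus; [apply Cdiff_id|apply Cdiff_const].
Qed.

Lemma Cpow_0_pos (k : nat) : (1 <= k)%nat -> (0 ^ k)%C = 0%C.
Proof. destruct k; [lia|]. intros _. simpl. ring. Qed.

(** With the larger exponent the numerator would be a continuous function times a positive power of
    z - a, hence zero at [a]. *)
Lemma pole_order_lt_absurd (F : C -> C) (a : C) (k k' : nat) :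
  is_pole F a k -> is_pole F a k' -> ~ (k < k')%nat.
Proof.
  intros H H' Hlt.
  destruct (is_pole_local _ _ _ H) as [_ [d [g [Hd [Hg [_ HF]]]]]].
  destruct (is_pole_local _ _ _ H') as [_ [d' [g' [Hd' [Hg' [Hg0' HF']]]]]].
  apply Hg0'. transitivity (g a * (a - a) ^ (k' - k))%C.
  - apply (ccont_limit_unique g' (fun z => g z * (z - a) ^ (k' - k))%C a (Rmin d d')); auto.
    + apply Rmin_pos; auto.
    + apply ccont_mult; auto. apply ccont_pow.
    + intros z Hz. pose proof (Rmin_l d d'). pose proof (Rmin_r d d').
      rewrite <- HF, <- HF' by lra. replace k' with (k + (k' - k))%nat at 1 by lia.
      rewrite Cpow_add_r. ring.
  - replace (a - a)%C with (RtoC 0) by ring. rewrite Cpow_0_pos by lia. ring.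
Qed.

Lemma pole_order_unique (F : C -> C) (a : C) (k k' : nat) :
  is_pole F a k -> is_pole F a k' -> k = k'.
Proof.
  intros H H'. pose proof (pole_order_lt_absurd F a k k' H H').
  pose proof (pole_order_lt_absurd F a k' k H' H). lia.
Qed.

Lemma pole_not_holomorphic (F h : C -> C) (a : C) (k : nat) (d : R) : is_pole F a k ->
  0 < d -> ccont h a -> (forall z, 0 < Cmod (z - a) < d -> F z = h z) -> False.
Proof.
  intros H Hd Hh HF. destruct (is_pole_local _ _ _ H) as [Hk [d' [g [Hd' [Hg [Hg0 HF']]]]]].
  apply Hg0. transitivity (h a * (a - a) ^ k)%C.
  - apply (ccont_limit_unique g (fun z => h z * (z - a) ^ k)%C a (Rmin d d')); auto.
    + apply Rmin_pos; auto.
    + apply ccont_mult; auto. apply ccont_pow.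
    + intros z Hz. pose proof (Rmin_l d d'). pose proof (Rmin_r d d').
      rewrite <- HF, <- HF' by lra. auto.
  - replace (a - a)%C with (RtoC 0) by ring. rewrite Cpow_0_pos by lia. ring.
Qed.

Lemma rep_pole_In (F : C -> C) (L : list C) (g : C -> C) (r : R) (a : C) (k : nat) :
  rep F L g r -> Cmod a < r -> is_pole F a k -> In a L.
Proof.
  intros [HD [_ Hloc]] Ha Hp. apply NNPP. intros Hin.
  destruct (Hloc a Ha) as [d1 [Hd1 F1]].
  destruct (not_In_near L a Hin) as [d2 [Hd2 F2]].
  apply (pole_not_holomorphic F (fun z => g z / rprod L z)%C a k (Rmin d1 d2)); auto.
  - apply Rmin_pos; auto.
  - apply ccont_div; [apply Cdiff_ccont; auto|apply Cdiff_ccont, Cdiff_rprod|].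
    apply rprod_neq_0; auto.
  - intros z Hz. pose proof (Rmin_l d1 d2). pose proof (Rmin_r d1 d2).
    rewrite <- F1 by lra. field. apply rprod_neq_0, F2. lra.
Qed.

Lemma fold_plus_map_indicator (x : C) (h : C -> nat) (l : list C) : NoDup l ->
  fold_right Nat.add O (map (fun a => (if Cx_eq_dec x a then 1 else 0) + h a)%nat l)
  = ((if in_dec Cx_eq_dec x l then 1 else 0) + fold_right Nat.add O (map h l))%nat.
Proof.
  induction l as [|a l IH]; intros Hl; auto. inversion Hl; subst.
  cbn [map fold_right]. rewrite IH by auto.
  destruct (in_dec Cx_eq_dec x l) as [H|H], (in_dec Cx_eq_dec x (a :: l)) as [H'|H'],
    (Cx_eq_dec x a) as [E|E]; subst; simpl in *; try tauto; try lia.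
  exfalso. destruct H'; congruence.
Qed.

Lemma fold_plus_map_count (l L : list C) : NoDup l -> (forall x, In x L -> In x l) ->
  fold_right Nat.add O (map (count_occ Cx_eq_dec L) l) = length L.
Proof.
  intros Hl. induction L as [|x L IH]; intros Hin.
  - simpl. clear. induction l; simpl; auto.
  - simpl length. rewrite <- IH by (intros; apply Hin; simpl; auto).
    rewrite (map_ext _ (fun a => (if Cx_eq_dec x a then 1 else 0) + count_occ Cx_eq_dec L a)%nat).
    + rewrite fold_plus_map_indicator by auto.
      destruct (in_dec Cx_eq_dec x l) as [H|H]; auto. exfalso. apply H, Hin. simpl; auto.
    + intros a. simpl. destruct (Cx_eq_dec x a); auto.
Qed.

Lemma fold_plus_perm (l l' : list nat) : Permutation l l' ->
  fold_right Nat.add O l = fold_right Nat.add O l'.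
Proof. induction 1; simpl; lia. Qed.

(** [npoles] is picked by [epsilon]; it can be computed only because orders are unique and the list
    of poles is unique up to permutation. *)
Lemma pole_count_unique (F : C -> C) (t : R) (N N' : nat) :
  pole_count F t N -> pole_count F t N' -> N = N'.
Proof.
  intros [l [ks [Hl [Hin [HF ->]]]]] [l' [ks' [Hl' [Hin' [HF' ->]]]]].
  set (ord := fun a => epsilon (inhabits O) (is_pole F a)).
  assert (Ho : forall m js, Forall2 (is_pole F) m js -> js = map ord m).
  { intros m js H. induction H; simpl; auto. f_equal; auto.
    apply (pole_order_unique F x); auto. apply epsilon_spec. eauto. }
  rewrite (Ho _ _ HF), (Ho _ _ HF'). apply fold_plus_perm, Permutation_map.
  apply NoDup_Permutation; auto. intros x. rewrite Hin, Hin'. tauto.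
Qed.

Definition in_ball (t : R) (b : C) : bool := if Rle_dec (Cmod b) t then true else false.

Lemma in_ball_iff (t : R) (b : C) : in_ball t b = true <-> Cmod b <= t.
Proof. unfold in_ball. destruct (Rle_dec (Cmod b) t); split; auto; try discriminate; tauto. Qed.

(** Inside the disc the multiplicity of a point in [L] is its order as a pole, so the orders of the
    distinct poles add up to a length. *)
Lemma rep_pole_count (F : C -> C) (L : list C) (g : C -> C) (r t : R) :
  rep F L g r -> t < r -> pole_count F t (length (filter (in_ball t) L)).
Proof.
  intros HR Ht.
  set (M := filter (in_ball t) L).
  exists (nodup Cx_eq_dec M), (map (count_occ Cx_eq_dec M) (nodup Cx_eq_dec M)).
  assert (Hc : forall a, In a M -> count_occ Cx_eq_dec M a = count_occ Cx_eq_dec L a).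
  { intros a Ha. apply filter_In in Ha. destruct Ha as [_ Ha]. unfold M. clear - Ha.
    induction L as [|b L IH]; simpl; auto.
    destruct (Cx_eq_dec b a) as [->|Hne].
    - rewrite Ha. simpl. destruct (Cx_eq_dec a a); [|congruence]. auto.
    - destruct (in_ball t b); simpl; auto. destruct (Cx_eq_dec b a); [congruence|auto]. }
  split; [apply NoDup_nodup|]. split; [|split].
  - intros a. rewrite nodup_In. unfold M. rewrite filter_In, in_ball_iff.
    change (In a L /\ Cmod a <= t <-> Cmod a <= t /\ exists k, is_pole F a k). split.
    + intros [H1 H2]. split; auto. eexists. apply (rep_is_pole F L g r); auto. lra.
    + intros [H1 [k Hk]]. split; auto. apply (rep_pole_In F L g r a k); auto. lra.
  - assert (HH : forall a, In a (nodup Cx_eq_dec M) -> is_pole F a (count_occ Cx_eq_dec M a)).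
    { intros a Ha. apply nodup_In in Ha. rewrite Hc by auto. apply filter_In in Ha.
      rewrite in_ball_iff in Ha. apply (rep_is_pole F L g r); try tauto. lra. }
    clear - HH. induction (nodup Cx_eq_dec M) as [|a l IH]; simpl; constructor.
    + apply HH; simpl; auto.
    + apply IH. intros; apply HH; simpl; auto.
  - symmetry. apply fold_plus_map_count; [apply NoDup_nodup|]. intros x Hx. apply nodup_In; auto.
Qed.

Lemma rep_npoles (F : C -> C) (L : list C) (g : C -> C) (r t : R) :
  rep F L g r -> t < r -> npoles F t = length (filter (in_ball t) L).
Proof.
  intros HR Ht. pose proof (rep_pole_count F L g r t HR Ht) as H.
  apply (pole_count_unique F t); auto. unfold npoles. apply epsilon_spec. eauto.
Qed.

(** * Evaluation of the proximity function and of the counting function *)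

Lemma Rint_RInt (f : R -> R) (a b : R) : ex_RInt f a b -> Rint f a b = RInt f a b.
Proof.
  intros H. unfold Rint. destruct (excluded_middle_informative _) as [Hi|Hn].
  - symmetry. apply RInt_Reals.
  - exfalso. apply Hn. constructor. apply ex_RInt_Reals_0. auto.
Qed.

Lemma Rsup_eq (S : R -> Prop) (v : R) : is_lub S v -> Rsup S = v.
Proof.
  intros H. assert (H' : is_lub S (Rsup S)).
  { unfold Rsup. apply epsilon_spec. eauto. }
  destruct H as [H1 H2], H' as [H3 H4]. apply Rle_antisym; auto.
Qed.

Lemma ln_le_mono (x y : R) : 0 < x -> x <= y -> ln x <= ln y.
Proof. intros Hx [H| <- ]; [left; apply ln_increasing; auto|lra]. Qed.

Lemma ln_ge_0 (x : R) : 1 <= x -> 0 <= ln x.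
Proof. intros Hx. rewrite <- ln_1. apply ln_le_mono; lra. Qed.

(** In this form continuity is visible also at 0. It agrees with the definition there because [ln]
    is 0 at nonpositive arguments. *)
Lemma logplus_eq (x : R) : logplus x = ln (Rmax 1 x).
Proof.
  unfold logplus. destruct (Rle_dec 1 x) as [H|H].
  - rewrite (Rmax_right 1 x) by auto. apply Rmax_right.
    rewrite <- ln_1. destruct H as [H| <- ]; [left; apply ln_increasing; lra|lra].
  - rewrite (Rmax_left 1 x), ln_1 by lra. apply Rmax_left.
    destruct (Rlt_dec 0 x) as [Hx|Hx].
    + rewrite <- ln_1. left. apply ln_increasing; lra.
    + unfold ln. destruct (Rlt_dec 0 x); [contradiction|lra].
Qed.

Lemma logplus_nonneg (x : R) : 0 <= logplus x.
Proof. apply Rmax_l. Qed.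

Lemma logplus_le_iff (x h : R) : 0 <= h -> (logplus x <= h <-> x <= exp h).
Proof.
  intros Hh. rewrite logplus_eq. pose proof (Rmax_l 1 x). pose proof (Rmax_r 1 x).
  assert (H1 : 1 <= exp h).
  { rewrite <- exp_0. destruct Hh as [Hh| <- ]; [left; apply exp_increasing; auto|lra]. }
  split; intros Hle.
  - eapply Rle_trans; [apply (Rmax_r 1)|]. rewrite <- (exp_ln (Rmax 1 x)) by lra.
    destruct Hle as [Hle| -> ]; [left; apply exp_increasing; auto|lra].
  - rewrite <- (ln_exp h). assert (Hm : Rmax 1 x <= exp h) by (apply Rmax_lub; auto).
    destruct Hm as [Hm| <- ]; [left; apply ln_increasing; lra|lra].
Qed.

Lemma le_exp_logplus (x : R) : x <= exp (logplus x).
Proof. apply logplus_le_iff; [apply logplus_nonneg|lra]. Qed.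

Lemma continuous_Rmax_l (c x : R) : continuous (Rmax c) x.
Proof.
  apply (continuous_ext (fun y => / 2 * (c + y + Rabs (y - c)))).
  - intros y. unfold Rmax, Rabs. destruct (Rle_dec c y), (Rcase_abs (y - c)); lra.
  - apply (continuous_Rmult (fun _ => / 2)); [apply continuous_const|].
    apply (continuous_plus (fun y => c + y) (fun y => Rabs (y - c))).
    + apply (continuous_plus (fun _ => c) (fun y => y)); [apply continuous_const|apply continuous_id].
    + apply (continuous_comp (fun y => y - c) Rabs); [|apply continuous_Rabs].
      apply (continuous_minus (fun y => y) (fun _ => c)); [apply continuous_id|apply continuous_const].
Qed.

Lemma continuous_Rmin_r (c x : R) : continuous (fun y => Rmin y c) x.
Proof.
  apply (continuous_ext (fun y => - Rmax (- c) (- y))).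
  - intros y. rewrite Rmax_opp_Rmin, Rmin_comm. as_R. ring.
  - apply (continuous_opp (fun y => Rmax (- c) (- y))).
    apply (continuous_comp (fun y => - y) (Rmax (- c))); [|apply continuous_Rmax_l].
    apply (continuous_opp (V := R_NormedModule) (fun y : R => y) x), continuous_id.
Qed.

Lemma continuous_logplus (x : R) : continuous logplus x.
Proof.
  apply (continuous_ext (fun y => ln (Rmax 1 y))).
  - intros y. symmetry. apply logplus_eq.
  - apply (continuous_comp (Rmax 1) ln); [apply continuous_Rmax_l|].
    apply continuous_ln'. pose proof (Rmax_l 1 x). lra.
Qed.

Definition log_circle (F : C -> C) (r th : R) : R := logplus (Cmod (F (circ r th))).

Lemma continuous_log_circle (F : C -> C) (r : R) : 0 <= r ->
  (forall z, Cmod z = r -> ccont F z) -> forall th, continuous (log_circle F r) th.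
Proof.
  intros Hr HF th. apply (continuous_comp (fun th => Cmod (F (circ r th))) logplus).
  - apply (rcont_Cmod (fun th => F (circ r th))), rcont_on_circle; auto.
  - apply continuous_logplus.
Qed.

(** On a circle where [F] is continuous log+ |F| is bounded, so the truncations are eventually the
    function itself and the supremum is attained. *)
Lemma prox_eq (F : C -> C) (r : R) : 0 <= r -> (forall z, Cmod z = r -> ccont F z) ->
  prox F r = Rmean (log_circle F r).
Proof.
  intros Hr HF. pose proof (continuous_log_circle F r Hr HF) as HU.
  set (U := log_circle F r) in *.
  assert (HUM : forall M th, continuous (fun th => Rmin (U th) M) th).
  { intros M th. apply (continuous_comp U (fun y => Rmin y M)); auto. apply continuous_Rmin_r. }
  assert (HE : forall M : nat, / (2 * PI) * Rint (fun th => Rmin (logplus (Cabs (F (r * cos th, r * sin th)))) (INR M)) 0 (2 * PI)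
     = Rmean (fun th => Rmin (U th) (INR M))).
  { intros M. unfold Rmean. f_equal. apply (Rint_RInt (fun th => Rmin (U th) (INR M))).
    apply continuous_ex_RInt. auto. }
  unfold prox. apply Rsup_eq. split.
  - intros x [M ->]. rewrite HE. apply Rmean_le; auto. intros; apply Rmin_l.
  - intros b Hb. destruct (continuous_bounded_circle U HU) as [M [_ HM]].
    destruct (INR_unbounded M) as [N HN].
    apply Rle_trans with (Rmean (fun th => Rmin (U th) (INR N))).
    + apply Rmean_le_on; auto. intros t Ht. specialize (HM t Ht). rewrite Rmin_left; lra.
    + apply Hb. exists N. rewrite HE. auto.
Qed.

(* With the value [0] at the origin, [count_term r 0] is the term [n(0, F) ln r]
   of [Ncount]. *)
Definition lnstar (b : C) : R := if Cx_eq_dec b 0 then 0 else ln (Cmod b).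

Lemma lnstar_neq (b : C) : b <> 0%C -> lnstar b = ln (Cmod b).
Proof. intros H. unfold lnstar. destruct (Cx_eq_dec b 0); tauto. Qed.

Lemma lnstar_0 : lnstar 0%C = 0.
Proof. unfold lnstar. destruct (Cx_eq_dec 0 0); tauto. Qed.

(** The contribution of a simple pole [b] to N(r, F): log (r / |b|) if 0 < |b| <= r, zero if |b| >=
    r, and log r at the origin. *)
Definition count_term (r : R) (b : C) : R := ln (Rmax r (Cmod b)) - lnstar b.

Lemma is_RInt_zero (a b : R) : is_RInt (fun _ : R => 0) a b 0.
Proof.
  assert (H := is_RInt_const (V := R_NormedModule) a b 0).
  change (is_RInt (fun _ : R => 0) a b ((b - a) * 0)) in H. rewrite Rmult_0_r in H. exact H.
Qed.

(** The integrand vanishes for t < c, so the factor 1 / t causes no singularity at the lower end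
    0. *)
Lemma is_RInt_inv_step (c r : R) : 0 < c -> 0 < r ->
  is_RInt (fun t => (if Rle_dec c t then 1 else 0) / t) 0 r (ln (Rmax r c) - ln c).
Proof.
  intros Hc Hr.
  assert (HZ : forall u, 0 <= u <= c ->
    is_RInt (fun t => (if Rle_dec c t then 1 else 0) / t) 0 u 0).
  { intros u Hu. apply (is_RInt_ext (fun _ => 0)).
    - rewrite Rmin_left, Rmax_right by lra. intros t Ht.
      destruct (Rle_dec c t); [lra|]. unfold Rdiv. as_R. ring.
    - apply is_RInt_zero. }
  destruct (Rle_dec r c) as [H|H].
  - rewrite Rmax_right, Rminus_diag by auto. apply HZ. lra.
  - rewrite Rmax_left by lra.
    replace (ln r - ln c) with (plus 0 (ln r - ln c)) by (unfold plus; simpl; ring).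
    apply (is_RInt_Chasles (V := R_NormedModule) _ 0 c r); [apply HZ; lra|].
    apply (is_RInt_ext (fun t => / t)).
    + rewrite Rmin_left, Rmax_right by lra. intros t Ht.
      destruct (Rle_dec c t); [|lra]. unfold Rdiv. as_R. ring.
    + apply (is_RInt_derive (V := R_CompleteNormedModule) ln Rinv).
      * rewrite Rmin_left, Rmax_right by lra. intros t Ht.
        auto_derive; [lra|field; lra].
      * rewrite Rmin_left, Rmax_right by lra. intros t Ht.
        apply continuity_pt_filterlim, continuity_pt_inv; [apply continuity_pt_id|lra].
Qed.

Lemma INR_length_filter (t : R) (L : list C) :
  INR (length (filter (in_ball t) L)) = lsum (fun b => if Rle_dec (Cmod b) t then 1 else 0) L.
Proof.
  induction L as [|b L IH]; auto. rewrite lsum_cons, <- IH. simpl filter.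
  unfold in_ball at 1. destruct (Rle_dec (Cmod b) t).
  - simpl length. rewrite S_INR. ring.
  - ring.
Qed.

Lemma Ncount_eq (F : C -> C) (L : list C) (g : C -> C) (R' r : R) :
  rep F L g R' -> 0 < r < R' -> Ncount F r = lsum (count_term r) L.
Proof.
  intros HR Hr. unfold Ncount.
  assert (HI : is_RInt (fun t => (INR (npoles F t) - INR (npoles F 0)) / t) 0 r
    (lsum (fun b => if Cx_eq_dec b 0 then 0 else ln (Rmax r (Cmod b)) - ln (Cmod b)) L)).
  { apply (is_RInt_ext (fun t => lsum (fun b => if Cx_eq_dec b 0 then 0
      else (if Rle_dec (Cmod b) t then 1 else 0) / t) L)).
    - rewrite Rmin_left, Rmax_right by lra. intros t Ht.
      rewrite !(rep_npoles F L g R') by (auto; lra). rewrite !INR_length_filter.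
      unfold Rdiv. rewrite <- lsum_minus, Rmult_comm, <- lsum_scal. apply lsum_ext.
      intros b _. destruct (Cx_eq_dec b 0) as [->|Hb].
      + rewrite Cmod_0. destruct (Rle_dec 0 t), (Rle_dec 0 0); try lra; ring.
      + pose proof (Cmod_pos b Hb). destruct (Rle_dec (Cmod b) 0); [lra|]. ring.
    - clear HR. induction L as [|b L IH].
      + apply is_RInt_zero.
      + rewrite lsum_cons. apply (is_RInt_plus (V := R_NormedModule)
          (fun t => if Cx_eq_dec b 0 then 0 else (if Rle_dec (Cmod b) t then 1 else 0) / t)); auto.
        destruct (Cx_eq_dec b 0) as [->|Hb].
        * apply is_RInt_zero.
        * apply is_RInt_inv_step; [apply Cmod_pos; auto|lra]. }
  rewrite Rint_RInt by (eexists; apply HI). rewrite (is_RInt_unique _ _ _ _ HI).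
  rewrite (rep_npoles F L g R') by (auto; lra). rewrite INR_length_filter.
  rewrite Rmult_comm, <- lsum_scal, <- lsum_plus. apply lsum_ext. intros b _.
  unfold count_term. destruct (Cx_eq_dec b 0) as [->|Hb].
  - rewrite Cmod_0, lnstar_0. destruct (Rle_dec 0 0); [|lra]. rewrite Rmax_left by lra. ring.
  - rewrite lnstar_neq by auto. pose proof (Cmod_pos b Hb). destruct (Rle_dec (Cmod b) 0); [lra|]. ring.
Qed.

Lemma T_eq (F : C -> C) (L : list C) (g : C -> C) (R' r : R) :
  rep F L g R' -> 0 < r < R' -> (forall z, Cmod z = r -> ccont F z) ->
  T F r = Rmean (log_circle F r) + lsum (count_term r) L.
Proof.
  intros HR Hr HF. unfold T. rewrite prox_eq, (Ncount_eq F L g R') by (auto; lra). auto.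
Qed.

Lemma count_term_nonneg (r : R) (b : C) : 1 <= r -> 0 <= count_term r b.
Proof.
  intros Hr. unfold count_term, lnstar. pose proof (Rmax_l r (Cmod b)).
  pose proof (Rmax_r r (Cmod b)). destruct (Cx_eq_dec b 0) as [->|Hb].
  - rewrite Rminus_0_r. apply ln_ge_0. lra.
  - pose proof (ln_le_mono _ _ (Cmod_pos b Hb) H0). lra.
Qed.

(** * Poles of a meromorphic function *)

Lemma divide_out (g : C -> C) (a : C) (r : R) : 0 < r ->
  (forall z, Cmod (z - a) < r -> Cdiff g z) -> g a = 0%C ->
  exists g1, (forall z, Cmod (z - a) < r / 2 -> Cdiff g1 z) /\
    forall z, Cmod (z - a) < r / 2 -> g z = ((z - a) * g1 z)%C.
Proof.
  intros Hr HD Ha.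
  destruct (divide_out_0 (fun z => g (z + a)%C) (r / 2)) as [h [Hh1 Hh2]]; [lra| |].
  - intros z Hz. apply (Cdiff_comp g (fun z => z + a)%C).
    + apply Cdiff_plus; [apply Cdiff_id|apply Cdiff_const].
    + apply HD. replace (z + a - a)%C with z by ring. lra.
  - exists (fun z => h (z - a)%C). split.
    + intros z Hz. apply (Cdiff_comp h (fun z => z - a)%C); auto.
      apply Cdiff_minus; [apply Cdiff_id|apply Cdiff_const].
    + intros z Hz. specialize (Hh2 _ Hz).
      replace (z - a + a)%C with z in Hh2 by ring. replace (0 + a)%C with a in Hh2 by ring.
      rewrite Hh2, Ha. ring.
Qed.

(** The value of [F] at [a] is ignored, as [meromorphic] leaves it open; [v] is the value of the
    holomorphic extension. *)
Definition removable (F : C -> C) (a : C) (v : C) : Prop :=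
  exists d h, 0 < d /\ (forall z, Cmod (z - a) < d -> Cdiff h z) /\ h a = v /\
    forall z, 0 < Cmod (z - a) < d -> F z = h z.

Lemma Cmod_self (a : C) : Cmod (a - a) = 0.
Proof. replace (a - a)%C with (RtoC 0) by ring. apply Cmod_0. Qed.

(** Induction on the exponent: as long as the numerator vanishes at [a], a factor z - a cancels. *)
Lemma meromorphic_at (f : C -> C) (a : C) : meromorphic f ->
  (exists k, is_pole f a k) \/ (exists v, removable f a v).
Proof.
  intros Hf. destruct (Hf a) as [r [Hr [k [g [Hg HF]]]]].
  revert r Hr g Hg HF. induction k as [|k IH]; intros r Hr g Hg HF.
  - right. exists (g a), r, g. split; [auto|]. split; [exact Hg|]. split; [auto|].
    intros z Hz. rewrite (HF z Hz).
    change ((g z / 1)%C = g z). field.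
  - destruct (Cx_eq_dec (g a) 0) as [Ha|Ha].
    + destruct (divide_out g a r Hr Hg Ha) as [g1 [Hg1 E1]].
      apply (IH (r / 2) ltac:(lra) g1 Hg1).
      intros z Hz. change (0 < Cmod (z - a)%C < r / 2) in Hz.
      assert (Hz' : 0 < Cmod (z - a)%C < r) by lra.
      rewrite (HF z Hz'), (Cpow_eq _ (S k)), (Cpow_eq _ k).
      change ((g z / (z - a) ^ S k)%C = (g1 z / (z - a) ^ k)%C).
      rewrite E1 by lra. rewrite Cpow_S. field.
      assert ((z - a)%C <> 0%C) by (apply Cmod_pos_neq; lra).
      split; [apply Cpow_nz|]; auto.
    + left. exists (S k). split; [lia|]. exists r. split; auto. exists g. auto.
Qed.

Lemma removable_unique (F : C -> C) (a v w : C) : removable F a v -> removable F a w -> v = w.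
Proof.
  intros [d [h [Hd [Hh [<- HF]]]]] [d' [h' [Hd' [Hh' [<- HF']]]]].
  apply (ccont_limit_unique h h' a (Rmin d d')).
  - apply Rmin_pos; auto.
  - apply Cdiff_ccont, Hh. rewrite Cmod_self. auto.
  - apply Cdiff_ccont, Hh'. rewrite Cmod_self. auto.
  - intros z Hz. pose proof (Rmin_l d d'). pose proof (Rmin_r d d').
    rewrite <- HF, <- HF'; auto; lra.
Qed.

Lemma removable_near (F h : C -> C) (a z : C) (d : R) :
  (forall z, Cmod (z - a) < d -> Cdiff h z) ->
  (forall z, 0 < Cmod (z - a) < d -> F z = h z) ->
  0 < Cmod (z - a) < d -> removable F z (h z).
Proof.
  intros Hh HF Hz. set (e := Rmin (Cmod (z - a)) (d - Cmod (z - a))).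
  assert (He : 0 < e) by (apply Rmin_pos; lra).
  assert (E1 : e <= Cmod (z - a)) by apply Rmin_l.
  assert (E2 : e <= d - Cmod (z - a)) by apply Rmin_r.
  assert (Hw : forall w, Cmod (w - z) < e -> 0 < Cmod (w - a) < d).
  { intros w Hw. pose proof (Cmod_triangle3 w z a). pose proof (Cmod_triangle3 z w a).
    rewrite (Cmod_minus_sym z w) in *. lra. }
  exists e, h. split; [auto|]. split; [|split; [auto|]].
  - intros w Hwz. apply Hh, Hw, Hwz.
  - intros w Hwz. apply HF, Hw, Hwz.
Qed.

(** The extension is chosen pointwise, without regard to neighbours; uniqueness of removable values
    forces it to agree with each local extension on a whole disc. *)
Lemma glue_holomorphic (F : C -> C) (r : R) :
  (forall a, Cmod a < r -> exists v, removable F a v) ->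
  exists g, (forall z, Cmod z < r -> Cdiff g z) /\
    (forall a v, Cmod a < r -> removable F a v -> g a = v) /\
    (forall a, Cmod a < r -> exists d, 0 < d /\
       forall z, 0 < Cmod (z - a) < d -> F z = g z).
Proof.
  intros H. set (g := fun a => epsilon (inhabits (RtoC 0)) (removable F a)).
  assert (Hg : forall a v, removable F a v -> g a = v).
  { intros a v Hv. apply (removable_unique F a); auto. apply epsilon_spec. eauto. }
  exists g. split; [|split].
  - intros a Ha. destruct (H a Ha) as [v [d [h [Hd [Hh [Hv HF]]]]]].
    apply (Cdiff_ext_loc h g a d); auto.
    + intros z Hz. symmetry. apply Hg. destruct (Cx_eq_dec z a) as [->|Hne].
      * exists d, h. auto.
      * apply (removable_near F h a z d); auto. split; auto.
        apply Cmod_pos, Cminus_neq_0; auto.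
    + apply Hh. rewrite Cmod_self. auto.
  - auto.
  - intros a Ha. destruct (H a Ha) as [v [d [h [Hd [Hh [Hv HF]]]]]].
    exists d. split; auto. intros z Hz. rewrite HF by auto. symmetry. apply Hg.
    apply (removable_near F h a z d); auto.
Qed.

Lemma meromorphic_isolated (f : C -> C) (a : C) : meromorphic f ->
  exists d, 0 < d /\ forall z, 0 < Cmod (z - a) < d -> Cdiff f z.
Proof.
  intros Hf. destruct (Hf a) as [r [Hr [k [g [Hg HF]]]]].
  exists r. split; auto. intros z Hz.
  apply (Cdiff_ext_loc (fun z => g z / (z - a) ^ k)%C f z (Rmin (Cmod (z - a)) (r - Cmod (z - a)))).
  - apply Rmin_pos; lra.
  - intros w Hw. pose proof (Rmin_l (Cmod (z - a)) (r - Cmod (z - a))).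
    pose proof (Rmin_r (Cmod (z - a)) (r - Cmod (z - a))).
    pose proof (Cmod_triangle3 w z a). pose proof (Cmod_triangle3 z w a).
    rewrite (Cmod_minus_sym z w) in *.
    assert (Hwa : 0 < Cmod (w - a) < r) by lra. specialize (HF w Hwa).
    rewrite Cpow_eq in HF. symmetry. exact HF.
  - assert (Hn : (z - a)%C <> 0%C) by (apply Cmod_pos_neq; lra).
    apply (Cdiff_div g (fun z => (z - a) ^ k)%C).
    + apply Hg. apply Hz.
    + apply Cdiff_pow, Cdiff_minus; [apply Cdiff_id|apply Cdiff_const].
    + apply Cpow_nz; auto.
Qed.

(** Singular points are isolated, so compactness of a square around the disc gives finiteness.
    Points where [f] merely has a wrong value count as singular too. *)
Lemma singular_finite (f : C -> C) (r : R) : meromorphic f -> 0 <= r ->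
  exists l : list C, forall z, Cmod z <= r -> ~ Cdiff f z -> In z l.
Proof.
  intros Hf Hr.
  assert (H : exists l : list C, forall z : C, - r <= fst z <= - r + 2 * r / 2 ^ 0 ->
    - r <= snd z <= - r + 2 * r / 2 ^ 0 -> ~ Cdiff f z -> In z l).
  { apply (bisection (- r) (- r) (2 * r) (2 * r) (fun k x y => exists l : list C, forall z : C,
      x <= fst z <= x + 2 * r / 2 ^ k -> y <= snd z <= y + 2 * r / 2 ^ k -> ~ Cdiff f z -> In z l));
      try lra.
    - intros k x y _ [l1 F1] [l2 F2] [l3 F3] [l4 F4].
      assert (Ek : 2 * r / 2 ^ k = 2 * r / 2 ^ S k + 2 * r / 2 ^ S k).
      { simpl. field. apply pow_nonzero; lra. }
      set (q := 2 * r / 2 ^ S k) in *. rewrite Ek.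
      exists (l1 ++ l2 ++ l3 ++ l4). intros z Hx Hy Hs. rewrite !in_app_iff.
      destruct (Rle_dec (fst z) (x + q)), (Rle_dec (snd z) (y + q)).
      + left. apply F1; auto; lra.
      + right; right; left. apply F3; auto; lra.
      + right; left. apply F2; auto; lra.
      + right; right; right. apply F4; auto; lra.
    - intros px py _ _. destruct (meromorphic_isolated f (px, py) Hf) as [d [Hd F]].
      exists (d / 2). split; [lra|]. intros k x y _ Hx Hy Hk _.
      exists ((px, py) :: nil). intros z Hzx Hzy Hs.
      destruct (Cx_eq_dec z (px, py)) as [->|Hne]; [simpl; auto|]. exfalso.
      apply Hs, F. split; [apply Cmod_pos, Cminus_neq_0; auto|].
      destruct z as [u v]. simpl in Hzx, Hzy.
      unfold Cminus, Cplus, Copp. simpl. eapply Rle_lt_trans; [apply Cmod_pair_le|].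
      assert (Rabs (u + - px) < d / 2) by (apply Rabs_def1; lra).
      assert (Rabs (v + - py) < d / 2) by (apply Rabs_def1; lra). lra. }
  destruct H as [l F]. exists l. intros z Hz Hs. simpl in F.
  pose proof (Rmax_Cmod z) as Hm.
  pose proof (Rmax_l (Rabs (fst z)) (Rabs (snd z))). pose proof (Rmax_r (Rabs (fst z)) (Rabs (snd z))).
  assert (H1 : Rabs (fst z) <= r) by lra. assert (H2 : Rabs (snd z) <= r) by lra.
  apply Rabs_le_between in H1. apply Rabs_le_between in H2. apply F; auto; lra.
Qed.

(** Makes room for a representation on a disc slightly larger than |z| <= r that meets no further
    poles. *)
Lemma gap_above (l : list C) (r : R) : exists r', r < r' /\
  forall z, In z l -> Cmod z < r' -> Cmod z <= r.
Proof.
  induction l as [|b l [r' [Hr F]]].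
  - exists (r + 1). split; [lra|]. intros z [].
  - destruct (Rle_dec (Cmod b) r) as [Hb|Hb].
    + exists r'. split; auto. intros z [->|Hz]; auto.
    + exists (Rmin r' (Cmod b)). split; [apply Rmin_glb_lt; lra|].
      pose proof (Rmin_l r' (Cmod b)). pose proof (Rmin_r r' (Cmod b)).
      intros z [->|Hz] Hl; [lra|]. apply F; auto; lra.
Qed.

Lemma is_pole_singular (f : C -> C) (a : C) (k : nat) : is_pole f a k -> ~ Cdiff f a.
Proof.
  intros Hp HD. apply (pole_not_holomorphic f f a k 1); auto; [lra|apply Cdiff_ccont; auto].
Qed.

Lemma count_occ_flat_map_repeat (ord : C -> nat) (l : list C) (a : C) : NoDup l -> In a l ->
  count_occ Cx_eq_dec (flat_map (fun b => repeat b (ord b)) l) a = ord a.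
Proof.
  assert (H0 : forall l, ~ In a l ->
    count_occ Cx_eq_dec (flat_map (fun b => repeat b (ord b)) l) a = O).
  { intros m Hm. apply count_occ_not_In. rewrite in_flat_map. intros [b [Hb Ha]].
    apply repeat_spec in Ha. subst. auto. }
  induction l as [|b l IH]; intros Hl Ha; [destruct Ha|]. inversion Hl; subst.
  simpl. rewrite count_occ_app. destruct Ha as [->|Ha].
  - rewrite (count_occ_repeat_eq Cx_eq_dec _ eq_refl), H0 by auto. lia.
  - rewrite count_occ_repeat_neq, IH by (auto; intros ->; auto). auto.
Qed.

(** [L] repeats each pole as often as its order; then [f] times [rprod L] has only removable
    singularities and is glued to a holomorphic function. *)
Lemma rep_exists (f : C -> C) (r : R) : meromorphic f -> 0 < r ->
  (forall z, Cmod z = r -> Cdiff f z) ->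
  exists L g r', r < r' /\ rep f L g r' /\
    (forall b, In b L -> Cmod b < r /\ ~ Cdiff f b) /\
    (forall z, Cmod z <= r -> Cdiff f z -> g z = (f z * rprod L z)%C).
Proof.
  intros Hf Hr Hgood. destruct (singular_finite f (r + 1) Hf) as [l Hl]; [lra|].
  destruct (gap_above l r) as [r0 [Hr0 Hgap]].
  set (r' := Rmin r0 (r + 1)).
  assert (Hr' : r < r') by (apply Rmin_glb_lt; lra).
  assert (Lr1 : r' <= r0) by apply Rmin_l. assert (Lr2 : r' <= r + 1) by apply Rmin_r.
  (* The ring r <= |z| < r' is free of singular points: the gap excludes those beyond [r], and
     [Hgood] those on the circle. *)
  assert (Hsing : forall z, Cmod z < r' -> ~ Cdiff f z -> Cmod z < r).
  { intros z Hz Hs. assert (Cmod z <= r) by (apply Hgap; [apply Hl; auto; lra|lra]).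
    destruct (Req_dec (Cmod z) r) as [E|E]; [exfalso; auto|lra]. }
  set (ord := fun a => epsilon (inhabits O) (is_pole f a)).
  assert (Hord : forall a k, is_pole f a k -> ord a = k).
  { intros a k Hk. apply (pole_order_unique f a); auto. apply epsilon_spec. eauto. }
  set (isp := fun a => if excluded_middle_informative ((exists k, is_pole f a k) /\ Cmod a < r)
    then true else false).
  assert (Hisp : forall a, isp a = true <-> (exists k, is_pole f a k) /\ Cmod a < r).
  { intros a. unfold isp. destruct (excluded_middle_informative _); split; auto; try discriminate; tauto. }
  set (P := filter isp (nodup Cx_eq_dec l)).
  assert (HP : forall a, In a P <-> (exists k, is_pole f a k) /\ Cmod a < r).
  { intros a. unfold P. rewrite filter_In, Hisp, nodup_In. split; [tauto|].
    intros [[k Hk] Ha]. split; [|eauto]. apply Hl; [lra|]. apply (is_pole_singular f a k); auto. }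
  assert (HN : NoDup P) by (apply NoDup_filter, NoDup_nodup).
  set (L := flat_map (fun b => repeat b (ord b)) P).
  assert (HLP : forall b, In b L -> In b P).
  { intros b Hb. apply in_flat_map in Hb. destruct Hb as [c [Hc Hb]].
    apply repeat_spec in Hb. subst. auto. }
  assert (Hrem : forall a, Cmod a < r' -> exists v, removable (fun z => f z * rprod L z)%C a v
     /\ (In a L -> v <> 0%C)).
  { intros a Ha. destruct (meromorphic_at f a Hf) as [[k Hk]|[v [d [h [Hd [Hh [Hv HF]]]]]]].
    - assert (HaP : In a P).
      { apply HP. split; eauto. apply Hsing; auto. apply (is_pole_singular f a k); auto. }
      assert (Hc : count_occ Cx_eq_dec L a = k).
      { unfold L. rewrite count_occ_flat_map_repeat; auto. }
      destruct Hk as [_ [d [Hd [g [Hg [Hga HF]]]]]].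
      set (M := remove Cx_eq_dec a L).
      exists (g a * rprod M a)%C. split.
      + exists d, (fun z => g z * rprod M z)%C. split; [auto|]. split; [|split; [auto|]].
        * intros z Hz. apply (Cdiff_mult g (rprod M)); [apply Hg, Hz|apply Cdiff_rprod].
        * intros z Hz. rewrite (HF z Hz), Cpow_eq, (rprod_split L a z), Hc. fold M.
          change (g z / (z - a) ^ k * ((z - a) ^ k * rprod M z) = g z * rprod M z)%C.
          field. apply Cpow_nz, Cmod_pos_neq. apply Hz.
      + intros _. apply Cmult_neq_0; auto. apply rprod_neq_0, remove_In.
    - exists (h a * rprod L a)%C. split.
      + exists d, (fun z => h z * rprod L z)%C. split; [auto|]. split; [|split; [auto|]].
        * intros z Hz. apply (Cdiff_mult h (rprod L)); [apply Hh, Hz|apply Cdiff_rprod].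
        * intros z Hz. rewrite (HF z Hz). auto.
      + intros Hin. exfalso. apply HLP, HP in Hin. destruct Hin as [[k Hk] _].
        apply (pole_not_holomorphic f h a k d); auto. apply Cdiff_ccont, Hh.
        rewrite Cmod_self. auto. }
  destruct (glue_holomorphic (fun z => f z * rprod L z)%C r') as [g [Hg1 [Hg2 Hg3]]].
  { intros a Ha. destruct (Hrem a Ha) as [v [Hv _]]. eauto. }
  exists L, g, r'. split; auto. split; [|split].
  - split; [|split]; auto. intros b Hb Hbr. destruct (Hrem b Hbr) as [v [Hv Hnz]].
    rewrite (Hg2 b v); auto.
  - intros b Hb. apply HLP, HP in Hb. destruct Hb as [[k Hk] Hb]. split; auto.
    apply (is_pole_singular f b k); auto.
  - intros z Hz HD. destruct (Hg3 z ltac:(lra)) as [d [Hd HF]].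
    apply (ccont_limit_unique g (fun z => f z * rprod L z)%C z d); auto.
    + apply Cdiff_ccont, Hg1. lra.
    + apply ccont_mult; apply Cdiff_ccont; auto. apply Cdiff_rprod.
    + intros w Hw. symmetry. apply HF; auto.
Qed.

(** * Factorisation of polynomials *)

(* [P] is a polynomial of degree at most [m] whose coefficient of [z^m] is [a]. *)
Inductive is_poly (a : C) : nat -> (C -> C) -> Prop :=
| is_poly_O (P : C -> C) : (forall z, P z = a) -> is_poly a O P
| is_poly_S (m : nat) (b : C) (P Q : C -> C) : is_poly a m Q ->
    (forall z, P z = (b + z * Q z)%C) -> is_poly a (S m) P.

Lemma is_poly_add_scal (a a' s : C) (m : nat) (P Q : C -> C) :
  is_poly a (S m) P -> is_poly a' m Q -> is_poly a (S m) (fun z => P z + s * Q z)%C.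
Proof.
  revert P Q. induction m as [|m IH]; intros P Q HP HQ;
    inversion HP as [|m0 b P0 P1 HP1 EP]; subst; inversion HQ as [Q0 EQ|m1 b' Q0 Q1 HQ1 EQ]; subst.
  - apply (is_poly_S a O (b + s * a')%C _ P1); auto.
    intros z. rewrite EP, EQ. ring.
  - apply (is_poly_S a (S m) (b + s * b')%C _ (fun z => P1 z + s * Q1 z)%C); auto.
    intros z. rewrite EP, EQ. ring.
Qed.

Lemma is_poly_divide (a : C) (m : nat) (P : C -> C) (s : C) : is_poly a (S m) P ->
  exists Q, is_poly a m Q /\ forall z, (P z - P s)%C = ((z - s) * Q z)%C.
Proof.
  revert P. induction m as [|m IH]; intros P HP; inversion HP as [|m0 b P0 P1 HP1 EP]; subst.
  - exists P1. split; auto. inversion HP1 as [Q0 E1|]; subst. intros z. rewrite !EP, !E1. ring.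
  - destruct (IH P1 HP1) as [Q1 [HQ1 E1]].
    exists (fun z => P1 z + s * Q1 z)%C. split; [apply (is_poly_add_scal a a); auto|].
    intros z. specialize (E1 z).
    replace (P z - P s)%C with ((z - s) * P1 z + s * (P1 z - P1 s))%C by (rewrite !EP; ring).
    rewrite E1. ring.
Qed.

(** [x ^ m / x] avoids the truncated exponent m - 1 at m = 0. The radius [x] may exceed |z|, so that
    one bound serves a whole disc. *)
Lemma is_poly_growth (a : C) (m : nat) (P : C -> C) : is_poly a m P ->
  exists K, 0 <= K /\ forall z x, 1 <= x -> Cmod z <= x ->
    Cmod (P z - a * z ^ m) <= K * (x ^ m / x).
Proof.
  induction 1 as [P EP|m b P Q HQ [K [HK F]] EP].
  - exists 0. split; [lra|]. intros z x Hx Hz. rewrite EP. simpl.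
    replace (a - a * 1)%C with (RtoC 0) by ring. rewrite Cmod_0. lra.
  - exists (K + Cmod b). pose proof (Cmod_ge_0 b). split; [lra|]. intros z x Hx Hz.
    rewrite EP. simpl. replace (b + z * Q z - a * (z * z ^ m))%C
      with (b + z * (Q z - a * z ^ m))%C by ring.
    eapply Rle_trans; [apply Cmod_triangle|]. rewrite Cmod_mult.
    specialize (F z x Hx Hz). pose proof (Cmod_ge_0 z).
    assert (1 <= x ^ m) by (apply pow_R1_Rle; auto).
    replace (x * x ^ m / x) with (x ^ m) by (field; lra).
    assert (Cmod z * Cmod (Q z - a * z ^ m) <= x * (K * (x ^ m / x))).
    { apply Rmult_le_compat; auto. apply Cmod_ge_0. }
    replace (x * (K * (x ^ m / x))) with (K * x ^ m) in * by (field; lra). nra.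
Qed.

Lemma Cdiff_is_poly (a : C) (m : nat) (P : C -> C) (z : C) : is_poly a m P -> Cdiff P z.
Proof.
  induction 1 as [P EP|m b P Q HQ IH EP].
  - apply (Cdiff_ext_loc (fun _ => a) P z 1); [lra|auto|apply Cdiff_const].
  - apply (Cdiff_ext_loc (fun z => b + z * Q z)%C P z 1); [lra|auto|].
    apply Cdiff_plus; [apply Cdiff_const|]. apply Cdiff_mult; auto. apply Cdiff_id.
Qed.

(* A polynomial without zeros would have a reciprocal with vanishing circle means. *)
Lemma fundamental_theorem_algebra (a : C) (m : nat) (P : C -> C) : is_poly a (S m) P ->
  a <> 0%C -> exists z, P z = 0%C.
Proof.
  intros HP Ha. apply NNPP. intros Hno.
  assert (Hnz : forall z, P z <> 0%C) by (intros z E; apply Hno; eauto).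
  destruct (is_poly_growth _ _ _ HP) as [K [HK F]].
  pose proof (Cmod_pos a Ha) as Hma.
  assert (H0 : Cmod (/ P 0)%C <= 0).
  { apply le_all_eps_0. intros eps He.
    (* A radius with |a| t - K >= 1 / eps, which bounds |P| from below on the circle. *)
    set (t := 1 + 2 * K / Cmod a + 2 / (Cmod a * eps)).
    assert (H1 : 0 <= 2 * K / Cmod a) by (apply Rdiv_le_0_compat; lra).
    assert (H2 : 0 < 2 / (Cmod a * eps)).
    { apply Rdiv_lt_0_compat; [lra|]. apply Rmult_lt_0_compat; auto. }
    assert (HD : forall z, Cdiff (fun z => / P z)%C z).
    { intros z. apply Cdiff_inv; auto. eapply Cdiff_is_poly; eauto. }
    assert (Ht : 1 <= t) by (unfold t; lra).
    rewrite <- (mean_value (fun z => / P z)%C t); [|lra|auto].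
    apply Cmod_Cmean_le.
    - intros th. apply (rcont_on_circle (fun z => / P z)%C); [lra|].
      intros; apply Cdiff_ccont, HD.
    - intros th. rewrite Cmod_inv by auto.
      specialize (F (circ t th) t Ht). rewrite Cmod_circ in F by lra. specialize (F (Rle_refl t)).
      set (w := P (circ t th)) in *.
      pose proof (Cmod_sub_ge (a * circ t th ^ S m) (a * circ t th ^ S m - w)) as G.
      replace (a * circ t th ^ S m - (a * circ t th ^ S m - w))%C with w in G by ring.
      rewrite (Cmod_minus_sym _ w), Cmod_mult, Cmod_pow, Cmod_circ in G by lra.
      assert (E : t ^ S m / t = t ^ m) by (simpl; field; lra).
      rewrite E in F. simpl in F, G.
      assert (1 <= t ^ m) by (apply pow_R1_Rle; auto).
      assert (Hw : Cmod a * t - K <= Cmod w).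
      { assert (Hm : (Cmod a * t - K) * 1 <= (Cmod a * t - K) * t ^ m).
        { apply Rmult_le_compat_l; auto.
          assert (Cmod a * (2 * K / Cmod a) = 2 * K) by (field; lra). unfold t. nra. }
        lra. }
      assert (Hat : Cmod a * t = Cmod a + 2 * K + 2 / eps) by (unfold t; field; lra).
      assert (/ eps <= Cmod w).
      { assert (0 < / eps) by (apply Rinv_0_lt_compat; auto). unfold Rdiv in Hat. lra. }
      rewrite <- (Rinv_inv eps). apply Rinv_le_contravar; auto. apply Rinv_0_lt_compat; auto. }
  pose proof (Cmod_ge_0 (/ P 0)%C). rewrite Cmod_inv in * by auto.
  pose proof (Rinv_0_lt_compat _ (Cmod_pos _ (Hnz 0%C))). lra.
Qed.

Lemma is_poly_factor (a : C) (m : nat) (P : C -> C) : is_poly a m P -> a <> 0%C ->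
  exists l, length l = m /\ forall z, P z = (a * rprod l z)%C.
Proof.
  intros HP Ha. revert P HP. induction m as [|m IH]; intros P HP.
  - exists nil. split; auto. intros z. inversion HP as [P0 EP|]; subst. rewrite EP. simpl. ring.
  - destruct (fundamental_theorem_algebra _ _ _ HP Ha) as [s Hs].
    destruct (is_poly_divide _ _ _ s HP) as [Q [HQ E]].
    destruct (IH Q HQ) as [l [Hl F]]. exists (s :: l). split; [simpl; auto|].
    intros z. specialize (E z). rewrite Hs, F in E. rewrite rprod_cons.
    replace (P z) with (P z - 0)%C by ring. rewrite E. ring.
Qed.

Lemma lower_sum_shift (p : nat -> C) (z : C) (m : nat) :
  lower_sum p z (S m) = (p O + z * lower_sum (fun k => p (S k)) z m)%C.
Proof.
  induction m as [|m IH].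
  - change ((0 + p O * 1)%C = (p O + z * 0)%C). ring.
  - change ((lower_sum p z (S m) + p (S m) * (z * Defs.Cpow z m))%C
      = (p O + z * (lower_sum (fun k => p (S k)) z m + p (S m) * Defs.Cpow z m))%C).
    rewrite IH. ring.
Qed.

Lemma omega_is_poly (n : nat) (c : C) (p : nat -> C) : is_poly c n (omega n c p).
Proof.
  revert p. induction n as [|n IH]; intros p.
  - apply is_poly_O. intros z. change ((c * 1 + 0)%C = c). ring.
  - apply (is_poly_S c n (p O) _ (omega n c (fun k => p (S k)))); auto.
    intros z. unfold omega at 1.
    change ((c * (z * Defs.Cpow z n) + lower_sum p z (S n))%C
      = (p O + z * (c * Defs.Cpow z n + lower_sum (fun k => p (S k)) z n))%C).
    rewrite lower_sum_shift. ring.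
Qed.

(** [rts w] lists the roots of om z = w with multiplicity. It is a mere choice for each [w];
    regularity in [w] will be claimed only for sums over all roots. *)
Definition root_map (n : nat) (c : C) (om : C -> C) (rts : C -> list C) : Prop :=
  (1 <= n)%nat /\ c <> 0%C /\ (forall w, length (rts w) = n) /\
  forall w z, (om z - w)%C = (c * rprod (rts w) z)%C.

Lemma root_map_exists (n : nat) (c : C) (om : C -> C) : (1 <= n)%nat -> c <> 0%C ->
  is_poly c n om -> exists rts, root_map n c om rts.
Proof.
  intros Hn Hc HP.
  assert (H : forall w, exists l, length l = n /\ forall z, (om z - w)%C = (c * rprod l z)%C).
  { intros w. apply is_poly_factor; auto. destruct n as [|n]; [lia|].
    inversion HP as [|m b P Q HQ EP]; subst.
    apply (is_poly_S c n (b - w)%C _ Q); auto. intros z. rewrite EP. ring. }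
  exists (fun w => epsilon (inhabits nil) (fun l => length l = n /\ forall z, (om z - w)%C = (c * rprod l z)%C)).
  split; [auto|]. split; [auto|]. split; intros w.
  - apply (epsilon_spec (inhabits nil) (fun l => length l = n /\ forall z, (om z - w)%C = (c * rprod l z)%C)); auto.
  - apply (epsilon_spec (inhabits nil) (fun l => length l = n /\ forall z, (om z - w)%C = (c * rprod l z)%C)); auto.
Qed.

(** * Preimages under the polynomial and Jensen's formula for om - b *)

Section Roots.
Variables (n : nat) (c : C) (om : C -> C) (rts : C -> list C).
Hypothesis Hom : root_map n c om rts.

Lemma root_map_zero (w z : C) : In z (rts w) <-> om z = w.
Proof.
  destruct Hom as [_ [Hc [_ E]]]. specialize (E w z). split.
  - intros H. apply Cminus_eq_0. rewrite E.
    replace (rprod (rts w) z) with (RtoC 0); [ring|].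
    clear E. induction (rts w) as [|b l IH]; [destruct H|]. rewrite rprod_cons.
    destruct H as [->|H]; [ring|]. rewrite <- IH; auto. ring.
  - intros H. apply NNPP. intros Hn. apply (rprod_neq_0 _ _) in Hn.
    apply (Cmult_neq_0 c _ Hc Hn). rewrite <- E, H. ring.
Qed.

Lemma root_map_Cdiff (z : C) : Cdiff om z.
Proof.
  destruct Hom as [_ [Hc [_ E]]].
  apply (Cdiff_ext_loc (fun z => c * rprod (rts 0) z)%C om z 1); [lra| |].
  - intros w _. rewrite <- E. ring.
  - apply (Cdiff_mult (fun _ => c)); [apply Cdiff_const|apply Cdiff_rprod].
Qed.

Lemma rprod_flat_map_rts (L : list C) (z : C) :
  (c ^ length L * rprod (flat_map rts L) z)%C = rprod L (om z).
Proof.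
  destruct Hom as [_ [Hc [_ E]]]. induction L as [|b L IH]; [simpl; ring|].
  simpl flat_map. rewrite rprod_app, rprod_cons, E, <- IH. simpl length. rewrite Cpow_S. ring.
Qed.

(** Each factor om z - b splits over the roots in [rts b], multiple ones included, so branch points
    of [om] need no special treatment; the leading coefficients collect to [c ^ length L]. *)
Lemma rep_comp (f : C -> C) (L : list C) (g : C -> C) (R' r' : R) :
  rep f L g R' -> (forall z, Cmod z < r' -> Cmod (om z) < R') ->
  rep (fun z => f (om z)) (flat_map rts L) (fun z => g (om z) / c ^ length L)%C r'.
Proof.
  intros [HD [Hnz Hloc]] Hr. destruct Hom as [_ [Hc _]].
  assert (Hcl : (c ^ length L)%C <> 0%C) by (apply Cpow_nz; auto).
  split; [|split].
  - intros z Hz. apply (Cdiff_div (fun z => g (om z))); [|apply Cdiff_const|auto].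
    apply (Cdiff_comp g om); [apply root_map_Cdiff|auto].
  - intros b Hb Hbr. apply in_flat_map in Hb. destruct Hb as [a [Ha Hb]].
    apply root_map_zero in Hb. subst a.
    apply Cmult_neq_0; [auto|]. intros E. apply (f_equal Cmod) in E.
    rewrite Cmod_inv, Cmod_0 in E by auto.
    pose proof (Rinv_0_lt_compat _ (Cmod_pos _ Hcl)). lra.
  - intros a Ha. destruct (Hloc (om a) (Hr a Ha)) as [d [Hd F]].
    (* Close to [a], but off [a], the point om z differs from om a, where the local identity for [f]
       would not be available. *)
    destruct (punctured_near (rts (om a)) a) as [d1 [Hd1 F1]].
    destruct (Cdiff_ccont _ _ (root_map_Cdiff a) d Hd) as [d2 [Hd2 F2]].
    exists (Rmin d1 d2). split; [apply Rmin_pos; auto|]. intros z Hz.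
    pose proof (Rmin_l d1 d2). pose proof (Rmin_r d1 d2).
    rewrite <- F.
    + rewrite <- rprod_flat_map_rts. field. auto.
    + split; [|apply F2; lra]. apply Cmod_pos, Cminus_neq_0.
      intros E. apply root_map_zero in E. apply (F1 z); auto. lra.
Qed.

(* The mean of [log |om - b|] over the circle is the counting function of the
   [b]-points up to this constant. *)
Definition root_const (b : C) : R := ln (Cmod c) + lsum lnstar (rts b).

Lemma mean_log_om (r : R) (b : C) : 0 < r -> (forall z, Cmod z = r -> om z <> b) ->
  Rmean (fun th => ln (Cmod (om (circ r th) - b)))
  = root_const b + lsum (count_term r) (rts b).
Proof.
  intros Hr Hb. pose proof Hom as [_ [Hc [_ E]]].
  assert (Hroot : forall z, In z (rts b) -> Cmod z <> r).
  { intros z Hz Er. apply (Hb z Er). apply root_map_zero; auto. }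
  assert (Hcont : forall z, In z (rts b) -> forall t, continuous (fun th => ln (Cmod (circ r th - z))) t).
  { intros z Hz t. apply continuous_ln_Cmod.
    - apply rcont_minus; [apply rcont_circ|apply rcont_const].
    - apply circ_minus_neq_0; [lra|auto]. }
  rewrite (Rmean_ext _ (fun th => ln (Cmod c) + lsum (fun z => ln (Cmod (circ r th - z))) (rts b))).
  - rewrite Rmean_plus, Rmean_const.
    + rewrite (Rmean_lsum (fun z th => ln (Cmod (circ r th - z)))) by auto.
      rewrite (lsum_ext _ (fun z => lnstar z + count_term r z)).
      * rewrite lsum_plus. unfold root_const. ring.
      * intros z Hz. rewrite mean_log_circle by auto. unfold count_term. ring.
    + intros; apply continuous_const.
    + intros t. apply (continuous_lsum (fun z th => ln (Cmod (circ r th - z)))). auto.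
  - intros th. assert (Hn : ~ In (circ r th) (rts b)).
    { intros Hin. apply (Hroot _ Hin). apply Cmod_circ; lra. }
    rewrite E, Cmod_mult, ln_mult, ln_Cmod_rprod; auto.
    + apply Cmod_pos; auto.
    + apply Cmod_pos, rprod_neq_0; auto.
Qed.

Lemma root_const_eq (b : C) : b <> om 0%C -> root_const b = ln (Cmod (om 0%C - b)).
Proof.
  intros Hb. pose proof Hom as [_ [Hc [_ E]]].
  assert (Hn : ~ In (RtoC 0) (rts b)) by (rewrite root_map_zero; auto).
  rewrite E, Cmod_mult, ln_mult, ln_Cmod_rprod; auto.
  - unfold root_const. f_equal. apply lsum_ext. intros z Hz.
    rewrite lnstar_neq by (intros ->; auto).
    replace (0 - z)%C with (- z)%C by ring. rewrite Cmod_opp. auto.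
  - apply Cmod_pos; auto.
  - apply Cmod_pos, rprod_neq_0; auto.
Qed.
End Roots.

(** * Comparison of characteristics *)

(* [(w - b) / refl r b w] is the Blaschke factor of the disc of radius [r] at [b]. *)
Definition refl (r : R) (b w : C) : C := (RtoC r - Cconj b / RtoC r * w)%C.

Definition refl_prod (r : R) (L : list C) (w : C) : C :=
  fold_right (fun b acc => refl r b w * acc)%C 1%C L.

(** The identity behind the fact that a Blaschke factor has modulus at most 1 in the disc. *)
Lemma Cmod_refl_sqr (r : R) (b w : C) : 0 < r ->
  Cmod (refl r b w) ^ 2 = Cmod (w - b) ^ 2 + (r ^ 2 - Cmod b ^ 2) * (r ^ 2 - Cmod w ^ 2) / r ^ 2.
Proof.
  intros Hr. unfold refl, Complex.Cdiv. rewrite <- RtoC_inv by lra. rewrite !Cmod2_alt.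
  destruct b as [b1 b2], w as [w1 w2]. unfold Re, Im. simpl. field. lra.
Qed.

Lemma Cmod_refl_ge (r : R) (b w : C) : 0 < r -> Cmod b <= r -> Cmod w <= r ->
  Cmod (w - b) <= Cmod (refl r b w).
Proof.
  intros Hr Hb Hw. pose proof (Cmod_refl_sqr r b w Hr) as E.
  pose proof (Cmod_ge_0 b). pose proof (Cmod_ge_0 w).
  assert (0 <= (r ^ 2 - Cmod b ^ 2) * (r ^ 2 - Cmod w ^ 2) / r ^ 2).
  { apply Rdiv_le_0_compat; [|apply pow_lt; auto]. simpl. apply Rmult_le_pos; nra. }
  apply Rsqr_incr_0_var; [|apply Cmod_ge_0]. unfold Rsqr. simpl in *. lra.
Qed.

Lemma refl_neq_0 (r : R) (b w : C) : 0 < r -> Cmod b < r -> Cmod w <= r -> refl r b w <> 0%C.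
Proof.
  intros Hr Hb Hw E. unfold refl in E. apply Cminus_eq_0 in E. apply (f_equal Cmod) in E.
  assert (Hr0 : RtoC r <> 0%C) by (intros E'; injection E'; lra).
  rewrite Cmod_mult, Cmod_div, Cmod_conj, Cmod_R, Rabs_pos_eq in E by (auto; lra).
  pose proof (Cmod_ge_0 b). pose proof (Cmod_ge_0 w).
  assert (r * r = Cmod b * Cmod w) by (rewrite E at 1; field; lra).
  assert (Cmod b * Cmod w <= Cmod b * r) by (apply Rmult_le_compat_l; lra).
  assert (Cmod b * r < r * r) by (apply Rmult_lt_compat_r; lra). lra.
Qed.

Lemma Cdiff_refl (r : R) (b z : C) : Cdiff (refl r b) z.
Proof.
  apply Cdiff_minus; [apply Cdiff_const|]. apply Cdiff_mult; [apply Cdiff_const|apply Cdiff_id].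
Qed.

Lemma Cdiff_refl_prod (r : R) (L : list C) (z : C) : Cdiff (refl_prod r L) z.
Proof.
  induction L as [|b L IH].
  - apply (Cdiff_const 1%C).
  - apply (Cdiff_mult (refl r b) (refl_prod r L)); auto. apply Cdiff_refl.
Qed.

Lemma refl_prod_neq_0 (r : R) (L : list C) (w : C) : 0 < r ->
  (forall b, In b L -> Cmod b < r) -> Cmod w <= r -> refl_prod r L w <> 0%C.
Proof.
  intros Hr. induction L as [|b L IH]; intros HL Hw.
  - intros E. injection E. lra.
  - apply Cmult_neq_0; [apply refl_neq_0|apply IH]; auto.
    + apply HL; simpl; auto.
    + intros; apply HL; simpl; auto.
Qed.

(** The zeros are the mirror images of the points of [L], at distance r^2 / |b| > 2 r - |b| from 0.
    The larger disc is needed because the majorant principle asks for holomorphy beyond the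
    circle. *)
Lemma refl_prod_neq_0_near (r r' : R) (L : list C) : 0 < r < r' ->
  (forall b, In b L -> Cmod b < r) ->
  exists t, r < t /\ t < r' /\ forall z, Cmod z <= t -> refl_prod r L z <> 0%C.
Proof.
  intros Hr HL.
  assert (H : exists t, r < t /\ forall z, Cmod z <= t -> refl_prod r L z <> 0%C).
  { induction L as [|b M IH].
    - exists (r + 1). split; [lra|]. intros z _ E. injection E. lra.
    - destruct IH as [t [Ht F]]; [intros; apply HL; simpl; auto|].
      pose proof (HL b (or_introl eq_refl)) as Hb. pose proof (Cmod_ge_0 b).
      exists (Rmin t (2 * r - Cmod b)). split; [apply Rmin_glb_lt; lra|].
      intros z Hz. pose proof (Rmin_l t (2 * r - Cmod b)). pose proof (Rmin_r t (2 * r - Cmod b)).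
      apply Cmult_neq_0; [|apply F; lra].
      intros E. unfold refl in E. apply Cminus_eq_0 in E. apply (f_equal Cmod) in E.
      assert (Hr0 : RtoC r <> 0%C) by (intros E'; injection E'; lra).
      rewrite Cmod_mult, Cmod_div, Cmod_conj, Cmod_R, Rabs_pos_eq in E by (auto; lra).
      assert (r * r = Cmod b * Cmod z) by (rewrite E at 1; field; lra).
      assert (Cmod b * Cmod z <= Cmod b * (2 * r - Cmod b)) by (apply Rmult_le_compat_l; lra).
      assert (0 < (r - Cmod b) * (r - Cmod b)) by (apply Rmult_lt_0_compat; lra). lra. }
  destruct H as [t [Ht F]]. exists (Rmin t ((r + r') / 2)).
  pose proof (Rmin_l t ((r + r') / 2)). pose proof (Rmin_r t ((r + r') / 2)).
  split; [apply Rmin_glb_lt; lra|]. split; [lra|]. intros z Hz. apply F. lra.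
Qed.

Lemma ln_Cmod_refl_prod (r : R) (L : list C) (w : C) : 0 < r ->
  (forall b, In b L -> Cmod b < r) -> Cmod w <= r ->
  ln (Cmod (refl_prod r L w)) = lsum (fun b => ln (Cmod (refl r b w))) L.
Proof.
  intros Hr. induction L as [|b L IH]; intros HL Hw.
  - simpl. rewrite Cmod_1. apply ln_1.
  - change (refl_prod r (b :: L) w) with (refl r b w * refl_prod r L w)%C.
    assert (HL' : forall b, In b L -> Cmod b < r) by (intros; apply HL; simpl; auto).
    rewrite lsum_cons, Cmod_mult, ln_mult, IH; auto.
    + apply Cmod_pos, refl_neq_0; auto. apply HL; simpl; auto.
    + apply Cmod_pos, refl_prod_neq_0; auto.
Qed.

Lemma Cmod_refl_prod_circ (r th : R) (L : list C) : 0 < r ->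
  Cmod (refl_prod r L (circ r th)) = Cmod (rprod L (circ r th)).
Proof.
  intros Hr. induction L as [|b L IH]; auto.
  change (refl_prod r (b :: L) (circ r th)) with (refl r b (circ r th) * refl_prod r L (circ r th))%C.
  rewrite rprod_cons, !Cmod_mult, IH. unfold refl. rewrite <- Cmod_reflect; auto.
Qed.

Lemma ln_refl_ge (r : R) (b w : C) : 0 < r -> Cmod b <= r -> Cmod w <= r -> w <> b ->
  ln (Cmod (w - b)) <= ln (Cmod (refl r b w)).
Proof.
  intros. apply ln_le_mono; [apply Cmod_pos, Cminus_neq_0; auto|apply Cmod_refl_ge; auto].
Qed.

(** Listing singular points only has the effect that w - b is nonzero for every regular [w]; all
    logarithms below rely on this. *)
Definition good_rep (f : C -> C) (L : list C) (g : C -> C) (r r' : R) : Prop :=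
  0 < r < r' /\ rep f L g r' /\ (forall b, In b L -> Cmod b < r /\ ~ Cdiff f b) /\
  (forall z, Cmod z <= r -> Cdiff f z -> g z = (f z * rprod L z)%C) /\
  (forall z, Cmod z = r -> Cdiff f z).

Lemma good_rep_exists (f : C -> C) (r : R) : meromorphic f -> 0 < r ->
  (forall z, Cmod z = r -> Cdiff f z) -> exists L g r', good_rep f L g r r'.
Proof.
  intros Hf Hr Hgood. destruct (rep_exists f r Hf Hr Hgood) as [L [g [r' [H1 [H2 [H3 H4]]]]]].
  exists L, g, r'. split; [lra|auto].
Qed.

Section Comparison.
Variables (f : C -> C) (L : list C) (g : C -> C) (R1 R1' : R).
Hypothesis Hrep : good_rep f L g R1 R1'.

Lemma good_In_neq (w b : C) : Cdiff f w -> In b L -> w <> b.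
Proof. intros HD Hb ->. destruct Hrep as [_ [_ [H _]]]. apply (H b Hb), HD. Qed.

Lemma good_not_In (w : C) : Cdiff f w -> ~ In w L.
Proof. intros HD Hb. apply (good_In_neq w w); auto. Qed.

Lemma continuous_log_circle_good : forall th, continuous (log_circle f R1) th.
Proof.
  destruct Hrep as [HR [_ [_ [_ Hg]]]]. apply continuous_log_circle; [lra|].
  intros; apply Cdiff_ccont; auto.
Qed.

Lemma log_circle_period (F : C -> C) (r th : R) : log_circle F r (th + 2 * PI) = log_circle F r th.
Proof. unfold log_circle. rewrite circ_period. auto. Qed.

Lemma Rmean_nonneg (u : R -> R) : (forall t, continuous u t) -> (forall t, 0 <= u t) -> 0 <= Rmean u.
Proof.
  intros Hu H. rewrite <- (Rmean_const 0). apply Rmean_le; auto. intros; apply continuous_const.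
Qed.

Lemma T_good (r : R) : 0 < r <= R1 -> (forall z, Cmod z = r -> Cdiff f z) ->
  T f r = Rmean (log_circle f r) + lsum (count_term r) L.
Proof.
  intros Hr Hg. destruct Hrep as [HR [H1 _]]. apply (T_eq f L g R1'); auto; [lra|].
  intros; apply Cdiff_ccont; auto.
Qed.

Lemma lsum_ln_diff_nonneg (w : C) : Cmod w <= R1 -> Cdiff f w ->
  0 <= lsum (fun b => ln (Cmod (refl R1 b w))) L - lsum (fun b => ln (Cmod (w - b))) L.
Proof.
  intros Hw HD. destruct Hrep as [HR [_ [HL _]]]. rewrite <- lsum_minus. apply lsum_nonneg.
  intros b Hb. destruct (HL b Hb).
  assert (Hwb : w <> b) by (apply good_In_neq; auto).
  pose proof (ln_refl_ge R1 b w ltac:(lra) ltac:(lra) Hw Hwb). lra.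
Qed.

Lemma ratio_refl_prod (w : C) : Cmod w <= R1 -> Cdiff f w ->
  Cmod (rprod L w / refl_prod R1 L w) = exp (lsum (fun b => ln (Cmod (w - b))) L
     - lsum (fun b => ln (Cmod (refl R1 b w))) L).
Proof.
  intros Hw HD. destruct Hrep as [HR [_ [HL _]]].
  assert (HL' : forall b, In b L -> Cmod b < R1) by (intros b Hb; apply HL; auto).
  assert (HX : refl_prod R1 L w <> 0%C) by (apply refl_prod_neq_0; auto; lra).
  pose proof (good_not_In w HD) as Hn.
  rewrite <- ln_Cmod_rprod, <- ln_Cmod_refl_prod by (auto; lra).
  rewrite <- ln_div by (apply Cmod_pos; auto; apply rprod_neq_0; auto).
  rewrite exp_ln, Cmod_div; auto.
  apply Rdiv_lt_0_compat; apply Cmod_pos; auto. apply rprod_neq_0; auto.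
Qed.

Lemma poisson_jensen (w : C) : Cmod w < R1 -> Cdiff f w ->
  logplus (Cmod (f w)) <= poisson R1 (log_circle f R1) w
    + (lsum (fun b => ln (Cmod (refl R1 b w))) L - lsum (fun b => ln (Cmod (w - b))) L).
Proof.
  intros Hw HD. pose proof Hrep as [HR [[Hg1 _] [HL [Hg Hgood]]]].
  assert (HL' : forall b, In b L -> Cmod b < R1) by (intros b Hb; apply HL; auto).
  assert (Hc := continuous_log_circle_good).
  assert (HH : 0 <= poisson R1 (log_circle f R1) w).
  { rewrite poisson_Rmean. apply Rmean_nonneg.
    - intros; apply continuous_Rmult; auto. apply continuous_poisson_kernel; auto.
    - intros; apply Rmult_le_pos; [apply logplus_nonneg|apply poisson_kernel_nonneg; auto]. }
  pose proof (lsum_ln_diff_nonneg w ltac:(lra) HD) as Hd.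
  (* Passing from log to log+ needs a nonnegative right-hand side, which is what [HH] and [Hd]
     provide. *)
  apply logplus_le_iff; [lra|].
  destruct (refl_prod_neq_0_near R1 R1' L HR HL') as [t [Ht1 [Ht2 HX]]].
  assert (HM : Cmod (g w / refl_prod R1 L w) <= exp (poisson R1 (log_circle f R1) w)).
  { apply (poisson_majorant R1 t (fun z => g z / refl_prod R1 L z)%C); auto.
    - intros z Hz. apply Cdiff_div; [apply Hg1; lra|apply Cdiff_refl_prod|auto].
    - intros; apply log_circle_period.
    - intros th. assert (He : Cmod (circ R1 th) = R1) by (apply Cmod_circ; lra).
      rewrite Hg by (try apply Hgood; lra).
      assert (Hnz : rprod L (circ R1 th) <> 0%C) by (apply rprod_neq_0, good_not_In, Hgood; auto).
      rewrite Cmod_div, Cmod_mult, Cmod_refl_prod_circ by (try apply HX; lra).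
      pose proof (Cmod_pos _ Hnz).
      replace (Cmod (f (circ R1 th)) * Cmod (rprod L (circ R1 th)) / Cmod (rprod L (circ R1 th)))
        with (Cmod (f (circ R1 th))) by (field; lra).
      apply le_exp_logplus. }
  rewrite Hg in HM by (auto; lra).
  replace (f w * rprod L w / refl_prod R1 L w)%C with (f w * (rprod L w / refl_prod R1 L w))%C in HM
    by (field; apply HX; lra).
  rewrite Cmod_mult, ratio_refl_prod in HM by (auto; lra).
  rewrite exp_plus.
  set (S1 := lsum (fun b => ln (Cmod (refl R1 b w))) L) in *.
  set (S2 := lsum (fun b => ln (Cmod (w - b))) L) in *.
  assert (Ex : exp (S2 - S1) * exp (S1 - S2) = 1).
  { rewrite <- exp_plus. replace (S2 - S1 + (S1 - S2)) with 0 by ring. apply exp_0. }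
  pose proof (exp_pos (S1 - S2)).
  replace (Cmod (f w)) with (Cmod (f w) * exp (S2 - S1) * exp (S1 - S2)).
  - apply Rmult_le_compat_r; lra.
  - rewrite Rmult_assoc, Ex. ring.
Qed.
End Comparison.

Lemma poisson_harnack_lower (r : R) (U : R -> R) (z : C) : Cmod z < r ->
  (forall t, continuous U t) -> (forall t, 0 <= U t) ->
  (r - Cmod z) / (r + Cmod z) * Rmean U <= poisson r U z.
Proof.
  intros Hz HU HU0. rewrite poisson_Rmean, <- Rmean_scal by auto. apply Rmean_le.
  - intros; apply continuous_Rmult; auto. apply continuous_const.
  - intros; apply continuous_Rmult; auto. apply continuous_poisson_kernel; auto.
  - intros t. rewrite (Rmult_comm (U t)). apply Rmult_le_compat_r; auto.
    apply poisson_kernel_bounds; auto.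
Qed.

Lemma exp_le_mono (x y : R) : x <= y -> exp x <= exp y.
Proof. intros [H| <- ]; [left; apply exp_increasing; auto|lra]. Qed.

Lemma exp_le_mono_inv (x y : R) : exp x <= exp y -> x <= y.
Proof. intros H. rewrite <- (ln_exp x), <- (ln_exp y). apply ln_le_mono; auto. apply exp_pos. Qed.

Definition log_deriv (l : list C) (z : C) : C :=
  fold_right (fun b acc => / (z - b) + acc)%C 0%C l.

Lemma log_deriv_cons (b : C) (l : list C) (z : C) :
  log_deriv (b :: l) z = (/ (z - b) + log_deriv l z)%C.
Proof. reflexivity. Qed.

Lemma cderiv_rprod (l : list C) (z : C) : ~ In z l ->
  cderiv (rprod l) z (rprod l z * log_deriv l z)%C.
Proof.
  induction l as [|b l IH]; intros Hn.
  - replace (rprod nil z * log_deriv nil z)%C with (RtoC 0) by (simpl; ring).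
    apply (cderiv_const 1%C).
  - apply In_cons_neq in Hn. destruct Hn as [Hb Hl].
    rewrite log_deriv_cons, rprod_cons.
    replace ((z - b) * rprod l z * (/ (z - b) + log_deriv l z))%C
      with ((1 + - 0) * rprod l z + (z - b) * (rprod l z * log_deriv l z))%C
      by (field; apply Cminus_neq_0; auto).
    apply (cderiv_mult (fun z => z - b)%C (rprod l)); auto.
    apply cderiv_alt. intros eps He. exists 1. split; [lra|]. intros w _.
    replace (w - b - (z - b) - (1 + - 0) * (w - z))%C with (RtoC 0) by ring.
    rewrite Cmod_0. apply Rmult_le_pos; [lra|apply Cmod_ge_0].
Qed.

(** Both sides are the derivative of [om] at [z]. So a sum over the roots for [w] can be replaced by
    one over the fixed roots for 0, and [w] enters only through the explicit factor 1 / (om z -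
    w). *)
Lemma root_map_log_deriv (n : nat) (c : C) (om : C -> C) (rts : C -> list C) (w z : C) :
  root_map n c om rts -> om z <> w -> om z <> 0%C ->
  (om z * log_deriv (rts 0%C) z)%C = ((om z - w) * log_deriv (rts w) z)%C.
Proof.
  intros Hom Hw H0.
  assert (H : forall v, om z <> v -> cderiv om z ((om z - v) * log_deriv (rts v) z)%C).
  { intros v Hv. pose proof Hom as [_ [_ [_ E]]].
    apply (cderiv_ext_loc (fun z => v + c * rprod (rts v) z)%C om z _ 1); [lra| |].
    - intros y _. rewrite <- E. ring.
    - rewrite E. replace (c * rprod (rts v) z * log_deriv (rts v) z)%C
        with (0 + (0 * rprod (rts v) z + c * (rprod (rts v) z * log_deriv (rts v) z)))%C by ring.
      apply cderiv_plus; [apply cderiv_const|].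
      apply (cderiv_mult (fun _ => c)); [apply cderiv_const|]. apply cderiv_rprod.
      rewrite (root_map_zero n c om rts Hom). auto. }
  replace (om z) with (om z - 0)%C at 1 by ring.
  apply (cderiv_unique om z); auto.
Qed.

Lemma rcont_log_deriv (l : list C) (r th : R) : 0 <= r -> (forall z, In z l -> Cmod z < r) ->
  rcont (fun s => log_deriv l (circ r s)) th.
Proof.
  intros Hr. induction l as [|b l IH]; intros Hl.
  - apply (rcont_const 0%C).
  - apply (rcont_plus (fun s => / (circ r s - b))%C (fun s => log_deriv l (circ r s))).
    + pose proof (Hl b (or_introl eq_refl)). apply rcont_inv.
      * apply rcont_minus; [apply rcont_circ|apply rcont_const].
      * apply circ_minus_neq_0; lra.
    + apply IH. intros; apply Hl; simpl; auto.
Qed.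

(** Since (e + z) / (e - z) = 2 e / (e - z) - 1, summing the Schwarz kernels over the points of [l]
    produces the logarithmic derivative of their product. *)
Lemma lsum_poisson (l : list C) (r : R) (U : R -> R) : (forall t, continuous U t) -> 0 < r ->
  (forall z, In z l -> Cmod z < r) ->
  lsum (poisson r U) l = Re (Cmean (fun th => RtoC (U th) *
    (2 * circ r th * log_deriv l (circ r th) - RtoC (INR (length l))))%C).
Proof.
  intros HU Hr. induction l as [|b l IH]; intros Hl.
  - rewrite (Cmean_ext _ (fun _ => 0%C)) by (intros; simpl; ring). rewrite Cmean_const. auto.
  - assert (Hl' : forall z, In z l -> Cmod z < r) by (intros; apply Hl; simpl; auto).
    pose proof (Hl b (or_introl eq_refl)) as Hb. pose proof (Cmod_ge_0 b).
    rewrite lsum_cons, IH by auto. unfold poisson, schwarz.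
    rewrite (Cmean_ext (fun th => RtoC (U th) * (2 * circ r th * log_deriv (b :: l) (circ r th) - RtoC (INR (length (b :: l)))))%C
      (fun th => RtoC (U th) * ((circ r th + b) / (circ r th - b)) + RtoC (U th) *
        (2 * circ r th * log_deriv l (circ r th) - RtoC (INR (length l))))%C).
    + rewrite Cmean_plus; auto.
      * intros th. apply rcont_mult; [apply rcont_RtoC; auto|apply rcont_schwarz_kernel; auto].
      * intros th. apply rcont_mult; [apply rcont_RtoC; auto|]. apply rcont_minus; [|apply rcont_const].
        apply rcont_mult; [|apply rcont_log_deriv; auto; lra].
        apply rcont_mult; [apply rcont_const|apply rcont_circ].
    + intros th. rewrite log_deriv_cons. simpl length. rewrite S_INR, RtoC_plus. field.
      apply circ_minus_neq_0; lra.
Qed.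

Section Composition.
Variables (n : nat) (c : C) (om : C -> C) (rts : C -> list C).
Hypothesis Hom : root_map n c om rts.
Variables (f : C -> C) (L : list C) (g : C -> C) (R1 R1' : R).
Hypothesis Hrep : good_rep f L g R1 R1'.
Variables (r t : R).
Hypothesis Hrt : 0 < r < t.
Hypothesis Hmax : forall z, Cmod z <= t -> Cmod (om z) < R1.
Hypothesis Hgood : forall z, Cmod z = r -> Cdiff f (om z).

Let F z := f (om z).
(** The sum over the poles [b] of the Green function of the disc of radius [R1] at [b]. *)
Let pole_sum (w : C) : R :=
  lsum (fun b => ln (Cmod (refl R1 b w))) L - lsum (fun b => ln (Cmod (w - b))) L.
Let w0 := om 0%C.

(* The sum over the poles [b] of the difference of the Green functions of the
   disc of radius [R1] with poles at [om 0] and at [0], suitably normalised at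
   [b = om 0] and [b = 0]. *)
Definition green_diff : R :=
  lsum (fun b => ln (Cmod (refl R1 b (om 0%C))) - root_const c rts b - (ln R1 - lnstar b)) L.

Let L_lt (b : C) : In b L -> Cmod b < R1.
Proof. intros Hb. apply Hrep; auto. Qed.

Let Hcirc (th : R) : Cmod (om (circ r th)) <= R1.
Proof. left. apply Hmax. rewrite Cmod_circ; lra. Qed.

Let Hgc (th : R) : Cdiff f (om (circ r th)).
Proof. apply Hgood, Cmod_circ. lra. Qed.

Let rcont_om (th : R) : rcont (fun s => om (circ r s)) th.
Proof.
  apply rcont_on_circle; [lra|]. intros; eapply Cdiff_ccont, root_map_Cdiff, Hom.
Qed.

Let cont_ln_om (b : C) (th : R) : In b L -> continuous (fun s => ln (Cmod (om (circ r s) - b))) th.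
Proof.
  intros Hb. apply (continuous_ln_Cmod (fun s => om (circ r s) - b)%C).
  - apply rcont_minus; [apply rcont_om|apply rcont_const].
  - apply Cminus_neq_0, (good_In_neq f L g R1 R1' Hrep); auto.
Qed.

Let cont_ln_refl (b : C) (th : R) : In b L -> continuous (fun s => ln (Cmod (refl R1 b (om (circ r s))))) th.
Proof.
  intros Hb. apply (continuous_ln_Cmod (fun s => refl R1 b (om (circ r s)))).
  - apply (rcont_comp (refl R1 b) (fun s => om (circ r s))); [apply rcont_om|].
    apply Cdiff_ccont, Cdiff_refl.
  - apply refl_neq_0; auto. destruct Hrep; lra.
Qed.

Let cont_F (th : R) : continuous (log_circle F r) th.
Proof.
  apply continuous_log_circle; [lra|]. intros z Hz. apply Cdiff_ccont.
  apply (Cdiff_comp f om); [eapply root_map_Cdiff, Hom|auto].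
Qed.

Let cont_pole_sum (th : R) : continuous (fun s => pole_sum (om (circ r s))) th.
Proof.
  apply (continuous_minus (fun s => lsum (fun b => ln (Cmod (refl R1 b (om (circ r s))))) L)
    (fun s => lsum (fun b => ln (Cmod (om (circ r s) - b))) L)).
  - apply (continuous_lsum (fun b s => ln (Cmod (refl R1 b (om (circ r s)))))). auto.
  - apply (continuous_lsum (fun b s => ln (Cmod (om (circ r s) - b)))). auto.
Qed.

Let om_neq (b z : C) : In b L -> Cmod z = r -> om z <> b.
Proof. intros Hb Hz. apply (good_In_neq f L g R1 R1' Hrep); auto. Qed.

(** [refl R1 b] composed with [om] has no zeros in |z| <= t, so its logarithmic mean is the value at
    0; the other logarithm is evaluated by [mean_log_om]. *)
Lemma mean_pole_sum : Rmean (fun th => pole_sum (om (circ r th)))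
  = lsum (fun b => ln (Cmod (refl R1 b w0)) - root_const c rts b) L
    - lsum (count_term r) (flat_map rts L).
Proof.
  assert (E1 : forall b, In b L -> Rmean (fun th => ln (Cmod (refl R1 b (om (circ r th)))))
     = ln (Cmod (refl R1 b w0))).
  { intros b Hb. apply (mean_log_nonvanishing r t (fun z => refl R1 b (om z))); auto.
    - intros z Hz. apply (Cdiff_comp (refl R1 b) om); [eapply root_map_Cdiff, Hom|apply Cdiff_refl].
    - intros z Hz. apply refl_neq_0; auto; [destruct Hrep; lra|left; auto]. }
  rewrite (Rmean_ext _ (fun th => lsum (fun b => ln (Cmod (refl R1 b (om (circ r th))))) L
    + - lsum (fun b => ln (Cmod (om (circ r th) - b))) L)) by (intros; unfold pole_sum; ring).
  rewrite (Rmean_plus (fun th => lsum (fun b => ln (Cmod (refl R1 b (om (circ r th))))) L)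
    (fun th => - lsum (fun b => ln (Cmod (om (circ r th) - b))) L)).
  - rewrite Rmean_opp.
    + rewrite (Rmean_lsum (fun b th => ln (Cmod (refl R1 b (om (circ r th)))))) by auto.
      rewrite (Rmean_lsum (fun b th => ln (Cmod (om (circ r th) - b)))) by auto.
      rewrite lsum_flat_map.
      rewrite (lsum_ext _ (fun b => ln (Cmod (refl R1 b w0))) L E1).
      rewrite (lsum_ext (fun b => Rmean (fun th => ln (Cmod (om (circ r th) - b))))
        (fun b => root_const c rts b + lsum (count_term r) (rts b)) L).
      * rewrite lsum_plus, lsum_minus. ring.
      * intros b Hb. apply (mean_log_om n c om rts Hom); auto. lra.
    + intros th. apply (continuous_lsum (fun b s => ln (Cmod (om (circ r s) - b)))). auto.
  - intros th. apply (continuous_lsum (fun b s => ln (Cmod (refl R1 b (om (circ r s)))))). auto.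
  - intros th. apply (continuous_opp (fun s => lsum (fun b => ln (Cmod (om (circ r s) - b))) L)).
    apply (continuous_lsum (fun b s => ln (Cmod (om (circ r s) - b)))). auto.
Qed.

Lemma T_comp_eq : T F r = Rmean (log_circle F r) + lsum (count_term r) (flat_map rts L).
Proof.
  destruct Hrep as [HR [HR1 _]].
  apply (T_eq F (flat_map rts L) (fun z => g (om z) / c ^ length L)%C t); [|lra|].
  - apply (rep_comp n c om rts Hom f L g R1' t); auto.
    intros z Hz. pose proof (Hmax z ltac:(lra)). lra.
  - intros z Hz. apply Cdiff_ccont. apply (Cdiff_comp f om); [eapply root_map_Cdiff, Hom|auto].
Qed.

Let sum_split : lsum (fun b => ln (Cmod (refl R1 b w0)) - root_const c rts b) L
  = green_diff + lsum (fun b => ln R1 - lnstar b) L.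
Proof. unfold green_diff. rewrite <- lsum_plus. apply lsum_ext. intros; unfold w0; ring. Qed.

(** Integrate [poisson_jensen] at om z. The Poisson integral of log+ |f| composed with [om] has its
    value at om 0 as mean, which Harnack compares with the mean over the circle; the counting terms
    of [F] cancel against those of [mean_pole_sum]. *)
Lemma T_comp_le : T F r <= (R1 + Cmod w0) / (R1 - Cmod w0) * Rmean (log_circle f R1)
  + lsum (fun b => ln R1 - lnstar b) L + green_diff.
Proof.
  assert (Hc := continuous_log_circle_good f L g R1 R1' Hrep).
  assert (Hw0 : Cmod w0 < R1) by (apply Hmax; rewrite Cmod_0; lra).
  assert (HS : forall z, Cmod z <= r -> Cdiff (fun z => schwarz R1 (log_circle f R1) (om z)) z).
  { intros z Hz. apply (Cdiff_comp (schwarz R1 (log_circle f R1)) om); [eapply root_map_Cdiff, Hom|].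
    apply schwarz_Cdiff; auto. apply Hmax. lra. }
  assert (HP : forall th, continuous (fun th => poisson R1 (log_circle f R1) (om (circ r th))) th).
  { intros th. apply (rcont_Re (fun s => schwarz R1 (log_circle f R1) (om (circ r s)))).
    apply (rcont_on_circle (fun z => schwarz R1 (log_circle f R1) (om z))); [lra|].
    intros z Hz. apply Cdiff_ccont, HS. lra. }
  assert (HM : Rmean (fun th => poisson R1 (log_circle f R1) (om (circ r th))) = poisson R1 (log_circle f R1) w0).
  { unfold poisson. rewrite <- (Re_Cmean (fun th => schwarz R1 (log_circle f R1) (om (circ r th)))).
    rewrite (mean_value (fun z => schwarz R1 (log_circle f R1) (om z)) r); auto. lra. }
  assert (H1 : Rmean (log_circle F r)
    <= Rmean (fun th => poisson R1 (log_circle f R1) (om (circ r th)) + pole_sum (om (circ r th)))).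
  { apply Rmean_le; auto.
    - intros th. apply (continuous_plus (fun th => poisson R1 (log_circle f R1) (om (circ r th)))
        (fun th => pole_sum (om (circ r th)))); auto.
    - intros th. apply (poisson_jensen f L g R1 R1' Hrep); auto.
      apply Hmax. rewrite Cmod_circ; lra. }
  rewrite Rmean_plus, HM, mean_pole_sum, sum_split in H1 by auto.
  rewrite T_comp_eq.
  pose proof (poisson_harnack R1 (log_circle f R1) w0 Hw0 Hc (fun th => logplus_nonneg _)). lra.
Qed.

(** Controls the mean that [T_comp_ge] subtracts with a factor slightly less than 1. The upper
    estimate discards the counting function of [F]. *)
Lemma green_diff_lower_bound : 1 <= r ->
  0 <= Rmean (fun th => pole_sum (om (circ r th)))
    <= lsum (fun b => ln R1 - lnstar b) L + green_diff.
Proof.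
  intros Hr. split.
  - apply Rmean_nonneg; auto. intros th. apply (lsum_ln_diff_nonneg f L g R1 R1' Hrep); auto.
  - rewrite mean_pole_sum, sum_split.
    assert (0 <= lsum (count_term r) (flat_map rts L)); [|lra].
    apply lsum_nonneg. intros; apply count_term_nonneg; auto.
Qed.

Variables (rho rho' Z : R).
Hypothesis Hrho : 0 < rho < rho'.
Hypothesis Hmin : forall z, r <= Cmod z -> rho' <= Cmod (om z).
Hypothesis Hgrho : forall z, Cmod z = rho -> Cdiff f z.
Hypothesis Hr1 : 1 <= r.
Hypothesis HZ : forall z, In z (rts 0%C) -> Cmod z <= Z.
Hypothesis HZr : 0 <= Z < r.

(** A majorant on |z| = r of the logarithm of |F| after the poles have been removed by the Blaschke
    product in om z. It can be negative. *)
Let U th := log_circle F r th - pole_sum (om (circ r th)).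

Let cont_U th : continuous U th.
Proof. apply (continuous_minus (log_circle F r) (fun s => pole_sum (om (circ r s)))); auto. Qed.

Let period_U th : U (th + 2 * PI) = U th.
Proof. unfold U, log_circle. rewrite circ_period. auto. Qed.

Let rts_lt (w z : C) : Cmod w < rho' -> In z (rts w) -> Cmod z < r.
Proof.
  intros Hw Hz. apply (root_map_zero n c om rts Hom) in Hz. apply Rnot_le_lt. intros Hle.
  specialize (Hmin z Hle). rewrite Hz in Hmin. lra.
Qed.

Let rho_lt : rho' <= R1.
Proof.
  pose proof (Hmin (circ r 0)) as H. rewrite Cmod_circ in H by lra.
  pose proof (Hcirc 0). specialize (H (Rle_refl r)). lra.
Qed.

(** Two functions of z are majorised with the same [U]: [g / refl_prod] and [rprod / refl_prod],
    both at om z. The first bounds log |f w|; the second shows that the right-hand side is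
    nonnegative, so that log can be replaced by log+. *)
Lemma logplus_le_poisson (w z : C) : Cmod w = rho -> In z (rts w) ->
  logplus (Cmod (f w)) <= poisson r U z + pole_sum w.
Proof.
  intros Hw Hz. pose proof Hrep as [HR [[Hg1 _] [HL [Hg _]]]].
  assert (Hzr : Cmod z < r) by (apply (rts_lt w z); auto; lra).
  assert (Hoz : om z = w) by (apply (root_map_zero n c om rts Hom); auto).
  assert (HDw : Cdiff f w) by auto. pose proof rho_lt as HrR.
  assert (HX : forall v, Cmod v <= t -> refl_prod R1 L (om v) <> 0%C).
  { intros v Hv. apply refl_prod_neq_0; auto; [lra|left; auto]. }
  assert (HDX : forall h, (forall v, Cmod v < R1 -> Cdiff h v) -> forall v, Cmod v <= t ->
    Cdiff (fun v => h (om v) / refl_prod R1 L (om v))%C v).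
  { intros h Hh v Hv. pose proof (root_map_Cdiff n c om rts Hom v). apply Cdiff_div; auto.
    - apply (Cdiff_comp h om); auto.
    - apply (Cdiff_comp (refl_prod R1 L) om); auto. apply Cdiff_refl_prod. }
  assert (HU : forall th, Cmod (rprod L (om (circ r th)) / refl_prod R1 L (om (circ r th)))
     = exp (- pole_sum (om (circ r th)))).
  { intros th. rewrite (ratio_refl_prod f L g R1 R1' Hrep) by auto. f_equal. unfold pole_sum. ring. }
  assert (M2 : Cmod (rprod L w / refl_prod R1 L w) <= exp (poisson r U z)).
  { rewrite <- Hoz. apply (poisson_majorant r t (fun v => rprod L (om v) / refl_prod R1 L (om v))%C); auto; [lra| |].
    - apply HDX. intros; apply Cdiff_rprod.
    - intros th. rewrite HU. apply exp_le_mono. unfold U.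
      pose proof (logplus_nonneg (Cmod (F (circ r th)))). unfold log_circle. lra. }
  assert (M1 : Cmod (g w / refl_prod R1 L w) <= exp (poisson r U z)).
  { rewrite <- Hoz. apply (poisson_majorant r t (fun v => g (om v) / refl_prod R1 L (om v))%C); auto; [lra| |].
    - apply HDX. intros; apply Hg1. lra.
    - intros th. rewrite Hg by auto.
      replace (f (om (circ r th)) * rprod L (om (circ r th)) / refl_prod R1 L (om (circ r th)))%C
        with (f (om (circ r th)) * (rprod L (om (circ r th)) / refl_prod R1 L (om (circ r th))))%C
        by (field; apply HX; rewrite Cmod_circ; lra).
      rewrite Cmod_mult, HU. unfold U, Rminus. rewrite exp_plus.
      apply Rmult_le_compat_r; [left; apply exp_pos|]. apply le_exp_logplus. }
  rewrite (ratio_refl_prod f L g R1 R1' Hrep) in M2 by (auto; lra).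
  assert (HXw : refl_prod R1 L w <> 0%C) by (rewrite <- Hoz; apply HX; lra).
  rewrite Hg in M1 by (auto; lra).
  replace (f w * rprod L w / refl_prod R1 L w)%C with (f w * (rprod L w / refl_prod R1 L w))%C in M1
    by (field; auto).
  rewrite Cmod_mult, (ratio_refl_prod f L g R1 R1' Hrep) in M1 by (auto; lra).
  replace (lsum (fun b => ln (Cmod (w - b))) L - lsum (fun b => ln (Cmod (refl R1 b w))) L)
    with (- pole_sum w) in * by (unfold pole_sum; ring).
  apply logplus_le_iff.
  - apply exp_le_mono_inv in M2. lra.
  - rewrite exp_plus. rewrite exp_Ropp in M1. pose proof (exp_pos (pole_sum w)).
    replace (Cmod (f w)) with (Cmod (f w) * / exp (pole_sum w) * exp (pole_sum w)) by (field; lra).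
    apply Rmult_le_compat_r; lra.
Qed.

Let rts0_lt (z : C) : In z (rts 0%C) -> Cmod z < r.
Proof. intros Hz. specialize (HZ z Hz). lra. Qed.

(* [Re (V w)] is the sum over the roots [z] of [om z = w] of the Poisson integral
   of [U] at [z] (see [V_eq]); in this form it is visibly harmonic in [w]. *)
Let V (w : C) : C := (Cmean (fun th => RtoC (U th) * (2 * circ r th) *
    (om (circ r th) * log_deriv (rts 0%C) (circ r th)) / (om (circ r th) - w))
  - Cmean (fun th => RtoC (U th) * RtoC (INR n)))%C.

Let om_far (th : R) (w : C) : rho' - Cmod w <= Cmod (om (circ r th) - w).
Proof.
  pose proof (Hmin (circ r th)) as H. rewrite Cmod_circ in H by lra. specialize (H (Rle_refl r)).
  pose proof (Cmod_sub_ge (om (circ r th)) w). lra.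
Qed.

Let rcont_num (th : R) : rcont (fun th => RtoC (U th) * (2 * circ r th) *
    (om (circ r th) * log_deriv (rts 0%C) (circ r th)))%C th.
Proof.
  apply rcont_mult.
  - apply rcont_mult; [apply rcont_RtoC, cont_U|].
    apply rcont_mult; [apply rcont_const|apply rcont_circ].
  - apply rcont_mult; [apply rcont_om|apply rcont_log_deriv; [lra|auto]].
Qed.

Let V_Cdiff (w : C) : Cmod w < rho' -> Cdiff V w.
Proof.
  intros Hw. apply Cdiff_minus; [|apply Cdiff_const].
  apply (cauchy_type_Cdiff _ (fun th => om (circ r th)) w (rho' - Cmod w)); auto. lra.
Qed.

(** The logarithmic derivative over [rts w] is rewritten over [rts 0] by [root_map_log_deriv]; om z
    - w and om z are nonzero on |z| = r because |om z| >= rho'. *)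
Let V_eq (w : C) : Cmod w < rho' -> Re (V w) = lsum (poisson r U) (rts w).
Proof.
  intros Hw. rewrite lsum_poisson.
  - f_equal. unfold V. rewrite <- Cmean_minus.
    + apply Cmean_ext. intros th.
      pose proof Hom as [_ [_ [Hlen _]]]. rewrite Hlen.
      assert (Hn : (om (circ r th) - w)%C <> 0%C).
      { apply Cmod_pos_neq. pose proof (om_far th w). lra. }
      rewrite (root_map_log_deriv n c om rts w (circ r th) Hom).
      * field. auto.
      * intros E. apply Hn. rewrite E. ring.
      * intros E. pose proof (om_far th 0%C) as H. rewrite E, Cmod_self, Cmod_0 in H. lra.
    + intros th. apply rcont_div; [apply rcont_num| |].
      * apply rcont_minus; [apply rcont_om|apply rcont_const].
      * apply Cmod_pos_neq. pose proof (om_far th w). lra.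
    + intros th. apply rcont_mult; [apply rcont_RtoC, cont_U|apply rcont_const].
  - apply cont_U.
  - lra.
  - intros z. apply rts_lt; auto.
Qed.

Let cont_frho (th : R) : continuous (log_circle f rho) th.
Proof. apply continuous_log_circle; [lra|]. intros; apply Cdiff_ccont; auto. Qed.

Let rho_neq (b : C) : In b L -> Cmod b <> rho.
Proof. intros Hb E. destruct Hrep as [_ [_ [HL _]]]. apply (HL b Hb); auto. Qed.

Let cont_ln_rho (b : C) (th : R) : In b L -> continuous (fun s => ln (Cmod (circ rho s - b))) th.
Proof.
  intros Hb. apply (continuous_ln_Cmod (fun s => circ rho s - b)%C).
  - apply rcont_minus; [apply rcont_circ|apply rcont_const].
  - apply circ_minus_neq_0; [lra|auto].
Qed.

Let cont_ln_refl_rho (b : C) (th : R) : In b L -> continuous (fun s => ln (Cmod (refl R1 b (circ rho s)))) th.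
Proof.
  intros Hb. pose proof rho_lt. apply (continuous_ln_Cmod (fun s => refl R1 b (circ rho s))).
  - apply (rcont_comp (refl R1 b) (circ rho)); [apply rcont_circ|].
    apply Cdiff_ccont, Cdiff_refl.
  - apply refl_neq_0; auto; [lra|]. rewrite Cmod_circ; lra.
Qed.

Let cont_pole_rho (th : R) : continuous (fun s => pole_sum (circ rho s)) th.
Proof.
  apply (continuous_minus (fun s => lsum (fun b => ln (Cmod (refl R1 b (circ rho s)))) L)
    (fun s => lsum (fun b => ln (Cmod (circ rho s - b))) L)).
  - apply (continuous_lsum (fun b s => ln (Cmod (refl R1 b (circ rho s))))). auto.
  - apply (continuous_lsum (fun b s => ln (Cmod (circ rho s - b)))). auto.
Qed.

(** The analogue of [mean_pole_sum] for the identity: the base point is 0, and no difference of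
    Green functions appears. *)
Let mean_pole_rho : Rmean (fun th => pole_sum (circ rho th))
  = lsum (fun b => ln R1 - lnstar b) L - lsum (count_term rho) L.
Proof.
  pose proof rho_lt.
  assert (E1 : forall b, In b L -> Rmean (fun th => ln (Cmod (refl R1 b (circ rho th)))) = ln R1).
  { intros b Hb. rewrite (mean_log_nonvanishing rho R1 (refl R1 b)); [| lra | |].
    - f_equal. unfold refl. replace (RtoC R1 - Cconj b / RtoC R1 * 0)%C with (RtoC R1) by ring.
      rewrite Cmod_R. apply Rabs_pos_eq. lra.
    - intros; apply Cdiff_refl.
    - intros; apply refl_neq_0; auto. lra. }
  rewrite (Rmean_ext _ (fun th => lsum (fun b => ln (Cmod (refl R1 b (circ rho th)))) L
    + - lsum (fun b => ln (Cmod (circ rho th - b))) L)) by (intros; unfold pole_sum; ring).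
  rewrite (Rmean_plus (fun th => lsum (fun b => ln (Cmod (refl R1 b (circ rho th)))) L)
    (fun th => - lsum (fun b => ln (Cmod (circ rho th - b))) L)).
  - rewrite Rmean_opp.
    + rewrite (Rmean_lsum (fun b th => ln (Cmod (refl R1 b (circ rho th))))) by auto.
      rewrite (Rmean_lsum (fun b th => ln (Cmod (circ rho th - b)))) by auto.
      rewrite (lsum_ext _ (fun b => ln R1) L E1).
      rewrite (lsum_ext (fun b => Rmean (fun th => ln (Cmod (circ rho th - b))))
        (fun b => count_term rho b + lnstar b) L).
      * rewrite lsum_plus, lsum_minus. ring.
      * intros b Hb. unfold count_term. rewrite mean_log_circle by (auto; lra). ring.
    + intros th. apply (continuous_lsum (fun b s => ln (Cmod (circ rho s - b)))). auto.
  - intros th. apply (continuous_lsum (fun b s => ln (Cmod (refl R1 b (circ rho s))))). auto.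
  - intros th. apply (continuous_opp (fun s => lsum (fun b => ln (Cmod (circ rho s - b))) L)).
    apply (continuous_lsum (fun b s => ln (Cmod (circ rho s - b)))). auto.
Qed.

(** The right-hand side is Re (V 0), the mean of Re V over |w| = rho. There each of the n roots
    contributes at least log+ |f w| minus the Green sum, whose mean is known by [mean_pole_rho]. *)
Let sum_poisson_ge : INR n * (T f rho - lsum (fun b => ln R1 - lnstar b) L)
  <= lsum (poisson r U) (rts 0%C).
Proof.
  pose proof rho_lt. pose proof Hom as [Hn [_ [Hlen _]]].
  rewrite <- V_eq by (rewrite Cmod_0; lra).
  rewrite <- (mean_value V rho) by (try (intros; apply V_Cdiff); lra).
  rewrite Re_Cmean, (T_good f L g R1 R1' Hrep) by (auto; lra).
  replace (INR n * _) with (Rmean (fun th => INR n * (log_circle f rho th + - pole_sum (circ rho th)))).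
  - apply Rmean_le.
    + intros th. apply (continuous_Rmult (fun _ => INR n)); [apply continuous_const|].
      apply (continuous_plus (log_circle f rho) (fun th => - pole_sum (circ rho th))); auto.
      apply (continuous_opp (fun th => pole_sum (circ rho th))); auto.
    + intros th. apply (rcont_Re (fun th => V (circ rho th))).
      apply rcont_on_circle; [lra|]. intros; apply Cdiff_ccont, V_Cdiff; lra.
    + intros th. rewrite V_eq by (rewrite Cmod_circ; lra).
      rewrite <- (Hlen (circ rho th)) at 1. rewrite <- lsum_const. apply lsum_le.
      intros z Hz. pose proof (logplus_le_poisson (circ rho th) z) as Hl.
      rewrite Cmod_circ in Hl by lra. specialize (Hl eq_refl Hz). unfold log_circle. lra.
  - rewrite Rmean_scal, Rmean_plus, Rmean_opp, mean_pole_rho; auto; [ring| |].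
    + intros th. apply (continuous_opp (fun th => pole_sum (circ rho th))); auto.
    + intros th. apply (continuous_plus (log_circle f rho) (fun th => - pole_sum (circ rho th))); auto.
      apply (continuous_opp (fun th => pole_sum (circ rho th))); auto.
Qed.

(** [U] is a difference of two nonnegative functions, so Harnack is used from above for one and from
    below for the other. It is applied at the roots of om z = 0, all in |z| <= Z. *)
Let poisson_U_le (z : C) : Cmod z <= Z ->
  poisson r U z <= (r + Z) / (r - Z) * Rmean (log_circle F r)
    - (r - Z) / (r + Z) * Rmean (fun th => pole_sum (om (circ r th))).
Proof.
  intros Hz. pose proof (Cmod_ge_0 z).
  assert (HA : 0 <= Rmean (log_circle F r)).
  { apply Rmean_nonneg; auto. intros; apply logplus_nonneg. }
  assert (Hp : forall th, 0 <= pole_sum (om (circ r th))).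
  { intros th. apply (lsum_ln_diff_nonneg f L g R1 R1' Hrep); auto. }
  assert (HB : 0 <= Rmean (fun th => pole_sum (om (circ r th)))) by (apply Rmean_nonneg; auto).
  assert (E : poisson r U z = poisson r (log_circle F r) z
    - poisson r (fun th => pole_sum (om (circ r th))) z).
  { replace (poisson r U z) with (poisson r (fun th => log_circle F r th + (-1) * pole_sum (om (circ r th))) z).
    - rewrite poisson_plus, poisson_scal; auto; try lra.
      intros th. apply (continuous_Rmult (fun _ => -1)); [apply continuous_const|auto].
    - f_equal. apply functional_extensionality. intros th. unfold U. ring. }
  rewrite E.
  pose proof (poisson_harnack r (log_circle F r) z ltac:(lra) cont_F (fun th => logplus_nonneg _)) as H1.
  pose proof (poisson_harnack_lower r (fun th : R => pole_sum (om (circ r th))) z ltac:(lra) cont_pole_sum Hp) as H2.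
  assert ((r + Cmod z) / (r - Cmod z) <= (r + Z) / (r - Z)).
  { apply Rmult_le_compat; try lra; [left; apply Rinv_0_lt_compat; lra|apply Rinv_le_contravar; lra]. }
  assert ((r - Z) / (r + Z) <= (r - Cmod z) / (r + Cmod z)).
  { apply Rmult_le_compat; try lra; [left; apply Rinv_0_lt_compat; lra|apply Rinv_le_contravar; lra]. }
  assert ((r + Cmod z) / (r - Cmod z) * Rmean (log_circle F r) <= (r + Z) / (r - Z) * Rmean (log_circle F r))
    by (apply Rmult_le_compat_r; auto).
  assert ((r - Z) / (r + Z) * Rmean (fun th => pole_sum (om (circ r th)))
    <= (r - Cmod z) / (r + Cmod z) * Rmean (fun th => pole_sum (om (circ r th))))
    by (apply Rmult_le_compat_r; auto).
  lra.
Qed.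

(** Combine the bounds of the sum over the roots and divide by n. In - q' B = - B + (1 - q') B the
    term - B, evaluated by [mean_pole_sum], cancels [N] and supplies the counting part of T F r. *)
Lemma T_comp_ge : T f rho <= (r + Z) / (r - Z) * T F r - green_diff
  + (1 - (r - Z) / (r + Z)) * (lsum (fun b => ln R1 - lnstar b) L + green_diff).
Proof.
  pose proof Hom as [Hn [_ [Hlen _]]].
  set (q := (r + Z) / (r - Z)). set (q' := (r - Z) / (r + Z)).
  set (N := lsum (fun b => ln R1 - lnstar b) L).
  set (A := Rmean (log_circle F r)).
  pose proof (green_diff_lower_bound Hr1) as HB. pose proof mean_pole_sum as EB.
  rewrite sum_split in EB. fold N in EB, HB.
  set (B := Rmean (fun th => pole_sum (om (circ r th)))) in *.
  pose proof T_comp_eq as ET. fold A in ET.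
  assert (HN : 0 <= lsum (count_term r) (flat_map rts L)).
  { apply lsum_nonneg. intros; apply count_term_nonneg; auto. }
  pose proof sum_poisson_ge as H1. fold N in H1.
  assert (H2 : lsum (poisson r U) (rts 0%C) <= INR n * (q * A - q' * B)).
  { rewrite <- (Hlen 0%C) at 1. rewrite <- lsum_const. apply lsum_le.
    intros z Hz. apply poisson_U_le. auto. }
  assert (Hn' : 0 < INR n) by (apply lt_0_INR; lia).
  assert (H3 : T f rho - N <= q * A - q' * B).
  { apply Rmult_le_reg_l with (INR n); auto. lra. }
  assert (Hq : 1 <= q).
  { unfold q. apply Rmult_le_reg_r with (r - Z); [lra|]. unfold Rdiv. rewrite Rmult_assoc, Rinv_l; lra. }
  assert (Hq' : q' <= 1).
  { unfold q'. apply Rmult_le_reg_r with (r + Z); [lra|]. unfold Rdiv. rewrite Rmult_assoc, Rinv_l; lra. }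
  assert ((q - 1) * A <= (q - 1) * T F r) by (apply Rmult_le_compat_l; lra).
  assert ((1 - q') * B <= (1 - q') * (N + green_diff)) by (apply Rmult_le_compat_l; lra).
  lra.
Qed.
End Composition.

Lemma ln_le_sub_1 (x : R) : 0 < x -> ln x <= x - 1.
Proof.
  intros Hx. pose proof (exp_ineq1_le (ln x)) as H. rewrite exp_ln in H by auto. lra.
Qed.

Lemma Rabs_ln_1_plus (y : C) : Cmod y <= 1 / 2 -> Rabs (ln (Cmod (1 + y))) <= 2 * Cmod y.
Proof.
  intros Hy. pose proof (Cmod_ge_0 y).
  pose proof (Cmod_triangle 1 y) as H1. rewrite Cmod_1 in H1.
  pose proof (Cmod_sub_ge 1 (- y)%C) as H2. rewrite Cmod_1, Cmod_opp in H2.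
  replace (1 - - y)%C with (1 + y)%C in H2 by ring.
  set (m := Cmod (1 + y)) in *. apply Rabs_le. split.
  - assert (Hi : ln (/ m) <= / m - 1) by (apply ln_le_sub_1, Rinv_0_lt_compat; lra).
    rewrite ln_Rinv in Hi by lra.
    assert (/ m - 1 <= 2 * Cmod y); [|lra].
    apply Rmult_le_reg_r with m; [lra|]. rewrite Rmult_minus_distr_r, Rinv_l by lra. nra.
  - pose proof (ln_le_sub_1 m ltac:(lra)). lra.
Qed.

Lemma le_lsum {A : Type} (h : A -> R) (l : list A) (b : A) : (forall a, 0 <= h a) -> In b l ->
  h b <= lsum h l.
Proof.
  intros Hh. induction l as [|a l IH]; intros Hb; [destruct Hb|]. rewrite lsum_cons.
  destruct Hb as [->|Hb].
  - assert (0 <= lsum h l) by (apply lsum_nonneg; auto). lra.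
  - specialize (IH Hb). specialize (Hh a). lra.
Qed.

Lemma Rabs_lsum {A : Type} (h : A -> R) (l : list A) : Rabs (lsum h l) <= lsum (fun b => Rabs (h b)) l.
Proof.
  induction l as [|a l IH]; [simpl; rewrite Rabs_R0; lra|]. rewrite !lsum_cons.
  eapply Rle_trans; [apply Rabs_triang|]. lra.
Qed.

Section Green.
Variables (n : nat) (c : C) (om : C -> C) (rts : C -> list C).
Hypothesis Hom : root_map n c om rts.

Let w0 := om 0%C.
Let gterm (r : R) (b : C) : R := ln (Cmod (refl r b w0)) - root_const c rts b - (ln r - lnstar b).

(* Harnack's inequality for the Green function, in explicit form. *)
Lemma green_term_far (r : R) (b : C) : 4 * Cmod w0 <= Cmod b -> 0 < Cmod b -> Cmod b < r ->
  Rabs (gterm r b) <= 8 * (Cmod w0 / Cmod b) * (ln r - lnstar b).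
Proof.
  intros H4 Hb0 Hbr. assert (Hb : b <> 0%C) by (apply Cmod_pos_neq; auto).
  pose proof (Cmod_ge_0 w0) as Hw.
  assert (Hbw : b <> w0) by (intros E; rewrite <- E in *; lra).
  unfold gterm. rewrite (root_const_eq n c om rts Hom) by auto. rewrite lnstar_neq by auto.
  fold w0. set (x := (w0 / b)%C). set (s := Cmod b ^ 2 / r ^ 2).
  assert (Hx : Cmod x = Cmod w0 / Cmod b) by (unfold x; apply Cmod_div; auto).
  assert (Hx4 : Cmod x <= 1 / 4).
  { rewrite Hx. apply Rmult_le_reg_r with (Cmod b); auto. unfold Rdiv at 1.
    rewrite Rmult_assoc, Rinv_l; lra. }
  pose proof (Cmod_ge_0 x) as Hx0. rewrite <- Hx.
  assert (Hr2 : 0 < r ^ 2) by (apply pow_lt; lra).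
  assert (Hs : 0 <= s <= 1).
  { unfold s. split; [apply Rdiv_le_0_compat; [apply pow_le; lra|auto]|].
    apply Rmult_le_reg_r with (r ^ 2); auto. unfold Rdiv. rewrite Rmult_assoc, Rinv_l by lra.
    rewrite Rmult_1_r, Rmult_1_l. apply pow_incr. lra. }
  assert (H1x : (1 - x)%C <> 0%C).
  { intros E. apply Cminus_eq_0 in E. rewrite <- E, Cmod_1 in Hx4. lra. }
  assert (Hwb : (w0 - b)%C <> 0%C) by (apply Cminus_neq_0; auto).
  (* refl r b w0 = - (r / b) (w0 - b) (1 + y). The factor 1 - s makes [y] small near the circle,
     where the Green function vanishes: 1 - s <= - log s = 2 log (r / |b|). *)
  set (y := (RtoC (1 - s) * x / (1 - x))%C).
  assert (Hr0 : RtoC r <> 0%C) by (intros E; injection E; lra).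
  assert (E : (refl r b w0 * b)%C = (- RtoC r * (w0 - b) * (1 + y))%C).
  { assert (Es : (RtoC s * (RtoC r * RtoC r))%C = (b * Cconj b)%C).
    { rewrite <- Cmod2_conj, <- !RtoC_mult. f_equal. unfold s. field. lra. }
    assert (Ew : w0 = (x * b)%C) by (unfold x; field; auto).
    unfold y, refl. rewrite Ew, RtoC_minus.
    replace (- RtoC r * (x * b - b) * (1 + (RtoC 1 - RtoC s) * x / (1 - x)))%C
      with (b * (RtoC r - (RtoC s * (RtoC r * RtoC r)) * x / RtoC r))%C by (field; auto).
    rewrite Es. field. auto. }
  assert (Hy : Cmod y <= 2 * ((1 - s) * Cmod x)).
  { unfold y. rewrite Cmod_div, Cmod_mult, Cmod_R, Rabs_pos_eq by (auto; lra).
    pose proof (Cmod_sub_ge 1 x) as Hg. rewrite Cmod_1 in Hg.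
    apply Rmult_le_reg_r with (Cmod (1 - x)); [lra|].
    unfold Rdiv. rewrite Rmult_assoc, Rinv_l by lra.
    assert (0 <= (1 - s) * Cmod x) by (apply Rmult_le_pos; lra). nra. }
  assert (Hy2 : Cmod y <= 1 / 2) by nra.
  pose proof (Rabs_ln_1_plus y Hy2) as Hl.
  assert (H1y : 0 < Cmod (1 + y)).
  { pose proof (Cmod_sub_ge 1 (- y)%C) as Hg. rewrite Cmod_1, Cmod_opp in Hg.
    replace (1 - - y)%C with (1 + y)%C in Hg by ring. lra. }
  assert (Hn : refl r b w0 <> 0%C) by (apply refl_neq_0; lra).
  apply (f_equal Cmod) in E. rewrite !Cmod_mult, Cmod_opp, Cmod_R, Rabs_pos_eq in E by lra.
  apply (f_equal ln) in E.
  pose proof (Cmod_pos _ Hn). pose proof (Cmod_pos _ Hwb).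
  rewrite !ln_mult in E by (try apply Rmult_lt_0_compat; lra).
  replace (ln (Cmod (refl r b w0)) - ln (Cmod (w0 - b)) - (ln r - ln (Cmod b)))
    with (ln (Cmod (1 + y))) by lra.
  eapply Rle_trans; [exact Hl|].
  assert (Hln : 1 - s <= 2 * (ln r - ln (Cmod b))).
  { assert (Hs0 : 0 < s) by (apply Rdiv_lt_0_compat; auto; apply pow_lt; auto).
    pose proof (ln_le_sub_1 s Hs0) as Hls. unfold s in Hls.
    rewrite ln_div, !ln_pow in Hls by (try apply pow_lt; lra). fold s in Hls. simpl in Hls. lra. }
  assert (2 * Cmod y <= 4 * Cmod x * (1 - s)) by lra.
  assert (4 * Cmod x * (1 - s) <= 4 * Cmod x * (2 * (ln r - ln (Cmod b)))) by (apply Rmult_le_compat_l; lra).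
  lra.
Qed.

Lemma green_term_near (r A : R) (b : C) : Cmod b <= A -> 2 * A * Cmod w0 <= r ^ 2 -> 0 < r ->
  Rabs (gterm r b) <= 1 + Rabs (lnstar b - root_const c rts b).
Proof.
  intros Hb HA Hr. pose proof (Cmod_ge_0 w0). pose proof (Cmod_ge_0 b).
  assert (Hr0 : RtoC r <> 0%C) by (intros E; injection E; lra).
  assert (Hr2 : 0 < r ^ 2) by (apply pow_lt; lra).
  set (y := (- (Cconj b * w0 / (RtoC r * RtoC r)))%C).
  assert (E : refl r b w0 = (RtoC r * (1 + y))%C) by (unfold refl, y; field; auto).
  assert (Hy : Cmod y <= 1 / 2).
  { unfold y. rewrite Cmod_opp, Cmod_div, !Cmod_mult, Cmod_conj, !Cmod_R, Rabs_pos_eq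
      by (try apply Cmult_neq_0; auto; lra).
    replace (r * r) with (r ^ 2) by ring.
    apply Rmult_le_reg_r with (r ^ 2); auto. unfold Rdiv. rewrite Rmult_assoc, Rinv_l by lra.
    assert (Cmod b * Cmod w0 <= A * Cmod w0) by (apply Rmult_le_compat_r; auto). lra. }
  pose proof (Rabs_ln_1_plus y Hy) as Hl.
  assert (H1y : 0 < Cmod (1 + y)).
  { pose proof (Cmod_sub_ge 1 (- y)%C) as Hg. rewrite Cmod_1, Cmod_opp in Hg.
    replace (1 - - y)%C with (1 + y)%C in Hg by ring. lra. }
  unfold gterm. rewrite E, Cmod_mult, Cmod_R, (Rabs_pos_eq r), ln_mult by lra.
  replace (ln r + ln (Cmod (1 + y)) - root_const c rts b - (ln r - lnstar b))
    with (ln (Cmod (1 + y)) + (lnstar b - root_const c rts b)) by ring.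
  eapply Rle_trans; [apply Rabs_triang|]. lra.
Qed.

(** Poles outside |b| <= A are charged to eps times their share of N(r, f); the finitely many others
    are bounded by a constant independent of [r]. *)
Lemma green_diff_small (f : C -> C) (eps : R) : meromorphic f -> 0 < eps ->
  exists K r0, 0 <= K /\ forall L g r r', good_rep f L g r r' -> r0 <= r ->
    Rabs (green_diff c om rts L r) <= K + eps * lsum (fun b => ln r - lnstar b) L.
Proof.
  intros Hf He. pose proof (Cmod_ge_0 w0) as Hw.
  assert (HA0 : 0 <= 8 * Cmod w0 / eps) by (apply Rdiv_le_0_compat; lra).
  (* Beyond [A] the hypothesis of [green_term_far] holds and its factor 8 |w0| / |b| is at most eps;
     the summand 1 keeps [A] positive. *)
  set (A := 1 + 4 * Cmod w0 + 8 * Cmod w0 / eps).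
  destruct (singular_finite f A Hf) as [l Hl]; [unfold A; lra|].
  set (h := fun b => Rabs (lnstar b - root_const c rts b)).
  set (M := 1 + lsum h l).
  assert (HM : 0 <= M).
  { unfold M. assert (0 <= lsum h l); [|lra]. apply lsum_nonneg. intros; apply Rabs_pos. }
  exists (INR (npoles f A) * M), (A + 2 * A * Cmod w0 + 1). split.
  { apply Rmult_le_pos; auto. apply pos_INR. }
  intros L g r r' Hrep Hr.
  assert (HA1 : 1 <= A) by (unfold A; lra).
  assert (HAw : 0 <= 2 * A * Cmod w0) by (repeat apply Rmult_le_pos; lra).
  pose proof Hrep as [Hrr [HR [HL _]]].
  unfold green_diff. eapply Rle_trans; [apply Rabs_lsum|].
  rewrite (rep_npoles f L g r' A HR) by lra. rewrite INR_length_filter.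
  rewrite Rmult_comm, <- lsum_scal, <- lsum_scal, <- lsum_plus. apply lsum_le.
  intros b Hb. destruct (HL b Hb) as [Hbr Hsing].
  assert (Hpos : 0 <= ln r - lnstar b).
  { pose proof (count_term_nonneg r b ltac:(lra)) as Hc. unfold count_term in Hc.
    rewrite Rmax_left in Hc by lra. auto. }
  assert (0 <= eps * (ln r - lnstar b)) by (apply Rmult_le_pos; lra).
  fold w0. destruct (Rle_dec (Cmod b) A) as [HbA|HbA].
  - assert (Hh : h b <= lsum h l) by (apply le_lsum; [intros; apply Rabs_pos|auto]).
    pose proof (green_term_near r A b HbA) as Hn. unfold gterm in Hn. fold (h b) in Hn.
    assert (2 * A * Cmod w0 <= r ^ 2) by (simpl; nra). specialize (Hn H0 ltac:(lra)).
    unfold M. lra.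
  - assert (Hb0 : 0 < Cmod b) by lra.
    pose proof (green_term_far r b) as Hn. unfold gterm in Hn.
    assert (4 * Cmod w0 <= Cmod b) by (unfold A in *; lra).
    specialize (Hn H0 Hb0 Hbr). rewrite Rmult_0_r, Rplus_0_l.
    eapply Rle_trans; [exact Hn|]. apply Rmult_le_compat_r; auto.
    apply Rmult_le_reg_r with (Cmod b); auto.
    replace (8 * (Cmod w0 / Cmod b) * Cmod b) with (8 * Cmod w0) by (field; lra).
    replace (8 * Cmod w0) with (eps * (8 * Cmod w0 / eps)) by (field; lra).
    apply Rmult_le_compat_l; [lra|]. unfold A in HbA. lra.
Qed.
End Green.

(** * Monotonicity of the characteristic, and radii without singular points *)

Lemma root_map_id : root_map 1 1%C (fun z => z) (fun w => w :: nil).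
Proof.
  split; [lia|]. split; [intros E; injection E; lra|]. split; auto.
  intros w z. simpl. ring.
Qed.

(** [T_comp_le] for the identity: the base points coincide, so [green_diff] is 0 and the Harnack
    factor is 1. *)
Lemma T_monotone (f : C -> C) (r s : R) : meromorphic f -> 0 < r < s ->
  (forall z, Cmod z = r -> Cdiff f z) -> (forall z, Cmod z = s -> Cdiff f z) ->
  T f r <= T f s.
Proof.
  intros Hf Hrs Hr Hs. destruct (good_rep_exists f s Hf ltac:(lra) Hs) as [L [g [s' Hrep]]].
  pose proof (T_comp_le 1 1%C (fun z => z) (fun w => w :: nil) root_map_id f L g s s' Hrep r ((r + s) / 2)) as H.
  specialize (H ltac:(lra) (fun z Hz => ltac:(lra)) Hr).
  rewrite (T_good f L g s s' Hrep s) by (auto; lra).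
  replace (green_diff _ _ _ L s) with 0 in H.
  - rewrite Cmod_0 in H. replace ((s + 0) / (s - 0)) with 1 in H by (field; lra).
    rewrite (lsum_ext (count_term s) (fun b => ln s - lnstar b)).
    + change (fun z : C => f z) with f in H. lra.
    + intros b Hb. unfold count_term. rewrite Rmax_left; auto.
      destruct Hrep as [_ [_ [HL _]]]. destruct (HL b Hb). lra.
  - unfold green_diff. rewrite (lsum_ext _ (fun _ => 0)); [rewrite lsum_const; ring|].
    intros b Hb. unfold root_const, refl. rewrite Cmod_1, ln_1. simpl.
    replace (RtoC s - Cconj b / RtoC s * 0)%C with (RtoC s) by ring.
    rewrite Cmod_R, Rabs_pos_eq by lra. ring.
Qed.

Lemma good_lsum_le (f : C -> C) (L : list C) (g : C -> C) (r r' : R) : good_rep f L g r r' -> 1 <= r ->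
  0 <= lsum (fun b => ln r - lnstar b) L /\ 0 <= Rmean (log_circle f r) /\
  Rmean (log_circle f r) + lsum (fun b => ln r - lnstar b) L = T f r.
Proof.
  intros Hrep Hr. pose proof Hrep as [Hrr [_ [HL [_ Hg]]]].
  assert (E : lsum (fun b => ln r - lnstar b) L = lsum (count_term r) L).
  { apply lsum_ext. intros b Hb. unfold count_term. rewrite Rmax_left; auto. destruct (HL b Hb). lra. }
  rewrite E. split; [|split].
  - apply lsum_nonneg. intros; apply count_term_nonneg; auto.
  - apply Rmean_nonneg; [eapply continuous_log_circle_good, Hrep|intros; apply logplus_nonneg].
  - rewrite (T_good f L g r r' Hrep); auto. lra.
Qed.

Lemma interval_avoids (l : list R) (a b : R) : a < b ->
  exists a' b', a <= a' /\ a' < b' /\ b' <= b /\ forall x, In x l -> ~ (a' < x < b').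
Proof.
  revert a b. induction l as [|y l IH]; intros a b Hab.
  - exists a, b. repeat split; try lra. intros x [].
  - destruct (IH a b Hab) as [a' [b' [H1 [H2 [H3 F]]]]].
    destruct (Rlt_dec y b') as [Hy|Hy].
    + exists (Rmax a' y), b'. pose proof (Rmax_l a' y). pose proof (Rmax_r a' y).
      split; [lra|]. split; [apply Rmax_lub_lt; auto|]. split; auto.
      intros x [->|Hx]; [lra|]. intros Hx'. apply (F x Hx). lra.
    + exists a', b'. repeat split; auto. intros x [->|Hx]; [lra|]. auto.
Qed.

Lemma exists_good_radius (f : C -> C) (a b : R) : meromorphic f -> 0 <= a < b ->
  exists r, a < r < b /\ forall z, Cmod z = r -> Cdiff f z.
Proof.
  intros Hf Hab. destruct (singular_finite f b Hf) as [l Hl]; [lra|].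
  destruct (interval_avoids (map Cmod l) a b) as [a' [b' [H1 [H2 [H3 F]]]]]; [lra|].
  exists ((a' + b') / 2). split; [lra|]. intros z Hz. apply NNPP. intros Hs.
  apply (F (Cmod z)); [|lra]. apply in_map, Hl; auto. lra.
Qed.

(** Each disc contains finitely many singular points, each with finitely many preimages; Cantor's
    pairing codes the disc and the position in its list by one index. *)
Lemma bad_radii_countable (n : nat) (c : C) (om : C -> C) (rts : C -> list C) (f : C -> C) :
  root_map n c om rts -> is_poly c n om -> meromorphic f ->
  exists x : nat -> R, forall z, ~ Cdiff f (om z) -> exists k, x k = Cmod z.
Proof.
  intros Hom HP Hf. destruct (is_poly_growth _ _ _ HP) as [K [HK F]].
  (* [B N] bounds |om z| for |z| <= N + 1. *)
  set (B := fun N : nat => (Cmod c * (INR N + 1) ^ n + K * ((INR N + 1) ^ n / (INR N + 1)))).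
  assert (HB : forall N, 0 <= B N).
  { intros N. pose proof (pos_INR N). unfold B.
    assert (0 < (INR N + 1) ^ n) by (apply pow_lt; lra).
    apply Rplus_le_le_0_compat; apply Rmult_le_pos; auto using Cmod_ge_0; try lra.
    apply Rdiv_le_0_compat; lra. }
  assert (Hl : forall N, exists l : list C, forall z, Cmod z <= B N -> ~ Cdiff f z -> In z l)
    by (intros N; apply singular_finite; auto).
  set (l := fun N => epsilon (inhabits nil) (fun l : list C => forall z, Cmod z <= B N -> ~ Cdiff f z -> In z l)).
  assert (Hl' : forall N z, Cmod z <= B N -> ~ Cdiff f z -> In z (l N)).
  { intros N. apply (epsilon_spec (inhabits nil) (fun l : list C => forall z, Cmod z <= B N -> ~ Cdiff f z -> In z l)); auto. }
  exists (fun k => Cmod (nth (snd (Cantor.of_nat k)) (flat_map rts (l (fst (Cantor.of_nat k)))) (RtoC 0))).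
  intros z Hz. destruct (INR_unbounded (Cmod z)) as [N HN].
  assert (Hin : In z (flat_map rts (l N))).
  { apply in_flat_map. exists (om z). split; [|apply (root_map_zero n c om rts Hom); auto].
    apply Hl'; auto. pose proof (pos_INR N).
    specialize (F z (INR N + 1) ltac:(lra) ltac:(lra)). unfold B.
    pose proof (Cmod_triangle (c * z ^ n) (om z - c * z ^ n)) as Ht.
    replace (c * z ^ n + (om z - c * z ^ n))%C with (om z) in Ht by ring.
    rewrite Cmod_mult, Cmod_pow in Ht.
    assert (Cmod c * Cmod z ^ n <= Cmod c * (INR N + 1) ^ n); [|lra].
    apply Rmult_le_compat_l; [apply Cmod_ge_0|]. apply pow_incr. split; [apply Cmod_ge_0|lra]. }
  destruct (In_nth _ _ (RtoC 0) Hin) as [i [_ Hi]].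
  exists (Cantor.to_nat (N, i)). rewrite Cantor.cancel_of_to. simpl. rewrite Hi. auto.
Qed.

(** * Growth and exceptional sets *)

Lemma infinite_sum_of_bounded (s : nat -> R) (B : R) : (forall k, 0 <= s k) ->
  (forall m, sum_f_R0 s m <= B) -> exists l, infinite_sum s l.
Proof.
  intros Hs HB. destruct (growing_cv (sum_f_R0 s)) as [l Hl].
  - intros m. simpl. specialize (Hs (S m)). lra.
  - exists B. intros x [m ->]. apply HB.
  - exists l. exact Hl.
Qed.

Lemma sum_le_of_nonneg (s : nat -> R) (m m' : nat) : (forall k, 0 <= s k) -> (m <= m')%nat ->
  sum_f_R0 s m <= sum_f_R0 s m'.
Proof.
  intros Hs H. induction H as [|m' H IH]; [lra|]. simpl. specialize (Hs (S m')). lra.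
Qed.

Lemma log_ratio_nonneg (a b : R) : 1 <= a <= b -> 0 <= ln (b / a).
Proof.
  intros H. apply ln_ge_0. apply Rmult_le_reg_r with a; [lra|].
  unfold Rdiv. rewrite Rmult_assoc, Rinv_l; lra.
Qed.

Lemma finite_log_measure_union (E1 E2 : R -> Prop) :
  finite_log_measure E1 -> finite_log_measure E2 -> finite_log_measure (fun r => E1 r \/ E2 r).
Proof.
  intros [P1 [a1 [b1 [H1 [C1 [l1 S1]]]]]] [P2 [a2 [b2 [H2 [C2 [l2 S2]]]]]].
  split; [intros x [H|H]; auto|].
  set (mix := fun (u v : nat -> R) k => if Nat.even k then u (Nat.div2 k) else v (Nat.div2 k)).
  assert (Ev : forall u v k, mix u v (2 * k)%nat = u k).
  { intros u v k. unfold mix. rewrite Nat.even_mul, Nat.div2_double. auto. }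
  assert (Od : forall u v k, mix u v (S (2 * k)) = v k).
  { intros u v k. unfold mix. rewrite Nat.even_succ, <- Nat.negb_even, Nat.even_mul.
    rewrite Nat.div2_succ_double. auto. }
  exists (mix a1 a2), (mix b1 b2).
  assert (Hab : forall k, 1 <= mix a1 a2 k <= mix b1 b2 k).
  { intros k. unfold mix. destruct (Nat.even k); auto. }
  split; auto. split.
  - intros x [H|H].
    + destruct (C1 x H) as [k Hk]. exists (2 * k)%nat. rewrite !Ev. auto.
    + destruct (C2 x H) as [k Hk]. exists (S (2 * k)). rewrite !Od. auto.
  - set (s1 := fun k => ln (b1 k / a1 k)). set (s2 := fun k => ln (b2 k / a2 k)).
    assert (N1 : forall k, 0 <= s1 k) by (intros; apply log_ratio_nonneg; auto).
    assert (N2 : forall k, 0 <= s2 k) by (intros; apply log_ratio_nonneg; auto).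
    assert (Nm : forall k, 0 <= ln (mix b1 b2 k / mix a1 a2 k)) by (intros; apply log_ratio_nonneg; auto).
    apply infinite_sum_of_bounded with (B := l1 + l2); auto.
    assert (Hodd : forall m, sum_f_R0 (fun k => ln (mix b1 b2 k / mix a1 a2 k)) (S (2 * m))
      = sum_f_R0 s1 m + sum_f_R0 s2 m).
    { induction m as [|m IH].
      - simpl. unfold mix, s1, s2. simpl. ring.
      - replace (S (2 * S m)) with (S (S (S (2 * m)))) by lia.
        rewrite (tech5 _ (S (S (2 * m)))), (tech5 _ (S (2 * m))), IH.
        replace (S (S (2 * m))) with (2 * S m)%nat by lia.
        rewrite !Od, !Ev. fold (s1 (S m)) (s2 (S m)). rewrite (tech5 s1), (tech5 s2). ring. }
    intros m. eapply Rle_trans; [apply (sum_le_of_nonneg _ m (S (2 * m))); auto; lia|].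
    rewrite Hodd. apply Rplus_le_compat; apply sum_incr; auto.
Qed.

Lemma finite_log_measure_countable (x : nat -> R) :
  finite_log_measure (fun r => 1 <= r /\ exists k, x k = r).
Proof.
  split; [intros r [H _]; auto|].
  exists (fun k => Rmax 1 (x k)), (fun k => Rmax 1 (x k)). split; [|split].
  - intros k. split; [apply Rmax_l|lra].
  - intros r [Hr [k <-]]. exists k. rewrite Rmax_right; lra.
  - apply infinite_sum_of_bounded with (B := 0).
    + intros k. apply log_ratio_nonneg. split; [apply Rmax_l|lra].
    + intros m. right. apply sum_eq_R0. intros k _. pose proof (Rmax_l 1 (x k)).
      rewrite Rdiv_diag, ln_1 by lra. auto.
Qed.

Lemma finite_log_measure_cells (l : R) (bad : nat -> Prop) (B : R) : 1 <= l ->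
  (forall m, sum_f_R0 (fun k => if excluded_middle_informative (bad k) then / (INR k + 1) else 0) m <= B) ->
  finite_log_measure (fun r => exists k, bad k /\ l * (INR k + 2) <= r <= l * (INR k + 3)).
Proof.
  intros Hl HB.
  assert (Hk : forall k, 1 <= l * (INR k + 2)) by (intros k; pose proof (pos_INR k); nra).
  split; [intros r [k [_ Hr]]; specialize (Hk k); lra|].
  exists (fun k => if excluded_middle_informative (bad k) then l * (INR k + 2) else 1),
    (fun k => if excluded_middle_informative (bad k) then l * (INR k + 3) else 1).
  assert (Hab : forall k, 1 <= (if excluded_middle_informative (bad k) then l * (INR k + 2) else 1)
    <= (if excluded_middle_informative (bad k) then l * (INR k + 3) else 1)).
  { intros k. destruct (excluded_middle_informative (bad k)); [|lra]. specialize (Hk k). lra. }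
  split; auto. split.
  - intros r [k [Hbad Hr]]. exists k. destruct (excluded_middle_informative (bad k)); tauto.
  - apply infinite_sum_of_bounded with (B := B); [intros; apply log_ratio_nonneg; auto|].
    intros m. eapply Rle_trans; [|apply (HB m)]. apply sum_Rle. intros k _.
    destruct (excluded_middle_informative (bad k)).
    + pose proof (pos_INR k).
      replace (l * (INR k + 3) / (l * (INR k + 2))) with (1 + / (INR k + 2)) by (field; lra).
      assert (0 < / (INR k + 2)) by (apply Rinv_0_lt_compat; lra).
      pose proof (ln_le_sub_1 (1 + / (INR k + 2)) ltac:(lra)).
      assert (/ (INR k + 2) <= / (INR k + 1)) by (apply Rinv_le_contravar; lra). lra.
    + rewrite Rdiv_diag, ln_1 by lra. lra.
Qed.

(** The right-hand side is the integral of x^(- p) over [a, b], whose integrand is smallest at b.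
    Here it follows from the tangent inequalities of exp and log. *)
Lemma Rpower_diff_le (a b p : R) : 0 < a <= b -> 1 < p ->
  (b - a) * Rpower b (- p) <= (Rpower a (1 - p) - Rpower b (1 - p)) / (p - 1).
Proof.
  intros Hab Hp.
  assert (E1 : Rpower b (1 - p) = b * Rpower b (- p)).
  { replace (1 - p) with (1 + - p) by ring. rewrite Rpower_plus, Rpower_1; lra. }
  assert (E2 : Rpower a (1 - p) = Rpower b (1 - p) * exp ((1 - p) * (ln a - ln b))).
  { unfold Rpower. rewrite <- exp_plus. f_equal. ring. }
  pose proof (exp_ineq1_le ((1 - p) * (ln a - ln b))) as H1.
  assert (H2 : ln a - ln b <= a / b - 1).
  { rewrite <- ln_div by lra. apply ln_le_sub_1. apply Rdiv_lt_0_compat; lra. }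
  assert (H3 : 0 < Rpower b (- p)) by apply exp_pos.
  apply Rmult_le_reg_r with (p - 1); [lra|].
  unfold Rdiv at 1. rewrite Rmult_assoc, Rmult_assoc, Rinv_l, Rmult_1_r by lra.
  rewrite E2, E1. set (x := exp ((1 - p) * (ln a - ln b))) in *.
  assert (H4 : (p - 1) * (1 - a / b) <= x - 1) by nra.
  assert (H5 : b * ((p - 1) * (1 - a / b)) <= b * (x - 1)) by (apply Rmult_le_compat_l; lra).
  replace (b * ((p - 1) * (1 - a / b))) with ((b - a) * (p - 1)) in H5 by (field; lra).
  nra.
Qed.

(* A cell is bad when [L] increases too much across it. With [p > 1] such that
   [1 / (k + 1)] is at most a constant times [(L (k + 4) - L k) / L (k + 4) ^ p]
   on bad cells, the sum over bad cells is bounded by a telescoping sum. *)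
Lemma slow_growth_off_few_cells (L : nat -> R) (M tau : R) : 0 < tau < 1 -> 0 < M ->
  (forall k, 1 <= L k) -> (forall k, L k <= L (S k)) ->
  (forall k, L k <= M * Rpower (INR k + 1) tau) ->
  exists bad : nat -> Prop,
    (forall eps, 0 < eps -> exists K, forall k, (K <= k)%nat -> ~ bad k -> L (k + 4)%nat - L k <= eps) /\
    exists B, forall m,
      sum_f_R0 (fun k => if excluded_middle_informative (bad k) then / (INR k + 1) else 0) m <= B.
Proof.
  intros Htau HM HL1 Hmono HLM.
  (* The jump threshold (k + 1)^(- zeta) tends to 0 since theta < 1, while (k + 1)^(- theta) is at
     most a constant times L(k + 4)^(- p) with p > 1 since theta > tau. The product of the two
     powers of k + 1 is 1 / (k + 1). *)
  set (theta := (1 + tau) / 2). set (p := theta / tau). set (zeta := 1 - theta).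
  assert (Hth : tau < theta < 1) by (unfold theta; lra).
  assert (Hp : 1 < p).
  { unfold p. apply Rmult_lt_reg_r with tau; [lra|]. unfold Rdiv. rewrite Rmult_assoc, Rinv_l; lra. }
  assert (Hz : 0 < zeta) by (unfold zeta; lra).
  exists (fun k => Rpower (INR k + 1) (- zeta) < L (k + 4)%nat - L k). split.
  - intros eps He. destruct (INR_unbounded (Rpower eps (- / zeta))) as [K HK].
    exists K. intros k Hk Hnb. apply Rnot_lt_le in Hnb. eapply Rle_trans; [exact Hnb|].
    apply le_INR in Hk. pose proof (exp_pos (- / zeta * ln eps)) as He'. fold (Rpower eps (- / zeta)) in He'.
    rewrite Rpower_Ropp. replace eps with (/ Rpower (Rpower eps (- / zeta)) zeta).
    + apply Rinv_le_contravar; [apply exp_pos|]. apply Rle_Rpower_l; lra.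
    + rewrite Rpower_mult. replace (- / zeta * zeta) with (- (1)) by (field; lra).
      rewrite Rpower_Ropp, Rpower_1, Rinv_inv; auto.
  (* The factor 5 passes from L (k + 4) to the power of k + 1, by k + 5 <= 5 (k + 1) and tau < 1. *)
  - set (M' := 5 * M). set (Q := Rpower M' p / (p - 1)).
    set (Psi := fun k => Rpower (L k) (1 - p)).
    assert (HQ : 0 <= Q) by (apply Rdiv_le_0_compat; [left; apply exp_pos|lra]).
    assert (Hmono4 : forall k, L k <= L (k + 4)%nat).
    { intros k. replace (k + 4)%nat with (S (S (S (S k)))) by lia.
      pose proof (Hmono k). pose proof (Hmono (S k)). pose proof (Hmono (S (S k))).
      pose proof (Hmono (S (S (S k)))). lra. }
    assert (Hterm : forall k, (L (k + 4)%nat - L k) * Rpower (INR k + 1) (- theta) <= Q * (Psi k - Psi (k + 4)%nat)).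
    { intros k. pose proof (pos_INR k) as Hk0. set (x := INR k + 1).
      assert (Hx : 1 <= x) by (unfold x; lra).
      set (L4 := L (k + 4)%nat).
      assert (H4 : 1 <= L4) by apply HL1.
      assert (HL4 : L4 <= M' * Rpower x tau).
      { eapply Rle_trans; [apply HLM|]. unfold M'. rewrite (Rmult_comm 5), Rmult_assoc.
        apply Rmult_le_compat_l; [lra|].
        apply Rle_trans with (Rpower (5 * x) tau).
        - apply Rle_Rpower_l; [lra|]. rewrite plus_INR. simpl. unfold x. lra.
        - rewrite <- Rpower_mult_distr by lra. apply Rmult_le_compat_r; [left; apply exp_pos|].
          rewrite <- (Rpower_1 5) at 2 by lra. apply Rle_Rpower; lra. }
      assert (Hpow : Rpower x (- theta) <= Rpower M' p * Rpower L4 (- p)).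
      { assert (Hln : ln L4 <= ln M' + tau * ln x).
        { rewrite <- (ln_exp (tau * ln x)), <- ln_mult.
          - apply ln_le_mono; [lra|exact HL4].
          - unfold M'. lra.
          - apply exp_pos. }
        unfold Rpower. rewrite <- exp_plus. apply exp_le_mono.
        assert (Ep : theta = p * tau) by (unfold p; field; lra).
        assert (p * ln L4 <= p * (ln M' + tau * ln x)) by (apply Rmult_le_compat_l; lra).
        rewrite Ep. lra. }
      pose proof (Rpower_diff_le (L k) L4 p) as HD.
      specialize (HD (conj (Rlt_le_trans _ _ _ Rlt_0_1 (HL1 k)) (Hmono4 k)) Hp).
      assert (0 <= L4 - L k) by (pose proof (Hmono4 k); unfold L4; lra).
      apply Rle_trans with ((L4 - L k) * (Rpower M' p * Rpower L4 (- p))).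
      - apply Rmult_le_compat_l; auto.
      - replace ((L4 - L k) * (Rpower M' p * Rpower L4 (- p)))
          with (Rpower M' p * ((L4 - L k) * Rpower L4 (- p))) by ring.
        unfold Q, Psi. fold L4.
        replace (Rpower M' p / (p - 1) * (Rpower (L k) (1 - p) - Rpower L4 (1 - p)))
          with (Rpower M' p * ((Rpower (L k) (1 - p) - Rpower L4 (1 - p)) / (p - 1))) by (field; lra).
        apply Rmult_le_compat_l; auto. left; apply exp_pos. }
    (* Differences over four steps telescope once four consecutive values are summed. *)
    set (Phi := fun k => Psi k + Psi (k + 1)%nat + Psi (k + 2)%nat + Psi (k + 3)%nat).
    exists (Q * Phi O). intros m.
    assert (Hsum : forall m, sum_f_R0 (fun k => if excluded_middle_informative
        (Rpower (INR k + 1) (- zeta) < L (k + 4)%nat - L k) then / (INR k + 1) else 0) m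
        <= Q * (Phi O - Phi (S m))).
    { assert (Hk : forall k, (if excluded_middle_informative
        (Rpower (INR k + 1) (- zeta) < L (k + 4)%nat - L k) then / (INR k + 1) else 0)
        <= Q * (Phi k - Phi (S k))).
      { intros k. replace (Phi k - Phi (S k)) with (Psi k - Psi (k + 4)%nat).
        2: { unfold Phi. replace (S k + 1)%nat with (k + 2)%nat by lia.
             replace (S k + 2)%nat with (k + 3)%nat by lia. replace (S k + 3)%nat with (k + 4)%nat by lia.
             replace (S k) with (k + 1)%nat by lia. ring. }
        eapply Rle_trans; [|apply Hterm]. pose proof (pos_INR k).
        destruct (excluded_middle_informative _) as [Hb|Hb].
        - replace (/ (INR k + 1)) with (Rpower (INR k + 1) (- zeta) * Rpower (INR k + 1) (- theta)).
          + apply Rmult_le_compat_r; [left; apply exp_pos|lra].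
          + rewrite <- Rpower_plus. unfold zeta. replace (- (1 - theta) + - theta) with (- (1)) by ring.
            rewrite Rpower_Ropp, Rpower_1; lra.
        - apply Rmult_le_pos; [pose proof (Hmono4 k); lra|left; apply exp_pos]. }
      intros m'. induction m' as [|m' IH].
      - apply (Hk O).
      - rewrite tech5. specialize (Hk (S m')). lra. }
    eapply Rle_trans; [apply Hsum|]. apply Rmult_le_compat_l; auto.
    assert (0 < Phi (S m)).
    { unfold Phi, Psi. repeat apply Rplus_lt_0_compat; apply exp_pos. }
    lra.
Qed.

(** The lower coefficients of a polynomial cost only (|c| x + K) x^(n - 1); shifting a single factor
    absorbs them, and the full power is larger still. *)
Lemma pow_shift_ge (x u : R) (m : nat) : 0 <= x -> 0 <= u -> (1 <= m)%nat ->
  (x + u) * x ^ (m - 1) <= (x + u) ^ m.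
Proof.
  intros Hx Hu Hm. destruct m as [|m]; [lia|]. simpl. rewrite Nat.sub_0_r.
  apply Rmult_le_compat_l; [lra|]. apply pow_incr. lra.
Qed.

Lemma is_poly_bounds (n : nat) (c : C) (om : C -> C) : (1 <= n)%nat -> is_poly c n om ->
  exists K, 0 <= K /\
    (forall z x, 1 <= x -> Cmod z <= x -> Cmod (om z) <= (Cmod c * x + K) * x ^ (n - 1)) /\
    (forall z x, 1 <= x -> K <= Cmod c * x -> x <= Cmod z ->
       (Cmod c * x - K) * x ^ (n - 1) <= Cmod (om z)).
Proof.
  intros Hn HP. destruct (is_poly_growth _ _ _ HP) as [K [HK F]]. exists K.
  pose proof (Cmod_ge_0 c) as Hc.
  assert (E : forall x, 1 <= x -> x ^ n / x = x ^ (n - 1) /\ x ^ n = x * x ^ (n - 1)).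
  { intros x Hx. destruct n as [|m]; [lia|]. simpl. rewrite Nat.sub_0_r. split; [field; lra|auto]. }
  split; auto. split.
  - intros z x Hx Hz. specialize (F z x Hx Hz). destruct (E x Hx) as [E1 E2]. rewrite E1 in F.
    pose proof (Cmod_triangle (c * z ^ n) (om z - c * z ^ n)) as Ht.
    replace (c * z ^ n + (om z - c * z ^ n))%C with (om z) in Ht by ring.
    rewrite Cmod_mult, Cmod_pow in Ht.
    assert (Cmod c * Cmod z ^ n <= Cmod c * x ^ n).
    { apply Rmult_le_compat_l; auto. apply pow_incr. split; [apply Cmod_ge_0|auto]. }
    rewrite E2 in H. lra.
  - intros z x Hx HKx Hz. assert (Hz1 : 1 <= Cmod z) by lra.
    specialize (F z (Cmod z) Hz1 (Rle_refl _)). destruct (E _ Hz1) as [E1 E2]. rewrite E1 in F.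
    pose proof (Cmod_sub_ge (c * z ^ n) (c * z ^ n - om z)) as Ht.
    replace (c * z ^ n - (c * z ^ n - om z))%C with (om z) in Ht by ring.
    rewrite (Cmod_minus_sym _ (om z)), Cmod_mult, Cmod_pow, E2 in Ht.
    apply Rle_trans with ((Cmod c * Cmod z - K) * Cmod z ^ (n - 1)); [|lra].
    assert (Cmod c * x <= Cmod c * Cmod z) by (apply Rmult_le_compat_l; lra).
    apply Rmult_le_compat; try lra; [apply pow_le; lra|apply pow_incr; lra].
Qed.

Lemma comp_estimate (n : nat) (c : C) (om : C -> C) (rts : C -> list C) (f : C -> C) :
  root_map n c om rts -> is_poly c n om -> meromorphic f ->
  exists l, 1 <= l /\ forall eps, 0 < eps <= 1 -> exists K r0, 0 <= K /\ l <= r0 /\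
    forall r rho R1, r0 <= r -> 0 < rho <= Cmod c * (r - l) ^ n -> Cmod c * (r + l) ^ n <= R1 ->
      (forall z, Cmod z = rho -> Cdiff f z) -> (forall z, Cmod z = R1 -> Cdiff f z) ->
      (forall z, Cmod z = r -> Cdiff f (om z)) ->
      T (fun z => f (om z)) r <= (1 + 2 * eps) * T f R1 + K /\
      T f rho <= (1 + eps) * T (fun z => f (om z)) r + 4 * eps * T f R1 + 2 * K.
Proof.
  intros Hom HP Hf. pose proof Hom as [Hn [Hc0 _]]. pose proof (Cmod_pos _ Hc0) as Hc.
  destruct (is_poly_bounds n c om Hn HP) as [B [HB [Bup Blow]]].
  assert (HBc : 0 <= B / Cmod c) by (apply Rdiv_le_0_compat; lra).
  assert (EBc : Cmod c * (B / Cmod c) = B) by (field; lra).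
  (* B / |c| absorbs the lower coefficients, one unit the enlarged radius r + 1 on which the
     comparison lemmas work, and the last one makes the inequalities strict. *)
  exists (2 + B / Cmod c). split; [lra|]. intros eps He.
  destruct (green_diff_small n c om rts Hom f eps Hf ltac:(lra)) as [K [r1 [HK HG]]].
  set (w := Cmod (om 0%C)). pose proof (Cmod_ge_0 (om 0%C)) as Hw. fold w in Hw.
  set (Z := lsum Cmod (rts 0%C)).
  assert (HZ : forall z, In z (rts 0%C) -> Cmod z <= Z).
  { intros z Hz. apply le_lsum; auto. intros; apply Cmod_ge_0. }
  assert (HZ0 : 0 <= Z) by (apply lsum_nonneg; intros; apply Cmod_ge_0).
  assert (Hwe : 0 <= 2 * w / eps) by (apply Rdiv_le_0_compat; lra).
  assert (HZe : 0 <= 2 * Z / eps) by (apply Rdiv_le_0_compat; lra).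
  (* R1 >= X makes [green_diff_small] applicable and brings the Harnack factor (R1 + w) / (R1 - w)
     below 1 + eps. *)
  set (X := Rabs r1 + 1 + w + 2 * w / eps).
  assert (HX : 0 < X) by (pose proof (Rabs_pos r1); unfold X; lra).
  assert (HXc : 0 < X / Cmod c) by (apply Rdiv_lt_0_compat; auto).
  (* The terms with [Z] bring (r + Z) / (r - Z) below 1 + eps, and X / |c| ensures R1 >= X. *)
  exists K, (2 + B / Cmod c + (Z + 1 + 2 * Z / eps) + X / Cmod c).
  split; auto. split; [lra|].
  intros r rho R1 Hr Hs1 Hs2 Hg1 Hg2 Hgr.
  assert (Hpow : forall x, 1 <= x -> x <= x ^ n).
  { intros x Hx. rewrite <- (pow_1 x) at 1. apply Rle_pow; auto. }
  assert (HR1X : X <= R1).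
  { replace X with (Cmod c * (X / Cmod c)) by (field; lra). eapply Rle_trans; [|exact Hs2].
    apply Rmult_le_compat_l; [lra|]. pose proof (Hpow (r + (2 + B / Cmod c)) ltac:(lra)). lra. }
  assert (HR11 : 1 <= R1) by (pose proof (Rabs_pos r1); unfold X in HR1X; lra).
  assert (Hs2n : (r + 1 + (B / Cmod c + 1)) ^ n <= (r + (2 + B / Cmod c)) ^ n) by (apply pow_incr; lra).
  assert (Hmax : forall z, Cmod z <= r + 1 -> Cmod (om z) < R1).
  { intros z Hz. eapply Rle_lt_trans; [apply (Bup z (r + 1)); auto; lra|].
    pose proof (pow_shift_ge (r + 1) (B / Cmod c + 1) n ltac:(lra) ltac:(lra) Hn) as Hsh.
    assert (Hp : 0 < (r + 1) ^ (n - 1)) by (apply pow_lt; lra).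
    apply Rlt_le_trans with (Cmod c * ((r + 1 + (B / Cmod c + 1)) * (r + 1) ^ (n - 1))).
    - rewrite <- Rmult_assoc. apply Rmult_lt_compat_r; auto. lra.
    - eapply Rle_trans; [|exact Hs2]. apply Rmult_le_compat_l; lra. }
  set (rho' := (Cmod c * r - B) * r ^ (n - 1)).
  assert (HBr : B <= Cmod c * r).
  { rewrite <- EBc. apply Rmult_le_compat_l; lra. }
  assert (Hmin : forall z, r <= Cmod z -> rho' <= Cmod (om z)).
  { intros z Hz. apply Blow; auto. lra. }
  assert (Hrho : 0 < rho < rho').
  { split; [lra|].
    assert (Hsn : (r - (2 + B / Cmod c)) ^ n <= (r - (2 + B / Cmod c)) * r ^ (n - 1)).
    { destruct n as [|m]; [lia|]. simpl. rewrite Nat.sub_0_r.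
      apply Rmult_le_compat; try lra; [apply pow_le; lra|apply pow_incr; lra]. }
    assert (Hp : 0 < r ^ (n - 1)) by (apply pow_lt; lra).
    apply Rle_lt_trans with (Cmod c * ((r - (2 + B / Cmod c)) * r ^ (n - 1))).
    - eapply Rle_trans; [apply Hs1|]. apply Rmult_le_compat_l; lra.
    - unfold rho'. rewrite <- Rmult_assoc. apply Rmult_lt_compat_r; auto. lra. }
  destruct (good_rep_exists f R1 Hf ltac:(lra) Hg2) as [L [g [R1' Hrep]]].
  destruct (good_lsum_le f L g R1 R1' Hrep HR11) as [HN [Hm ET]].
  pose proof (HG L g R1 R1' Hrep) as HD.
  specialize (HD ltac:(pose proof (Rle_abs r1); unfold X in HR1X; lra)).
  set (N := lsum (fun b => ln R1 - lnstar b) L) in *.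
  pose proof (T_comp_le n c om rts Hom f L g R1 R1' Hrep r (r + 1) ltac:(lra) Hmax Hgr) as HU.
  pose proof (T_comp_ge n c om rts Hom f L g R1 R1' Hrep r (r + 1) ltac:(lra) Hmax Hgr
    rho rho' Z Hrho Hmin Hg1 ltac:(lra) HZ ltac:(lra)) as HL.
  pose proof (green_diff_lower_bound n c om rts Hom f L g R1 R1' Hrep r (r + 1) ltac:(lra) Hmax Hgr ltac:(lra)) as [HB0 HB1].
  pose proof (T_comp_eq n c om rts Hom f L g R1 R1' Hrep r (r + 1) ltac:(lra) Hmax Hgr) as HTF.
  fold w in HU. fold N in HU, HL, HB1.
  set (D := green_diff c om rts L R1) in *. set (m := Rmean (log_circle f R1)) in *.
  set (TF := T (fun z : C => f (om z)) r) in *.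
  change (T (fun z : Cx => f (om z)) r) with TF.
  assert (HTF0 : 0 <= TF).
  { rewrite HTF. apply Rplus_le_le_0_compat.
    - apply Rmean_nonneg; [|intros; apply logplus_nonneg].
      apply continuous_log_circle; [lra|]. intros z Hz. apply Cdiff_ccont.
      apply (Cdiff_comp f om); [eapply root_map_Cdiff, Hom|auto].
    - apply lsum_nonneg. intros; apply count_term_nonneg. lra. }
  apply Rabs_le_between in HD.
  assert (Hkap : (R1 + w) / (R1 - w) <= 1 + eps).
  { assert (HwR : w + 2 * w / eps + 1 <= R1) by (pose proof (Rabs_pos r1); unfold X in HR1X; lra).
    apply Rmult_le_reg_r with (R1 - w); [lra|]. unfold Rdiv. rewrite Rmult_assoc, Rinv_l by lra.
    assert (eps * (2 * w / eps) = 2 * w) by (field; lra).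
    assert (eps * (2 * w / eps) <= eps * (R1 - w)) by (apply Rmult_le_compat_l; lra). lra. }
  assert (Hq : (r + Z) / (r - Z) <= 1 + eps).
  { apply Rmult_le_reg_r with (r - Z); [lra|]. unfold Rdiv. rewrite Rmult_assoc, Rinv_l by lra.
    assert (eps * (2 * Z / eps) = 2 * Z) by (field; lra).
    assert (eps * (2 * Z / eps) <= eps * (r - Z)) by (apply Rmult_le_compat_l; lra). lra. }
  assert (Hq' : 1 - (r - Z) / (r + Z) <= eps).
  { apply Rmult_le_reg_r with (r + Z); [lra|]. unfold Rdiv.
    replace ((1 - (r - Z) * / (r + Z)) * (r + Z)) with (2 * Z) by (field; lra).
    assert (eps * (2 * Z / eps) = 2 * Z) by (field; lra).
    assert (eps * (2 * Z / eps) <= eps * (r + Z)) by (apply Rmult_le_compat_l; lra). lra. }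
  rewrite <- ET.
  assert ((R1 + w) / (R1 - w) * m <= (1 + eps) * m) by (apply Rmult_le_compat_r; auto).
  assert ((r + Z) / (r - Z) * TF <= (1 + eps) * TF) by (apply Rmult_le_compat_r; auto).
  assert ((1 - (r - Z) / (r + Z)) * (N + D) <= eps * (N + D)) by (apply Rmult_le_compat_r; lra).
  assert (0 <= eps * m) by (apply Rmult_le_pos; lra).
  assert (0 <= eps * N) by (apply Rmult_le_pos; lra).
  assert (eps * D <= eps * (K + eps * N)) by (apply Rmult_le_compat_l; lra).
  assert (eps * (eps * N) <= 1 * (eps * N)) by (apply Rmult_le_compat_r; lra).
  assert (eps * K <= 1 * K) by (apply Rmult_le_compat_r; lra).
  split; lra.
Qed.

(** * The case of bounded characteristic *)

Lemma T_bounded_no_poles (f : C -> C) (M : R) : meromorphic f ->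
  (forall r0, exists r, r0 <= r /\ (forall z, Cmod z = r -> Cdiff f z) /\ T f r <= M) ->
  forall a k, ~ is_pole f a k.
Proof.
  intros Hf HM a k Hp.
  (* At this radius the pole [a] alone contributes at least M + 1 to the counting function. *)
  destruct (HM (1 + Cmod a + exp (M + lnstar a + 1))) as [r [Hr [Hg HT]]].
  pose proof (Cmod_ge_0 a). pose proof (exp_pos (M + lnstar a + 1)).
  destruct (good_rep_exists f r Hf ltac:(lra) Hg) as [L [g [r' Hrep]]].
  pose proof Hrep as [Hrr [HR _]].
  assert (Ha : In a L) by (apply (rep_pole_In f L g r' a k HR); auto; lra).
  rewrite (T_good f L g r r' Hrep) in HT by (auto; lra).
  assert (H1 : 0 <= Rmean (log_circle f r)).
  { apply Rmean_nonneg; [eapply continuous_log_circle_good, Hrep|intros; apply logplus_nonneg]. }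
  pose proof (le_lsum (count_term r) L a (fun b => count_term_nonneg r b ltac:(lra)) Ha) as H2.
  unfold count_term at 1 in H2. rewrite Rmax_left in H2 by lra.
  assert (M + lnstar a + 1 <= ln r) by (rewrite <- (ln_exp (M + lnstar a + 1)); apply ln_le_mono; lra).
  lra.
Qed.

(* Poisson-Jensen bounds [|f|] on large circles, and then Liouville applies. *)
Lemma T_bounded_constant (f : C -> C) (M : R) : meromorphic f ->
  (forall r0, exists r, r0 <= r /\ (forall z, Cmod z = r -> Cdiff f z) /\ T f r <= M) ->
  forall w w', Cdiff f w -> Cdiff f w' -> f w = f w'.
Proof.
  intros Hf HM w w' Hw Hw'.
  pose proof (T_bounded_no_poles f M Hf HM) as Hnp.
  apply Cminus_eq_0, Cmod_eq_0, Rle_antisym; [|apply Cmod_ge_0].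
  (* The Harnack factor is at most 3 on the circle of radius s <= r / 2 used below. *)
  apply le_all_eps_0. intros eps He. set (B := exp (3 * M)).
  assert (HB : 0 < B) by apply exp_pos.
  pose proof (Cmod_ge_0 w). pose proof (Cmod_ge_0 w').
  set (Q := (Cmod w + Cmod w') * (2 * B)).
  assert (HQ : 0 <= Q / eps) by (apply Rdiv_le_0_compat; auto; unfold Q; apply Rmult_le_pos; lra).
  (* Since s > r / 4, both points lie inside |z| < s, and the final bound Q / s is at most eps. *)
  destruct (HM (4 * (1 + Cmod w + Cmod w' + Q / eps))) as [r [Hr [Hg HT]]].
  destruct (good_rep_exists f r Hf ltac:(lra) Hg) as [L [g [r' Hrep]]].
  pose proof Hrep as [Hrr [HR [HL [HgL _]]]].
  assert (HLn : L = nil).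
  { destruct L as [|b L]; auto. exfalso. destruct (HL b (or_introl eq_refl)) as [Hb _].
    apply (Hnp b (count_occ Cx_eq_dec (b :: L) b)).
    apply (rep_is_pole f (b :: L) g r' b HR); [lra|simpl; auto]. }
  subst L. pose proof HR as [HgD _].
  assert (Efg : forall z, Cmod z <= r -> Cdiff f z -> g z = f z).
  { intros z Hz HD. rewrite HgL by auto. simpl. ring. }
  assert (HT' : Rmean (log_circle f r) <= M).
  { rewrite (T_good f nil g r r' Hrep) in HT by (auto; lra). simpl in HT. lra. }
  assert (HT0 : 0 <= Rmean (log_circle f r)).
  { apply Rmean_nonneg; [eapply continuous_log_circle_good, Hrep|intros; apply logplus_nonneg]. }
  destruct (exists_good_radius f (r / 4) (r / 2) Hf) as [s [Hs Hgs]]; [lra|].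
  assert (Hbd : forall z, Cmod z = s -> Cmod (g z) <= B).
  { intros z Hz. rewrite Efg by (auto; lra).
    eapply Rle_trans; [apply le_exp_logplus|]. apply exp_le_mono.
    eapply Rle_trans; [apply (poisson_jensen f nil g r r' Hrep); auto; lra|].
    simpl. rewrite Rminus_diag, Rplus_0_r.
    eapply Rle_trans; [apply poisson_harnack; [lra|eapply continuous_log_circle_good, Hrep|intros; apply logplus_nonneg]|].
    rewrite Hz. apply Rmult_le_compat; auto.
    - apply Rdiv_le_0_compat; lra.
    - apply Rmult_le_reg_r with (r - s); [lra|]. unfold Rdiv. rewrite Rmult_assoc, Rinv_l; lra. }
  assert (Hbd' : forall z, Cmod z < s -> Cmod (g z) <= B).
  { intros z Hz. apply (maximum_modulus g s); auto.
    - intros v Hv. apply HgD. lra.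
    - intros th. apply Hbd, Cmod_circ. lra. }
  destruct (divide_out_0 g r) as [g1 [Hg1 Eg1]]; [lra|intros; apply HgD; lra|].
  assert (Hg1b : forall z, Cmod z < s -> Cmod (g1 z) <= 2 * B / s).
  { intros z Hz. apply (maximum_modulus g1 s); auto.
    - intros v Hv. apply Hg1. lra.
    - intros th. assert (Hm : Cmod (circ s th) = s) by (apply Cmod_circ; lra).
      specialize (Eg1 (circ s th) ltac:(lra)).
      pose proof (Cmod_sub_le (g (circ s th)) (g 0%C)) as Ht.
      replace (g (circ s th) - g 0)%C with (circ s th * g1 (circ s th))%C in Ht by (rewrite Eg1; ring).
      rewrite Cmod_mult, Hm in Ht. pose proof (Hbd _ Hm).
      pose proof (Hbd' 0%C ltac:(rewrite Cmod_0; lra)).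
      apply Rmult_le_reg_r with s; [lra|]. unfold Rdiv. rewrite Rmult_assoc, Rinv_l by lra. lra. }
  rewrite <- (Efg w), <- (Efg w') by (auto; lra).
  rewrite (Eg1 w), (Eg1 w') by lra.
  replace (g 0 + w * g1 w - (g 0 + w' * g1 w'))%C with (w * g1 w - w' * g1 w')%C by ring.
  eapply Rle_trans; [apply Cmod_sub_le|]. rewrite !Cmod_mult.
  apply Rle_trans with (Q / s).
  - replace (Q / s) with (Cmod w * (2 * B / s) + Cmod w' * (2 * B / s)) by (unfold Q; field; lra).
    apply Rplus_le_compat; apply Rmult_le_compat_l; auto; apply Hg1b; lra.
  - apply Rmult_le_reg_r with s; [lra|]. unfold Rdiv at 1. rewrite Rmult_assoc, Rinv_l, Rmult_1_r by lra.
    replace Q with (eps * (Q / eps)) by (field; lra). apply Rmult_le_compat_l; lra.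
Qed.

(** Settles the case in which the additive constant of [comp_estimate] cannot be absorbed: there are
    no poles and all regular points have the same value, so both sides are means of one constant. *)
Lemma T_bounded_eq (n : nat) (c : C) (om : C -> C) (rts : C -> list C) (f : C -> C) (M r s : R) :
  root_map n c om rts -> is_poly c n om -> meromorphic f ->
  (forall r0, exists r, r0 <= r /\ (forall z, Cmod z = r -> Cdiff f z) /\ T f r <= M) ->
  0 < r -> 0 < s -> (forall z, Cmod z = r -> Cdiff f (om z)) ->
  (forall z, Cmod z = s -> Cdiff f z) -> T (fun z => f (om z)) r = T f s.
Proof.
  intros Hom HP Hf HM Hr Hs Hgr Hgs. pose proof Hom as [Hn _].
  pose proof (T_bounded_no_poles f M Hf HM) as Hnp.
  pose proof (T_bounded_constant f M Hf HM) as Hconst.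
  destruct (is_poly_bounds n c om Hn HP) as [B [HB [Bup _]]].
  set (X := (Cmod c * (r + 2) + B) * (r + 2) ^ (n - 1)).
  assert (HX : 0 <= X).
  { apply Rmult_le_pos; [|apply pow_le; lra]. pose proof (Cmod_ge_0 c).
    assert (0 <= Cmod c * (r + 2)) by (apply Rmult_le_pos; lra). lra. }
  destruct (HM (X + s + 1)) as [R [HR [HgR _]]].
  destruct (good_rep_exists f R Hf ltac:(lra) HgR) as [L [g [R' Hrep]]].
  pose proof Hrep as [HRR [Hre [HL _]]].
  assert (HLn : L = nil).
  { destruct L as [|b L]; auto. exfalso. destruct (HL b (or_introl eq_refl)) as [Hb _].
    apply (Hnp b (count_occ Cx_eq_dec (b :: L) b)).
    apply (rep_is_pole f (b :: L) g R' b Hre); [lra|simpl; auto]. }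
  subst L.
  assert (Hmax : forall z, Cmod z <= r + 1 -> Cmod (om z) < R).
  { intros z Hz. pose proof (Bup z (r + 2) ltac:(lra) ltac:(lra)). fold X in H. lra. }
  change (T (fun z : C => f (om z)) r = T f s).
  rewrite (T_comp_eq n c om rts Hom f nil g R R' Hrep r (r + 1)) by (auto; lra).
  rewrite (T_good f nil g R R' Hrep s) by (auto; lra).
  simpl. f_equal. apply Rmean_ext. intros th. unfold log_circle. do 2 f_equal.
  apply Hconst; [apply Hgr|apply Hgs]; apply Cmod_circ; lra.
Qed.

Lemma pow_inj_pos (n : nat) (x y : R) : (1 <= n)%nat -> 0 <= x -> 0 <= y -> x ^ n = y ^ n -> x = y.
Proof.
  intros Hn.
  assert (Hlt : forall x y, 0 <= x < y -> x ^ n < y ^ n).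
  { intros u v Huv. destruct n as [|m]; [lia|]. simpl.
    assert (u ^ m <= v ^ m) by (apply pow_incr; lra).
    assert (0 < v ^ m) by (apply pow_lt; lra).
    apply Rle_lt_trans with (u * v ^ m); [apply Rmult_le_compat_l; lra|].
    apply Rmult_lt_compat_r; lra. }
  intros Hx Hy E. destruct (Rtotal_order x y) as [H|[H|H]]; auto; exfalso.
  - specialize (Hlt x y ltac:(lra)). lra.
  - specialize (Hlt y x ltac:(lra)). lra.
Qed.

(** The radii whose circle |w| = |c| r^n meets a singular point are the bad radii of the monomial c
    z^n, so the result for polynomials is applied to it. *)
Lemma monomial_bad_radii (n : nat) (c : C) (f : C -> C) : (1 <= n)%nat -> c <> 0%C -> meromorphic f ->
  exists y : nat -> R, forall r, 0 <= r -> (forall k, y k <> r) ->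
    forall z, Cmod z = Cmod c * r ^ n -> Cdiff f z.
Proof.
  intros Hn Hc Hf. set (om := omega n c (fun _ => RtoC 0)).
  assert (Eom : forall z, Cmod (om z) = Cmod c * Cmod z ^ n).
  { intros z. assert (E0 : forall m, lower_sum (fun _ => RtoC 0) z m = RtoC 0).
    { induction m as [|m IH]; auto. simpl lower_sum. rewrite IH.
      change ((0 + 0 * Defs.Cpow z m)%C = 0%C). ring. }
    unfold om, omega. rewrite E0, Cpow_eq.
    change (Cmod (c * z ^ n + 0)%C = Cmod c * Cmod z ^ n).
    rewrite Cplus_0_r, Cmod_mult, Cmod_pow. auto. }
  pose proof (omega_is_poly n c (fun _ => RtoC 0)) as HP. fold om in HP.
  destruct (root_map_exists n c om Hn Hc HP) as [rts Hom].
  destruct (bad_radii_countable n c om rts f Hom HP Hf) as [y Hy].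
  exists y. intros r Hr Hk w Hw. apply NNPP. intros Hs.
  pose proof Hom as [_ [_ [Hlen _]]].
  assert (Hz : exists z, In z (rts w)).
  { destruct (rts w) as [|z l] eqn:E; [|exists z; simpl; auto].
    specialize (Hlen w). rewrite E in Hlen. simpl in Hlen. lia. }
  destruct Hz as [z Hz]. apply (root_map_zero n c om rts Hom) in Hz.
  destruct (Hy z) as [k Hkz]; [rewrite Hz; auto|]. apply (Hk k). rewrite Hkz.
  apply (pow_inj_pos n); auto; [apply Cmod_ge_0|].
  apply Rmult_eq_reg_l with (Cmod c); [|pose proof (Cmod_pos _ Hc); lra].
  rewrite <- Eom, Hz. auto.
Qed.

Lemma T_nonneg (f : C -> C) (r : R) : meromorphic f -> 1 <= r ->
  (forall z, Cmod z = r -> Cdiff f z) -> 0 <= T f r.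
Proof.
  intros Hf Hr Hg. destruct (good_rep_exists f r Hf ltac:(lra) Hg) as [L [g [r' Hrep]]].
  destruct (good_lsum_le f L g r r' Hrep Hr) as [H1 [H2 H3]]. lra.
Qed.

Lemma hyperorder_bound (t rho sigma : R) : exp 1 <= t -> exp 1 <= rho ->
  ln (ln t) / ln rho <= sigma -> ln t <= exp (sigma * ln rho).
Proof.
  intros Ht Hrho H.
  assert (H1 : 1 <= ln t) by (rewrite <- (ln_exp 1); apply ln_le_mono; [apply exp_pos|auto]).
  assert (H2 : 1 <= ln rho) by (rewrite <- (ln_exp 1); apply ln_le_mono; [apply exp_pos|auto]).
  rewrite <- (exp_ln (ln t)) by lra. apply exp_le_mono.
  replace (ln (ln t)) with (ln (ln t) / ln rho * ln rho) by (field; lra).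
  apply Rmult_le_compat_r; lra.
Qed.

(** The nodes discretise |c| r^n at steps of length [l] in r, on regular circles only, so that
    [T_monotone] applies between them. The maximum with exp 1 makes the logarithm at least 1, as
    [slow_growth_off_few_cells] requires. *)
Lemma exists_nodes (n : nat) (c : C) (f : C -> C) (l sigma R0 : R) :
  (1 <= n)%nat -> c <> 0%C -> meromorphic f -> 1 <= l -> 0 < sigma -> INR n * sigma < 1 ->
  (forall r, R0 <= r -> ln (ln (T f r)) / ln r <= sigma) ->
  exists rho : nat -> R,
    (forall k, Cmod c * (l * INR k) ^ n < rho k < Cmod c * (l * (INR k + 1)) ^ n) /\
    (forall k z, Cmod z = rho k -> Cdiff f z) /\
    (forall k, T f (rho k) <= T f (rho (S k))) /\
    exists M, 0 < M /\
      forall k, ln (Rmax (exp 1) (T f (rho k))) <= M * Rpower (INR k + 1) (INR n * sigma).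
Proof.
  intros Hn Hc Hf Hl Hs Htau HT. pose proof (Cmod_pos _ Hc) as Hc0.
  assert (Hex : forall k, exists r, (Cmod c * (l * INR k) ^ n < r < Cmod c * (l * (INR k + 1)) ^ n)
    /\ forall z, Cmod z = r -> Cdiff f z).
  { intros k. apply exists_good_radius; auto. pose proof (pos_INR k).
    assert (H0 : 0 <= l * INR k) by (apply Rmult_le_pos; lra).
    split; [apply Rmult_le_pos; [lra|apply pow_le; auto]|].
    apply Rmult_lt_compat_l; auto.
    destruct n as [|m]; [lia|]. simpl.
    assert ((l * INR k) ^ m <= (l * (INR k + 1)) ^ m) by (apply pow_incr; lra).
    assert (0 < (l * (INR k + 1)) ^ m) by (apply pow_lt; nra).
    apply Rle_lt_trans with (l * INR k * (l * (INR k + 1)) ^ m).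
    - apply Rmult_le_compat_l; auto.
    - apply Rmult_lt_compat_r; lra. }
  set (rho := fun k => epsilon (inhabits 0) (fun r => (Cmod c * (l * INR k) ^ n < r < Cmod c * (l * (INR k + 1)) ^ n)
    /\ forall z, Cmod z = r -> Cdiff f z)).
  assert (Hrho : forall k, (Cmod c * (l * INR k) ^ n < rho k < Cmod c * (l * (INR k + 1)) ^ n)
    /\ forall z, Cmod z = rho k -> Cdiff f z).
  { intros k. apply (epsilon_spec (inhabits 0) (fun r => (Cmod c * (l * INR k) ^ n < r < Cmod c * (l * (INR k + 1)) ^ n)
    /\ forall z, Cmod z = r -> Cdiff f z)). auto. }
  assert (Hmono : forall k, T f (rho k) <= T f (rho (S k))).
  { intros k. destruct (Hrho k) as [H1 G1]. destruct (Hrho (S k)) as [H2 G2].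
    apply T_monotone; auto. rewrite S_INR in H2.
    assert (0 <= (l * INR k) ^ n) by (apply pow_le, Rmult_le_pos; [lra|apply pos_INR]).
    assert (0 <= Cmod c * (l * INR k) ^ n) by (apply Rmult_le_pos; lra). lra. }
  exists rho. split; [intros; apply Hrho|]. split; [intros k; apply Hrho|]. split; auto.
  set (Lk := fun k => ln (Rmax (exp 1) (T f (rho k)))).
  assert (HL1 : forall k, 1 <= Lk k).
  { intros k. unfold Lk. rewrite <- (ln_exp 1) at 1. apply ln_le_mono; [apply exp_pos|apply Rmax_l]. }
  assert (HLmono : forall j k, (j <= k)%nat -> Lk j <= Lk k).
  { intros j k H. induction H as [|k H IH]; [lra|]. eapply Rle_trans; [exact IH|].
    unfold Lk. apply ln_le_mono.
    - eapply Rlt_le_trans; [apply exp_pos|apply Rmax_l].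
    - apply Rle_max_compat_l; auto. }
  (* (|c| l^n)^sigma, the constant left when (|c| (l (k + 1))^n)^sigma is written as a multiple of
     (k + 1)^(n sigma). *)
  set (A := exp (sigma * (ln (Cmod c) + INR n * ln l))).
  assert (HA : 0 < A) by apply exp_pos.
  (* From node [k1] on the growth hypothesis applies; earlier nodes are bounded by the value at [k1]
     through monotonicity. *)
  destruct (INR_unbounded (Rmax R0 (exp 1) / Cmod c)) as [k1 Hk1].
  assert (He1 : 2 <= exp 1) by (pose proof (exp_ineq1_le 1); lra).
  assert (Hlarge : forall k, (k1 <= k)%nat -> Rmax R0 (exp 1) <= rho k).
  { intros k Hk. apply le_INR in Hk. destruct (Hrho k) as [[H1 _] _].
    pose proof (Rmax_r R0 (exp 1)).
    assert (Hk0 : 0 < Rmax R0 (exp 1) / Cmod c) by (apply Rdiv_lt_0_compat; lra).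
    assert (Hk1' : 1 <= INR k).
    { destruct k as [|k]; [simpl in Hk; lra|]. rewrite S_INR. pose proof (pos_INR k). lra. }
    assert (Hlk : INR k <= (l * INR k) ^ n).
    { apply Rle_trans with (l * INR k); [nra|]. rewrite <- (pow_1 (l * INR k)) at 1.
      apply Rle_pow; auto. nra. }
    assert (Cmod c * (Rmax R0 (exp 1) / Cmod c) <= Cmod c * (l * INR k) ^ n)
      by (apply Rmult_le_compat_l; lra).
    replace (Cmod c * (Rmax R0 (exp 1) / Cmod c)) with (Rmax R0 (exp 1)) in * by (field; lra). lra. }
  assert (Hbig : forall k, 1 <= Rpower (INR k + 1) (INR n * sigma)).
  { intros k. apply Rle_trans with (Rpower (INR k + 1) 0).
    { pose proof (pos_INR k). rewrite Rpower_O; lra. }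
    apply Rle_Rpower; [pose proof (pos_INR k); lra|]. apply Rmult_le_pos; [apply pos_INR|lra]. }
  exists (1 + A + Lk k1). split; [specialize (HL1 k1); lra|]. intros k. fold (Lk k).
  specialize (Hbig k). set (x := Rpower (INR k + 1) (INR n * sigma)) in *.
  destruct (Nat.le_ge_cases k k1) as [Hk|Hk].
  - pose proof (HLmono k k1 Hk). pose proof (HL1 k1).
    assert ((1 + A + Lk k1) * 1 <= (1 + A + Lk k1) * x) by (apply Rmult_le_compat_l; lra). lra.
  - pose proof (HL1 k1). specialize (Hlarge k Hk).
    pose proof (Rmax_l R0 (exp 1)). pose proof (Rmax_r R0 (exp 1)).
    destruct (Rle_dec (T f (rho k)) (exp 1)) as [Ht|Ht].
    + unfold Lk at 1. rewrite Rmax_left, ln_exp by auto.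
      assert (1 * 1 <= (1 + A + Lk k1) * x) by (apply Rmult_le_compat; lra). lra.
    + unfold Lk at 1. rewrite Rmax_right by lra.
      assert (Hh : ln (T f (rho k)) <= exp (sigma * ln (rho k))).
      { apply hyperorder_bound; try lra. apply HT. lra. }
      assert (HxA : exp (sigma * ln (rho k)) <= A * x).
      { unfold A, x, Rpower. rewrite <- exp_plus. apply exp_le_mono.
        replace (sigma * (ln (Cmod c) + INR n * ln l) + INR n * sigma * ln (INR k + 1))
          with (sigma * (ln (Cmod c) + INR n * (ln l + ln (INR k + 1)))) by ring.
        apply Rmult_le_compat_l; [lra|]. pose proof (pos_INR k).
        rewrite <- ln_mult, <- ln_pow, <- ln_mult by (try apply pow_lt; nra).
        apply ln_le_mono; [lra|]. destruct (Hrho k). lra. }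
      assert (A * x <= (1 + A + Lk k1) * x) by (apply Rmult_le_compat_r; lra). lra.
Qed.

(** [a] and [b] are T f at two nodes around |c| r^n, and [S] is the value in between. *)
Lemma squeeze_estimate (eps a b S TF K : R) : 0 < eps <= 1 / 20 -> 0 <= a -> a <= S <= b ->
  b <= (1 + eps) * a -> K <= eps * a -> TF <= (1 + 2 * eps) * b + K ->
  a <= (1 + eps) * TF + 4 * eps * b + 2 * K -> Rabs (TF - S) <= 20 * eps * S.
Proof.
  intros He Ha HS Hb HK HU HL.
  assert (E1 : eps * b <= eps * ((1 + eps) * a)) by (apply Rmult_le_compat_l; lra).
  assert (E2 : eps * a <= eps * S) by (apply Rmult_le_compat_l; lra).
  assert (E3 : eps * (eps * a) <= 1 / 20 * (eps * a)).
  { apply Rmult_le_compat_r; [apply Rmult_le_pos|]; lra. }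
  apply Rabs_le. split.
  (* 4 eps b costs at most 4.2 eps a, by E3, and 2 K at most 2 eps a; together less than 7 eps a. *)
  - assert (HTF : a * (1 - 7 * eps) <= (1 + eps) * TF) by lra.
    destruct (Rle_dec 0 (S - TF)) as [H|H].
    + assert (0 <= eps * (S - TF)) by (apply Rmult_le_pos; lra). lra.
    + assert (0 <= eps * S) by (apply Rmult_le_pos; lra). lra.
  - lra.
Qed.

Theorem theorem6 (n : nat) (c : Cx) (p : nat -> Cx) (f : Cx -> Cx) :
  (1 <= n)%nat ->
  c <> C0 ->
  meromorphic f ->
  (* limsup_{r -> oo} log log T(r,f) / log r < 1/n^2 *)
  (exists sigma, sigma < 1 / (INR n) ^ 2 /\
     exists R0, forall r, R0 <= r -> ln (ln (T f r)) / ln r <= sigma) ->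
  exists E : R -> Prop, finite_log_measure E /\
    forall eps, 0 < eps -> exists R0, forall r, R0 <= r -> ~ E r ->
      Rabs (T (fun z => f (omega n c p z)) r - T f (Cabs c * r ^ n))
        <= eps * T f (Cabs c * r ^ n).
Proof.
  intros Hn Hc Hf [sigma0 [Hsig [R0 HT0]]].
  set (om := omega n c p).
  pose proof (omega_is_poly n c p) as HP. fold om in HP.
  destruct (root_map_exists n c om Hn Hc HP) as [rts Hom].
  destruct (bad_radii_countable n c om rts f Hom HP Hf) as [x Hx].
  destruct (monomial_bad_radii n c f Hn Hc Hf) as [y Hy].
  destruct (comp_estimate n c om rts f Hom HP Hf) as [l [Hl Hest]].
  pose proof (Cmod_pos c Hc) as Hc0. change (Cabs c) with (Cmod c).
  assert (HnR : 1 <= INR n) by (apply (le_INR 1); auto).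
  (* [sigma0] may be negative; the maximum is still below 1 / n^2 and gives a positive exponent n
     sigma. *)
  set (sigma := Rmax sigma0 (1 / (2 * INR n ^ 2))).
  assert (Hn2 : 0 < INR n ^ 2) by (apply pow_lt; lra).
  assert (Hs1 : 0 < sigma).
  { eapply Rlt_le_trans; [|apply Rmax_r]. apply Rdiv_lt_0_compat; lra. }
  assert (Hs2 : INR n * sigma < 1).
  { assert (sigma < 1 / INR n ^ 2).
    { apply Rmax_lub_lt; auto. unfold Rdiv. rewrite !Rmult_1_l. apply Rinv_lt_contravar; nra. }
    assert (INR n * sigma < INR n * (1 / INR n ^ 2)) by (apply Rmult_lt_compat_l; lra).
    replace (INR n * (1 / INR n ^ 2)) with (/ INR n) in * by (field; lra).
    assert (/ INR n <= / 1) by (apply Rinv_le_contravar; lra). lra. }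
  assert (HT : forall r, R0 <= r -> ln (ln (T f r)) / ln r <= sigma).
  { intros r Hr. eapply Rle_trans; [apply HT0; auto|apply Rmax_l]. }
  destruct (exists_nodes n c f l sigma R0 Hn Hc Hf Hl Hs1 Hs2 HT)
    as [rho [Hrho [Hgrho [Hmono [M [HM HLM]]]]]].
  set (L := fun k => ln (Rmax (exp 1) (T f (rho k)))).
  assert (HL1 : forall k, 1 <= L k).
  { intros k. unfold L. rewrite <- (ln_exp 1) at 1. apply ln_le_mono; [apply exp_pos|apply Rmax_l]. }
  assert (HLmono : forall k, L k <= L (S k)).
  { intros k. unfold L. apply ln_le_mono.
    - eapply Rlt_le_trans; [apply exp_pos|apply Rmax_l].
    - apply Rle_max_compat_l; auto. }
  destruct (slow_growth_off_few_cells L M (INR n * sigma)) as [bad [Hbad [B HB]]]; auto.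
  { split; auto. apply Rmult_lt_0_compat; lra. }
  exists (fun r => (exists k, bad k /\ l * (INR k + 2) <= r <= l * (INR k + 3)) \/
    ((1 <= r /\ exists k, x k = r) \/ (1 <= r /\ exists k, y k = r))).
  split.
  { apply finite_log_measure_union; [apply finite_log_measure_cells with (B := B); auto|].
    apply finite_log_measure_union; apply finite_log_measure_countable. }
  intros eps Heps.
  assert (Hgood : forall r, 1 <= r -> ~ ((1 <= r /\ exists k, x k = r) \/ (1 <= r /\ exists k, y k = r)) ->
    (forall z, Cmod z = r -> Cdiff f (om z)) /\ (forall z, Cmod z = Cmod c * r ^ n -> Cdiff f z)).
  { intros r Hr Hnb. split.
    - intros z Hz. apply NNPP. intros Hs. destruct (Hx z Hs) as [k Hk]. apply Hnb. left.
      split; auto. exists k. lra.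
    - apply Hy; [lra|]. intros k Hk. apply Hnb. right. eauto. }
  assert (Hmono' : forall j k, (j <= k)%nat -> T f (rho j) <= T f (rho k)).
  { intros j k H. induction H as [|k H IH]; [lra|]. eapply Rle_trans; [exact IH|auto]. }
  destruct (classic (exists M0, forall k, T f (rho k) <= M0)) as [[M0 HM0]|Hunb].
  - exists (1 + / Cmod c). intros r Hr HnE.
    assert (Hci : 0 < / Cmod c) by (apply Rinv_0_lt_compat; auto).
    destruct (Hgood r ltac:(lra) ltac:(tauto)) as [G1 G2].
    assert (Hrn : r <= r ^ n).
    { rewrite <- (pow_1 r) at 1. apply Rle_pow; auto. lra. }
    assert (HS1 : 1 <= Cmod c * r ^ n).
    { replace 1 with (Cmod c * / Cmod c) by (field; lra). apply Rmult_le_compat_l; lra. }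
    rewrite (T_bounded_eq n c om rts f M0 r (Cmod c * r ^ n)); auto; try lra.
    + rewrite Rminus_diag, Rabs_R0. apply Rmult_le_pos; [lra|]. apply T_nonneg; auto.
    + intros r0. destruct (INR_unbounded (Rmax 1 (r0 / Cmod c))) as [k Hk].
      exists (rho k). split; [|split; [apply Hgrho|apply HM0]].
      pose proof (Rmax_l 1 (r0 / Cmod c)). pose proof (Rmax_r 1 (r0 / Cmod c)).
      destruct (Hrho k) as [Hk1 _].
      assert (Hlk : INR k <= (l * INR k) ^ n).
      { apply Rle_trans with (l * INR k); [nra|]. rewrite <- (pow_1 (l * INR k)) at 1.
        apply Rle_pow; auto. nra. }
      assert (Cmod c * (r0 / Cmod c) <= Cmod c * (l * INR k) ^ n) by (apply Rmult_le_compat_l; lra).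
      replace (Cmod c * (r0 / Cmod c)) with r0 in * by (field; lra). lra.
  - set (e := Rmin (1 / 20) (eps / 20)).
    assert (He : 0 < e) by (apply Rmin_pos; lra).
    assert (He1 : e <= 1 / 20) by apply Rmin_l. assert (He2 : e <= eps / 20) by apply Rmin_r.
    destruct (Hest e) as [K [r0 [HK [Hr0 Hcomp]]]]; [lra|].
    assert (Hln : 0 < ln (1 + e)) by (rewrite <- ln_1; apply ln_increasing; lra).
    destruct (Hbad (ln (1 + e)) Hln) as [k1 Hk1].
    (* From node [k2] on, the maximum inside [L] is T f itself, and the additive constant [K] is at
       most [e] times T f. *)
    assert (Hk2 : exists k2, Rmax (exp 1) (K / e) < T f (rho k2)).
    { apply NNPP. intros Hno. apply Hunb. exists (Rmax (exp 1) (K / e)). intros k.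
      apply Rnot_lt_le. intros Hlt. apply Hno. eauto. }
    destruct Hk2 as [k2 Hk2].
    exists (r0 + l * (INR k1 + INR k2 + 3)). intros r Hr HnE.
    assert (Hr1 : 1 <= r).
    { pose proof (pos_INR k1). pose proof (pos_INR k2).
      assert (0 <= l * (INR k1 + INR k2 + 3)) by (apply Rmult_le_pos; lra). lra. }
    destruct (Hgood r Hr1 ltac:(tauto)) as [G1 G2].
    destruct (nfloor_ex (r / l)) as [N [HN1 HN2]]; [apply Rdiv_le_0_compat; lra|].
    assert (Erl : r = l * (r / l)) by (field; lra).
    assert (HNk : (k1 + k2 + 2 <= N)%nat).
    { apply INR_le. rewrite !plus_INR. simpl (INR 2).
      assert (Hlr : INR k1 + INR k2 + 3 <= r / l).
      { apply Rmult_le_reg_l with l; [lra|]. rewrite <- Erl. lra. }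
      lra. }
    (* Cell [k] is [l (k + 2), l (k + 3)], hence the shift by 2 from the integer part of r / l. *)
    set (k := (N - 2)%nat).
    assert (EN : INR N = INR k + 2).
    { replace N with (k + 2)%nat by (unfold k; lia). rewrite plus_INR. simpl. ring. }
    assert (Hcell : l * (INR k + 2) <= r <= l * (INR k + 3)).
    { rewrite Erl. split; apply Rmult_le_compat_l; lra. }
    assert (Hnb : ~ bad k) by (intros Hb; apply HnE; left; exists k; auto).
    specialize (Hk1 k ltac:(unfold k; lia) Hnb).
    pose proof (pos_INR k) as Hk0.
    assert (Hlk0 : 0 <= l * INR k) by (apply Rmult_le_pos; lra).
    destruct (Hrho k) as [Ha1 Ha2]. destruct (Hrho (k + 4)%nat) as [Hb1 Hb2].
    rewrite plus_INR in Hb1, Hb2. simpl (INR 4) in Hb1, Hb2.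
    assert (Hrk : 0 < rho k).
    { eapply Rle_lt_trans; [|exact Ha1]. apply Rmult_le_pos; [lra|]. apply pow_le; auto. }
    (* On cell [k] one has r - l >= l (k + 1) and r + l <= l (k + 4), so the nodes [k] and [k + 4]
       enclose both shifted radii; this is why growth is measured across four steps. *)
    assert (Hlow : rho k <= Cmod c * (r - l) ^ n).
    { left. eapply Rlt_le_trans; [exact Ha2|]. apply Rmult_le_compat_l; [lra|]. apply pow_incr. lra. }
    assert (Hupp : Cmod c * (r + l) ^ n <= rho (k + 4)%nat).
    { left. eapply Rle_lt_trans; [|exact Hb1]. apply Rmult_le_compat_l; [lra|]. apply pow_incr. lra. }
    destruct (Hcomp r (rho k) (rho (k + 4)%nat)) as [HU HLo]; auto.
    { assert (0 <= l * (INR k1 + INR k2 + 3)); [|lra].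
      pose proof (pos_INR k1). pose proof (pos_INR k2). apply Rmult_le_pos; lra. }
    { apply Hgrho. }
    { apply Hgrho. }
    assert (Hpm : (r - l) ^ n < r ^ n /\ r ^ n < (r + l) ^ n).
    { assert (Hlt : forall u v, 0 <= u < v -> u ^ n < v ^ n).
      { intros u v Huv. assert (Hle : u ^ n <= v ^ n) by (apply pow_incr; lra).
        destruct Hle as [|E]; auto. apply pow_inj_pos in E; auto; lra. }
      split; apply Hlt; lra. }
    destruct Hpm as [Hp1 Hp2].
    assert (Hm1 : Cmod c * (r - l) ^ n < Cmod c * r ^ n) by (apply Rmult_lt_compat_l; auto).
    assert (Hm2 : Cmod c * r ^ n < Cmod c * (r + l) ^ n) by (apply Rmult_lt_compat_l; auto).
    assert (HS1 : T f (rho k) <= T f (Cmod c * r ^ n)) by (apply T_monotone; auto; [lra|apply Hgrho]).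
    assert (HS2 : T f (Cmod c * r ^ n) <= T f (rho (k + 4)%nat)) by (apply T_monotone; auto; [lra|apply Hgrho]).
    assert (Hak : Rmax (exp 1) (K / e) < T f (rho k)).
    { eapply Rlt_le_trans; [exact Hk2|]. apply Hmono'. unfold k. lia. }
    pose proof (Rmax_l (exp 1) (K / e)). pose proof (Rmax_r (exp 1) (K / e)).
    assert (Ha0 : 0 < T f (rho k)) by (pose proof (exp_pos 1); lra).
    assert (HKa : K <= e * T f (rho k)).
    { replace K with (e * (K / e)) by (field; lra). apply Rmult_le_compat_l; lra. }
    assert (Hba : T f (rho (k + 4)%nat) <= (1 + e) * T f (rho k)).
    { unfold L in Hk1. rewrite !Rmax_right in Hk1 by lra.
      rewrite <- (exp_ln (T f (rho (k + 4)%nat))) by lra.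
      rewrite <- (exp_ln ((1 + e) * T f (rho k))) by (apply Rmult_lt_0_compat; lra).
      apply exp_le_mono. rewrite ln_mult by lra. lra. }
    eapply Rle_trans.
    + apply (squeeze_estimate e (T f (rho k)) (T f (rho (k + 4)%nat)) (T f (Cmod c * r ^ n))
        (T (fun z => f (om z)) r) K); auto; lra.
    + apply Rmult_le_compat_r; lra.
Qed.
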